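(* Let $B$ be a finite Blaschke product such that $B(0)=0$, let $K_B=\mathcal{H}^2\ominus B\mathcal{H}^2$, and let $\|\cdot\|$ be any fixed norm on the finite-dimensional space $K_B$. For $f$ holomorphic on $\mathbb{D}$: (1) $f\in\mathcal{H}^2$ if and only if $f=\sum_{k=0}^\infty g_kB^k$ (convergence in $\mathcal{H}^2$ norm) with $g_k\in K_B$ for all $k$ and $\sum_{k=0}^\infty\|g_k\|^2<\infty$. (2) $f\in\mathcal{D}$ if and only if $f=\sum_{k=0}^\infty g_kB^k$ (convergence in $\mathcal{D}$ norm) with $g_k\in K_B$ for all $k$ and $\sum_{k=0}^\infty(k+1)\|g_k\|^2<\infty$. (3) $f\in\mathcal{A}^2$ if and only if $f=\sum_{k=0}^\infty g_kB^k$ (convergence in $\mathcal{A}^2$ norm) with $g_k\in K_B$ for all $k$ and $\sum_{k=0}^\infty\|g_k\|^2/(k+1)<\infty$.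
   Context: $\mathbb{D}$ is the open unit disc in $\mathbb{C}$ and $A$ is normalized Lebesgue area measure on $\mathbb{D}$. The Dirichlet space $\mathcal{D}$ is the space of holomorphic $f$ on $\mathbb{D}$ with $\|f\|_{\mathcal{D}}^2=|f(0)|^2+\int_{\mathbb{D}}|f'(z)|^2\,dA(z)<\infty$. $\mathcal{H}^2$ and $\mathcal{A}^2$ denote the Hardy and (unweighted) Bergman spaces on $\mathbb{D}$ with their usual norms. For a finite Blaschke product $B$, the model space $K_B=\mathcal{H}^2\ominus B\mathcal{H}^2$ is the orthogonal complement of $B\mathcal{H}^2$ in $\mathcal{H}^2$; it has finite dimension $\deg B$, so all norms on it are equivalent and the choice of norm on $K_B$ is immaterial. *)

(* Defs.v *)
From HB Require Import structures.
From mathcomp Require Import all_boot all_order all_algebra.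
From mathcomp Require Import complex.
From mathcomp Require Import all_classical all_reals all_analysis.

Set Implicit Arguments.
Unset Strict Implicit.
Unset Printing Implicit Defensive.

Import Order.TTheory GRing.Theory Num.Theory.
Import numFieldNormedType.Exports.

Local Open Scope classical_set_scope.
Local Open Scope ring_scope.
Local Open Scope complex_scope.

(* R[i] packed as a numFieldType: over it, [derivable] and [derive1] are complex
   differentiability and the complex derivative, and the topology is that of
   the modulus. *)
Definition cplx (R : realType) : numFieldType := R[i].

Notation normc := Normc.normc.

Section Spaces.
Variable R : realType.
Implicit Types (f g h B : R[i] -> R[i]) (r : R) (z : R[i]).

(* Functions on the disc are represented by total functions on R[i]; every
   notion below depends only on their values on [disc]. *)
Definition disc : set R[i] := [set z | normc z < 1].

Definition holomorphic_on_disc f : Prop :=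
  forall z, disc z -> derivable (f : cplx R -> cplx R) z 1.

Definition area_integral (u : R[i] -> \bar R) : \bar R :=
  ((pi^-1)%:E *
   \int[lebesgue_measure \x lebesgue_measure]_(p in
      [set p : R * R | disc (p.1 +i* p.2)]) u (p.1 +i* p.2))%E.

Definition circle_point r (t : R) : R[i] := (r * cos t) +i* (r * sin t).

Definition circle_mean_sq f r : \bar R :=
  (((2 * pi)^-1)%:E *
   \int[lebesgue_measure]_(t in `[0%R, (2 * pi)%R])
      ((normc (f (circle_point r t)) ^+ 2)%:E))%E.

Definition hardy_norm f : \bar R :=
  sqrte (ereal_sup [set circle_mean_sq f r | r in `[0, 1[]).

Definition hardy : set (R[i] -> R[i]) :=
  [set f | holomorphic_on_disc f /\ (hardy_norm f < +oo)%E].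

Definition circle_inner f g r : R[i] :=
  let F t := f (circle_point r t) * conjc (g (circle_point r t)) in
  ((2 * pi)^-1)%:C *
  ((\int[lebesgue_measure]_(t in `[0, 2 * pi]) complex.Re (F t)) +i*
   (\int[lebesgue_measure]_(t in `[0, 2 * pi]) complex.Im (F t))).

(* The limit exists for f and g in the Hardy space. *)
Definition hardy_inner f g : R[i] :=
  lim ((circle_inner f g r : cplx R) @[r --> 1^'-]).

Definition dirichlet_norm f : \bar R :=
  sqrte ((normc (f 0) ^+ 2)%:E
         + area_integral (fun z =>
             (normc (derive1 (f : cplx R -> cplx R) z) ^+ 2)%:E))%E.

Definition dirichlet : set (R[i] -> R[i]) :=
  [set f | holomorphic_on_disc f /\ (dirichlet_norm f < +oo)%E].

Definition bergman_norm f : \bar R :=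
  sqrte (area_integral (fun z => (normc (f z) ^+ 2)%:E)).

Definition bergman : set (R[i] -> R[i]) :=
  [set f | holomorphic_on_disc f /\ (bergman_norm f < +oo)%E].

(* Zeros are listed with multiplicity in [s]. *)
Definition finite_blaschke_product B : Prop :=
  exists (c : R[i]) (s : seq R[i]),
    [/\ normc c = 1, (forall a, a \in s -> disc a) &
        forall z, disc z ->
          B z = c * \prod_(a <- s) ((z - a) / (1 - conjc a * z))].

Definition model_space B : set (R[i] -> R[i]) :=
  [set h | hardy h /\
           forall g, hardy g -> hardy_inner h (fun z => B z * g z) = 0].

(* By separation and the triangle inequality, such an N takes equal values on
   functions that agree on the disc. *)
Record is_norm_on (V : set (R[i] -> R[i])) (N : (R[i] -> R[i]) -> R) : Prop :=
  IsNormOn {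
    norm_on_ge0 : forall g, V g -> 0 <= N g;
    norm_on_eq0 : forall g, V g ->
      (N g = 0 <-> forall z, disc z -> g z = 0);
    norm_onZ : forall c g, V g -> N (fun z => c * g z) = normc c * N g;
    norm_onD : forall g h, V g -> V h -> N (fun z => g z + h z) <= N g + N h
  }.

Definition blaschke_series_cvg (nrm : (R[i] -> R[i]) -> \bar R) B
    (g : nat -> R[i] -> R[i]) f : Prop :=
  nrm (fun z => f z - \sum_(k < n) g k z * B z ^+ k) @[n --> \oo] --> 0%E.

End Spaces.

(* Main.v *)
Require Import Defs.
From HB Require Import structures.
From mathcomp Require Import all_boot all_order all_algebra.
From mathcomp Require Import complex.
From mathcomp Require Import all_classical all_reals all_analysis.
From mathcomp Require Import measurable_realfun.
From mathcomp Require Import ring lra.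

(** The theorem is first reduced to a statement on Taylor coefficients. A
    holomorphic function on the disc is the sum of a power series, by Cauchy's
    theorem (lemma [holo_rep]). The Hardy, Dirichlet and Bergman norms are
    comparable to the energies [\sum_n w_n |a_n|^2] of the Taylor coefficients
    with weights [1], [n + 1] and [1 / (n + 1)]: for the Hardy norm by
    Parseval's formula on circles, and for the area integrals by averaging
    over rotations, which reduces them to the moments of the disc (lemma
    [area_series]).

    Let [B] have the zeros [s], the origin among them. The model space
    consists of the functions [p / \prod_(a <- s) (1 - a^* z)] with [p] a
    polynomial of degree smaller than the number of zeros; its elements have
    geometrically decaying coefficients, so all weighted energies are
    comparable on it.

    The heart of the matter is that for finite sums [f = \sum_(k < m) g_k B^k]
    with [g_k] in the model space the energy of [f] with weight [w] is
    comparable, uniformly in [m], to [\sum_(k < m) w_k |g_k|^2]. For the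
    weight [1] this is an equality, since multiplication by [B] is isometric
    on the Hardy space and its range is orthogonal to the model space. For the
    weight [n + 1] one uses that the Dirichlet integral of [B y] exceeds that
    of [y] by an amount between [|y|^2] and a multiple of it (lemmas
    [enn_MB_ge] and [enn_MB_le]): with the Horner scheme [g_0 + B y] both
    bounds follow by induction, the cross term being absorbed by the gain
    [|y|^2]. The weight [1 / (n + 1)] is obtained from [n + 1] by duality
    (lemma [expansion_likeb]).

    Since [B] vanishes at the origin, division by [B] lowers the degree, so
    polynomials have finite expansions (lemma [poly_FS]). The truncations of
    the power series of [f] therefore have expansions, which by the two-sided
    bound form a Cauchy sequence; their limit is the expansion of [f] (lemma
    [expansion_exists]). Conversely, if the series of the [g_k B^k] converges
    to [f] in one of the norms, some remainder has finite norm, while the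
    partial sums have geometrically decaying coefficients; hence [f] lies in
    the space. *)

Import Order.TTheory GRing.Theory Num.Theory.
Import numFieldNormedType.Exports.

Local Open Scope classical_set_scope.
Local Open Scope ring_scope.
Local Open Scope complex_scope.

Set Implicit Arguments.
Unset Strict Implicit.
Unset Printing Implicit Defensive.

(** * Moduli of complex numbers *)

Section Modulus.
Variable R : realType.
Implicit Types x y z : R[i].

Lemma ncD x y : normc (x + y) <= normc x + normc y.
Proof. exact: le_normcD. Qed.

Lemma ncM x y : normc (x * y) = normc x * normc y.
Proof. exact: Normc.normcM. Qed.

Lemma ncN x : normc (- x) = normc x.
Proof. exact: normcN. Qed.

Lemma ncB x y : normc (x - y) <= normc x + normc y.
Proof. by rewrite -[X in _ <= _ + X]ncN ncD. Qed.

Lemma nc0 : normc (0 : R[i]) = 0.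
Proof. exact: Normc.normc0. Qed.

Lemma nc1 : normc (1 : R[i]) = 1.
Proof. exact: Normc.normc1. Qed.

Lemma ncV x : normc (x^-1) = (normc x)^-1.
Proof. exact: Normc.normcV. Qed.

Lemma nc_ge0 x : 0 <= normc x.
Proof. by case: x => a b; rewrite /normc sqrtr_ge0. Qed.

Lemma nc_eq0 x : (normc x == 0) = (x == 0).
Proof.
by apply/eqP/eqP => [/Normc.eq0_normc //|->]; exact: nc0.
Qed.

Lemma nc_gt0 x : (0 < normc x) = (x != 0).
Proof. by rewrite lt_def nc_ge0 andbT nc_eq0. Qed.

Lemma ncX x n : normc (x ^+ n) = normc x ^+ n.
Proof. by elim: n => [|n IH]; rewrite ?expr0 ?nc1 // !exprS ncM IH. Qed.

Lemma ncC x y : normc (x - y) = normc (y - x).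
Proof. by rewrite -ncN opprB. Qed.

Lemma nc_dist x y z : normc (x - z) <= normc (x - y) + normc (y - z).
Proof. by apply: (le_trans _ (ncD _ _)); rewrite addrA subrK. Qed.

Lemma nc_sub_le x y : normc x - normc y <= normc (x - y).
Proof. by rewrite lerBlDr; apply: (le_trans _ (ncD _ _)); rewrite subrK. Qed.

Lemma nc_conj z : normc (conjc z) = normc z.
Proof. by case: z => a b; rewrite /normc /= sqrrN. Qed.

Lemma nc_sqr z : normc z ^+ 2 = complex.Re z ^+ 2 + complex.Im z ^+ 2.
Proof. by case: z => a b; rewrite /normc /= sqr_sqrtr // addr_ge0 ?sqr_ge0. Qed.

Lemma nc_sqrE z : normc z ^+ 2 = complex.Re (z * conjc z).
Proof. by rewrite nc_sqr; case: z => a b /=; ring. Qed.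

Lemma nc_Re z : `|complex.Re z| <= normc z.
Proof.
rewrite -(@ler_pXn2r _ 2) ?nnegrE ?nc_ge0 // nc_sqr.
by rewrite -normrX ger0_norm ?sqr_ge0 // lerDl sqr_ge0.
Qed.

Lemma nc_Im z : `|complex.Im z| <= normc z.
Proof.
rewrite -(@ler_pXn2r _ 2) ?nnegrE ?nc_ge0 // nc_sqr.
by rewrite -normrX ger0_norm ?sqr_ge0 // lerDr sqr_ge0.
Qed.

Lemma nc_le_ReIm z : normc z <= `|complex.Re z| + `|complex.Im z|.
Proof.
rewrite -(@ler_pXn2r _ 2) ?nnegrE ?nc_ge0 ?addr_ge0 // nc_sqr sqrrD.
rewrite -!normrX !(ger0_norm (sqr_ge0 _)) -addrA lerD2l lerDr.
by rewrite mulrn_wge0 // mulr_ge0.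
Qed.

Lemma nc_real (a : R) : normc a%:C = `|a|.
Proof. by rewrite /normc /= expr0n addr0 sqrtr_sqr. Qed.

Lemma nc_nat n : normc (n%:R : R[i]) = n%:R.
Proof.
have -> : (n%:R : R[i]) = (n%:R : R)%:C by rewrite rmorph_nat.
by rewrite nc_real ger0_norm.
Qed.

Lemma nc_sum (I : Type) (s : seq I) (P : pred I) (F : I -> R[i]) :
  normc (\sum_(i <- s | P i) F i) <= \sum_(i <- s | P i) normc (F i).
Proof.
elim/big_rec2 : _ => [|i y1 y2 _ h]; first by rewrite nc0.
by apply: (le_trans (ncD _ _)); rewrite lerD2l.
Qed.

Lemma conj_ncE z : z * conjc z = (normc z ^+ 2)%:C.
Proof.
rewrite nc_sqr; case: z => a b /=; rewrite /GRing.mul /=; congr (_ +i* _); ring.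
Qed.

Lemma ReD x y : complex.Re (x + y) = complex.Re x + complex.Re y.
Proof. by case: x => a b; case: y. Qed.

Lemma ImD x y : complex.Im (x + y) = complex.Im x + complex.Im y.
Proof. by case: x => a b; case: y. Qed.

Lemma ReN x : complex.Re (- x) = - complex.Re x.
Proof. by case: x. Qed.

Lemma ImN x : complex.Im (- x) = - complex.Im x.
Proof. by case: x. Qed.

Lemma ReM x y : complex.Re (x * y) =
  complex.Re x * complex.Re y - complex.Im x * complex.Im y.
Proof. by case: x => a b; case: y. Qed.

Lemma ImM x y : complex.Im (x * y) =
  complex.Re x * complex.Im y + complex.Im x * complex.Re y.
Proof. by case: x => a b; case: y. Qed.

Lemma ReJ z : complex.Re (conjc z) = complex.Re z.
Proof. by case: z. Qed.

Lemma ImJ z : complex.Im (conjc z) = - complex.Im z.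
Proof. by case: z. Qed.

Lemma Re_sum (I : Type) (s : seq I) (P : pred I) (F : I -> R[i]) :
  complex.Re (\sum_(i <- s | P i) F i) = \sum_(i <- s | P i) complex.Re (F i).
Proof. by elim/big_rec2 : _ => // i y1 y2 _ <-; rewrite ReD. Qed.

Lemma c_ext x y : complex.Re x = complex.Re y -> complex.Im x = complex.Im y ->
  x = y.
Proof. by case: x => a b; case: y => c d /= -> ->. Qed.

End Modulus.

(** * Limits of complex sequences *)

Section Limits.
Variable R : realType.
Implicit Types (u v : nat -> R[i]) (x l : R[i]).

Lemma cvgnP (b : nat -> R) (l : R) : b n @[n --> \oo] --> l <->
  forall e, 0 < e -> exists N, forall n, (N <= n)%N -> `|b n - l| <= e.
Proof.
split=> [/cvgrPdist_le h e e0|h].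
  by have [N _ hN] := h e e0; exists N => n Nn; rewrite distrC; exact: hN.
apply/cvgrPdist_le => e e0; have [N hN] := h e e0.
by exists N => // n /= Nn; rewrite distrC; exact: hN.
Qed.

(** Convergence in [R[i]], read through the real-valued modulus. *)
Definition cto u l : Prop := normc (u n - l) @[n --> \oo] --> (0 : R).

Lemma ctoP u l : cto u l <->
  forall e, 0 < e -> exists N, forall n, (N <= n)%N -> normc (u n - l) <= e.
Proof.
split=> [/cvgnP h e e0|h]; last apply/cvgnP => e e0.
  have [N hN] := h e e0; exists N => n Nn.
  by have := hN n Nn; rewrite subr0 ger0_norm ?nc_ge0.
have [N hN] := h e e0; exists N => n Nn.
by rewrite subr0 ger0_norm ?nc_ge0 ?hN.
Qed.

Lemma real_squeeze0 (b c : nat -> R) : (forall n, 0 <= b n <= c n) ->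
  c n @[n --> \oo] --> 0 -> b n @[n --> \oo] --> 0.
Proof.
move=> bc c0; apply: (@squeeze_cvgr _ _ _ _ (cst 0) c) => //.
  by apply: nearW => n; exact: bc.
exact: cvg_cst.
Qed.

Lemma cto_le u l (c : nat -> R) : (forall n, normc (u n - l) <= c n) ->
  c n @[n --> \oo] --> 0 -> cto u l.
Proof. by move=> h; apply: real_squeeze0 => n; rewrite nc_ge0 h. Qed.

Lemma cto_eq u v x : u =1 v -> cto u x -> cto v x.
Proof. by move=> /funext ->. Qed.

Lemma cto_cst x : cto (fun=> x) x.
Proof. by apply/ctoP => e e0; exists 0%N => n _; rewrite subrr nc0 ltW. Qed.

Lemma ctoD u v x y : cto u x -> cto v y -> cto (fun n => u n + v n) (x + y).
Proof.
move=> ux vy; apply: (@cto_le _ _ (fun n => normc (u n - x) + normc (v n - y))).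
  by move=> n /=; apply: (le_trans _ (ncD _ _)); rewrite opprD addrACA.
by rewrite -[X in _ --> X](addr0 (0:R)); exact: cvgD.
Qed.

Lemma ctoZ (c : R[i]) u x : cto u x -> cto (fun n => c * u n) (c * x).
Proof.
move=> ux; apply: (@cto_le _ _ (fun n => normc c * normc (u n - x))).
  by move=> n; rewrite -ncM mulrBr.
by rewrite -[X in _ --> X](mulr0 (normc c)); apply: cvgMr.
Qed.

Lemma ctoN u x : cto u x -> cto (fun n => - u n) (- x).
Proof. by move=> ux; apply: (cto_le _ ux) => n; rewrite -opprD ncN. Qed.

Lemma ctoB u v x y : cto u x -> cto v y -> cto (fun n => u n - v n) (x - y).
Proof. by move=> ux vy; apply: ctoD => //; exact: ctoN. Qed.

Lemma cto_bound u x (M : R) : cto u x -> (forall n, normc (u n) <= M) ->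
  normc x <= M.
Proof.
move=> /ctoP ux uM; apply/ler_addgt0Pr => e e0; have [N /(_ N (leqnn N)) h] := ux e e0.
rewrite addrC; apply: (le_trans _ (lerD h (uM N))); rewrite ncC.
by apply: (le_trans _ (ncD _ _)); rewrite subrK.
Qed.

Lemma cto_uniq u x y : cto u x -> cto u y -> x = y.
Proof.
move=> ux uy; apply/eqP; rewrite -subr_eq0 -nc_eq0 eq_le nc_ge0 andbT.
by apply: cto_bound (ctoB ux uy) _ => n; rewrite subrr nc0.
Qed.

Lemma cto_shift u x k : cto u x -> cto (fun n => u (n + k)%N) x.
Proof.
move=> /ctoP h; apply/ctoP => e e0; have [N hN] := h e e0.
by exists N => n Nn; apply: hN; rewrite (leq_trans Nn) ?leq_addr.
Qed.

Lemma cto_ReIm u x : complex.Re (u n) @[n --> \oo] --> complex.Re x ->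
  complex.Im (u n) @[n --> \oo] --> complex.Im x -> cto u x.
Proof.
move=> hr hi; apply: (@cto_le _ _
  (fun n => `|complex.Re (u n) - complex.Re x| + `|complex.Im (u n) - complex.Im x|)).
  by move=> n /=; apply: (le_trans (nc_le_ReIm _)); rewrite ReD ReN ImD ImN.
have h0 (f : nat -> R) (a : R) : f n @[n --> \oo] --> a ->
    `|f n - a| @[n --> \oo] --> 0.
  move=> fa; rewrite -[X in _ --> X](normr0 R); apply: cvg_norm.
  by rewrite -(subrr a); apply: cvgB => //; exact: cvg_cst.
by rewrite -[X in _ --> X](addr0 (0:R)); apply: cvgD; exact: h0.
Qed.

Lemma cto_Re u x : cto u x -> complex.Re (u n) @[n --> \oo] --> complex.Re x.
Proof.
move=> /ctoP h; apply/cvgnP => e e0; have [N hN] := h e e0; exists N => n Nn.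
by apply: (le_trans _ (hN n Nn)); rewrite -ReN -ReD nc_Re.
Qed.

Lemma cto_Im u x : cto u x -> complex.Im (u n) @[n --> \oo] --> complex.Im x.
Proof.
move=> /ctoP h; apply/cvgnP => e e0; have [N hN] := h e e0; exists N => n Nn.
by apply: (le_trans _ (hN n Nn)); rewrite -ImN -ImD nc_Im.
Qed.

Lemma real_cauchy (b : nat -> R) :
  (forall e, 0 < e -> exists N, forall m n, (N <= m)%N -> (N <= n)%N ->
    `|b m - b n| <= e) -> cvgn b.
Proof.
move=> h; apply/cauchy_cvgP/cauchy_ballP => e e0; near_simpl.
have e2 : 0 < e / 2 by rewrite divr_gt0.
have [N hN] := h (e / 2) e2.
exists ([set n | (N <= n)%N], [set n | (N <= n)%N]); first by split; exists N.
move=> [m n] /= [Nm Nn]; rewrite /ball /=.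
by apply: le_lt_trans (hN _ _ Nm Nn) _; rewrite ltr_pdivrMr // mulr_natr mulr2n ltrDl.
Qed.

Lemma cto_cauchy u :
  (forall e, 0 < e -> exists N, forall m n, (N <= m)%N -> (N <= n)%N ->
    normc (u m - u n) <= e) -> exists l, cto u l.
Proof.
move=> h.
have cr : cvgn (fun n => complex.Re (u n)).
  apply: real_cauchy => e e0; have [N hN] := h e e0; exists N => m n Nm Nn.
  by apply: (le_trans _ (hN m n Nm Nn)); rewrite -ReN -ReD nc_Re.
have ci : cvgn (fun n => complex.Im (u n)).
  apply: real_cauchy => e e0; have [N hN] := h e e0; exists N => m n Nm Nn.
  by apply: (le_trans _ (hN m n Nm Nn)); rewrite -ImN -ImD nc_Im.
exists (limn (fun n => complex.Re (u n)) +i* limn (fun n => complex.Im (u n))).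
exact: cto_ReIm.
Qed.

Lemma cvg_le_cst (u : nat -> R) (l M : R) : u n @[n --> \oo] --> l ->
  (forall n, u n <= M) -> l <= M.
Proof.
move=> ul uM; apply/ler_addgt0Pr => e e0.
have [N /(_ N (leqnn N))] := (cvgnP _ _).1 ul e e0.
by rewrite distrC => /(le_trans (ler_norm _)); rewrite lerBlDr addrC => /le_trans; apply;
  rewrite lerD2r.
Qed.

Lemma cvg_ge_partial (u : nat -> R) (l : R) : u n @[n --> \oo] --> l ->
  {homo u : m n / (m <= n)%N >-> m <= n} -> forall n, u n <= l.
Proof.
move=> ul um n; rewrite -lerN2; apply: (@cvg_le_cst (fun m => - u (m + n)%N)).
  by apply: cvgN; rewrite cvg_shiftn.
by move=> m; rewrite lerN2; apply: um; exact: leq_addl.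
Qed.

End Limits.

(** * Power series on the unit disc *)

Section PowerSeries.
Variable R : realType.
Implicit Types (a b : nat -> R[i]) (f g : R[i] -> R[i]) (z w : R[i]).

Definition psum a z n : R[i] := \sum_(k < n) a k * z ^+ k.

Definition rep f a : Prop := forall z, disc z -> cto (psum a z) (f z).

(** The radius of convergence is at least one; unlike [rep] this mentions
   only the coefficients. *)
Definition growth a : Prop := forall s : R, 0 <= s -> s < 1 ->
  exists M, 0 <= M /\ forall n, normc (a n) * s ^+ n <= M.

Lemma geom_sum_le (q : R) n : 0 <= q -> q < 1 ->
  \sum_(k < n) q ^+ k <= (1 - q)^-1.
Proof.
move=> q0 q1; rewrite -[leRHS]mul1r ler_pdivlMr ?subr_gt0 // mulrC.
rewrite -opprB mulNr -subrX1 opprB lerBlDr lerDl; exact: exprn_ge0.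
Qed.

Lemma nat_geom_bound (q : R) : 0 <= q -> q < 1 ->
  forall n, n%:R * q ^+ n <= (1 - q)^-1.
Proof.
move=> q0 q1 n; apply: (le_trans _ (geom_sum_le n q0 q1)).
have -> : n%:R * q ^+ n = \sum_(k < n) q ^+ n.
  by rewrite sumr_const card_ord mulr_natl.
by apply: ler_sum => k _; rewrite ler_wiXn2l ?(ltW q1) // ltnW.
Qed.

Lemma geom_tail (u : nat -> R[i]) (M q : R) : 0 <= q -> q < 1 ->
  (forall k, normc (u k) <= M * q ^+ k) ->
  forall n j, normc (\sum_(k < n + j) u k - \sum_(k < n) u k) <= M * q ^+ n / (1 - q).
Proof.
move=> q0 q1 h n j; rewrite big_split_ord /= addrAC subrr add0r.
apply: (le_trans (nc_sum _ _ _)).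
have M0 : 0 <= M by have := h 0%N; rewrite expr0 mulr1; apply: le_trans; exact: nc_ge0.
apply: (@le_trans _ _ (\sum_(k < j) M * q ^+ n * q ^+ k)).
  by apply: ler_sum => k _; rewrite -mulrA -exprD; exact: h.
by rewrite -mulr_sumr ler_wpM2l ?geom_sum_le // mulr_ge0 ?exprn_ge0.
Qed.

Lemma geom_cvg (u : nat -> R[i]) (M q : R) : 0 <= q -> q < 1 ->
  (forall k, normc (u k) <= M * q ^+ k) ->
  exists l, cto (fun n => \sum_(k < n) u k) l.
Proof.
move=> q0 q1 h; apply: cto_cauchy => e e0.
have c0 : (fun n => M / (1 - q) * q ^+ n) @ \oo --> (0 : R).
  rewrite -[X in _ --> X](mulr0 (M / (1 - q))); apply: cvgMr.
  by apply: cvg_expr; rewrite ger0_norm.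
have e2 : 0 < e / 2 by rewrite divr_gt0.
have [N hN] := (cvgnP _ _).1 c0 _ e2.
have hb n : (N <= n)%N -> normc (\sum_(k < n) u k - \sum_(k < N) u k) <= e / 2.
  move=> Nn; rewrite -(subnKC Nn); apply: (le_trans (geom_tail q0 q1 h N (n - N))).
  have := hN N (leqnn N); rewrite subr0 => /(le_trans (ler_norm _)).
  by rewrite mulrAC.
exists N => m n Nm Nn; apply: (le_trans (nc_dist _ (\sum_(k < N) u k) _)).
by rewrite [e]splitr lerD ?hb // ncC hb.
Qed.

Lemma geom_lim_tail (u : nat -> R[i]) l (M q : R) : 0 <= q -> q < 1 ->
  (forall k, normc (u k) <= M * q ^+ k) ->
  cto (fun n => \sum_(k < n) u k) l ->
  forall n, normc (l - \sum_(k < n) u k) <= M * q ^+ n / (1 - q).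
Proof.
move=> q0 q1 h hl n.
have hs := ctoB (cto_shift n hl) (cto_cst (\sum_(k < n) u k)).
by apply: (cto_bound hs) => j; rewrite addnC; exact: geom_tail.
Qed.

Lemma cto_bounded (u : nat -> R[i]) l : cto u l ->
  exists M, 0 <= M /\ forall n, normc (u n) <= M.
Proof.
move=> ul; have /cvg_has_ub [M hM] : cvgn (fun n => normc (u n - l)).
  by apply/cvg_ex; exists 0.
exists (`|M| + normc l); split; first by rewrite addr_ge0 ?nc_ge0.
move=> n; rewrite -[u n](subrK l); apply: (le_trans (ncD _ _)); rewrite lerD2r.
apply: (@le_trans _ _ M); last exact: ler_norm.
by apply: hM; exists n => //; rewrite ger0_norm ?nc_ge0.
Qed.

Lemma disc_real (s : R) : 0 <= s -> s < 1 -> disc (s%:C).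
Proof. by move=> s0 s1; rewrite /disc /mkset nc_real ger0_norm. Qed.

Lemma rep_growth f a : rep f a -> growth a.
Proof.
move=> h s s0 s1; have hs := h _ (disc_real s0 s1).
have [M [M0 hM]] := cto_bounded hs; exists (M + M); split; first exact: addr_ge0.
move=> n; have := lerD (hM n.+1) (hM n); apply: le_trans.
apply: (le_trans _ (ncB _ _)); rewrite /psum big_ord_recr /= addrAC subrr add0r.
by rewrite ncM ncX nc_real ger0_norm.
Qed.

(** A slightly larger radius is still smaller than one, which turns boundedness
    of the terms into geometric decay. *)
Lemma growth_dom a (s : R) : growth a -> 0 <= s -> s < 1 ->
  exists M q, [/\ 0 <= M, 0 <= q, q < 1 &
    forall k, normc (a k) * s ^+ k <= M * q ^+ k].
Proof.
move=> ga s0 s1; pose t := (1 + s) / 2.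
have [t0 st t1] : [/\ 0 < t, s < t & t < 1] by rewrite /t; split; lra.
have [M [M0 hM]] := ga t (ltW t0) t1; exists M, (s / t); split => //.
- by rewrite divr_ge0 // ltW.
- by rewrite ltr_pdivrMr // mul1r.
move=> k; rewrite expr_div_n mulrA ler_pdivlMr ?exprn_gt0 // mulrAC.
by rewrite ler_wpM2r ?exprn_ge0.
Qed.

Lemma growth_term a (s M q : R) z : normc z <= s ->
  (forall k, normc (a k) * s ^+ k <= M * q ^+ k) ->
  forall k, normc (a k * z ^+ k) <= M * q ^+ k.
Proof.
move=> zs h k; apply: (le_trans _ (h k)); rewrite ncM ncX ler_wpM2l ?nc_ge0 //.
by rewrite lerXn2r ?nnegrE ?nc_ge0 // (le_trans (nc_ge0 z)).
Qed.

Lemma growth_rep a : growth a -> exists f, rep f a.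
Proof.
move=> ga.
have h z : exists l, disc z -> cto (psum a z) l.
  have [dz|] := pselect (disc z); last by exists 0.
  have [M [q [_ q0 q1 hk]]] := growth_dom ga (nc_ge0 z) dz.
  by have [l hl] := geom_cvg q0 q1 (growth_term (lexx _) hk); exists l.
by have [f hf] := choice h; exists f.
Qed.

Lemma growth_natM a : growth a -> growth (fun n => n%:R * a n).
Proof.
move=> ga s s0 s1; have [M [q [M0 q0 q1 h]]] := growth_dom ga s0 s1.
exists (M * (1 - q)^-1); split; first by rewrite mulr_ge0 // invr_ge0 subr_ge0 ltW.
move=> n; rewrite ncM nc_nat -mulrA.
apply: (le_trans (ler_wpM2l _ (h n))) => //; rewrite mulrCA ler_wpM2l //.
exact: nat_geom_bound.
Qed.

Lemma growthS a : growth a -> growth (fun n => a n.+1).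
Proof.
move=> ga s s0 s1; have [M [q [M0 q0 q1 h]]] := growth_dom ga s0 s1.
case: (eqVneq s 0) => [->|sn0].
  exists (normc (a 1)); split=> [|[|n]]; rewrite ?nc_ge0 // ?expr0 ?mulr1 //.
  by rewrite expr0n mulr0 nc_ge0.
exists (M / s); split=> [|n]; first by rewrite divr_ge0.
rewrite ler_pdivlMr ?lt_def ?sn0 // -mulrA -exprSr; apply: (le_trans (h n.+1)).
by rewrite ler_piMr // exprn_ile1 // ltW.
Qed.

Definition dera a : nat -> R[i] := fun n => n.+1%:R * a n.+1.

Lemma growth_dera a : growth a -> growth (dera a).
Proof. by move=> ga; apply: (@growthS (fun n => n%:R * a n)); exact: growth_natM. Qed.

(** The factor [s ^+ 2] on the left avoids a negative power of [s] on the
    right; the induction step multiplies by [z + h]. *)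
Lemma pow_remainder (z h : R[i]) (s : R) n : normc z <= s -> normc (z + h) <= s ->
  s ^+ 2 * normc ((z + h) ^+ n.+1 - z ^+ n.+1 - n.+1%:R * z ^+ n * h)
    <= n.+1%:R ^+ 2 * s ^+ n.+1 * normc h ^+ 2.
Proof.
move=> zs zhs; have s0 : 0 <= s := le_trans (nc_ge0 z) zs.
elim: n => [|n IH].
  have -> : (z + h) ^+ 1 - z ^+ 1 - 1%:R * z ^+ 0 * h = 0 by rewrite !expr1 expr0; ring.
  rewrite nc0 mulr0.
  by rewrite expr1n mul1r mulr_ge0 // exprn_ge0 // nc_ge0.
have -> : (z + h) ^+ n.+2 - z ^+ n.+2 - n.+2%:R * z ^+ n.+1 * h =
   (z + h) * ((z + h) ^+ n.+1 - z ^+ n.+1 - n.+1%:R * z ^+ n * h) +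
   n.+1%:R * z ^+ n * h ^+ 2.
  rewrite [(z + h) ^+ n.+2]exprS [z ^+ n.+2]exprS [z ^+ n.+1]exprS.
  rewrite -[n.+2]addn1 natrD; ring.
apply: (le_trans (ler_wpM2l (sqr_ge0 s) (ncD _ _))); rewrite mulrDr !ncM !ncX nc_nat.
have h1 : s ^+ 2 * (normc (z + h) *
    normc ((z + h) ^+ n.+1 - z ^+ n.+1 - n.+1%:R * z ^+ n * h)) <=
    s * (n.+1%:R ^+ 2 * s ^+ n.+1 * normc h ^+ 2).
  rewrite mulrCA; apply: ler_pM => //; first exact: nc_ge0.
  by rewrite mulr_ge0 ?nc_ge0 ?sqr_ge0.
have h2 : s ^+ 2 * (n.+1%:R * normc z ^+ n * normc h ^+ 2) <=
    s ^+ n.+2 * n.+1%:R * normc h ^+ 2.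
  have -> : s ^+ 2 * (n.+1%:R * normc z ^+ n * normc h ^+ 2) =
    s ^+ 2 * n.+1%:R * normc h ^+ 2 * normc z ^+ n by ring.
  have -> : s ^+ n.+2 * n.+1%:R * normc h ^+ 2 =
    s ^+ 2 * n.+1%:R * normc h ^+ 2 * s ^+ n by rewrite -addn2 exprD; ring.
  apply: ler_wpM2l; first by rewrite !mulr_ge0 ?exprn_ge0 ?nc_ge0.
  by rewrite lerXn2r // nnegrE nc_ge0.
apply: (le_trans (lerD h1 h2)).
have -> : s * (n.+1%:R ^+ 2 * s ^+ n.+1 * normc h ^+ 2) + s ^+ n.+2 * n.+1%:R * normc h ^+ 2
  = (n.+1%:R ^+ 2 + n.+1%:R) * s ^+ n.+2 * normc h ^+ 2.
  rewrite [s ^+ n.+2]exprS; ring.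
rewrite ler_wpM2r ?exprn_ge0 ?nc_ge0 // ler_wpM2r ?exprn_ge0 //.
rewrite -[n.+2]addn1 natrD sqrrD expr1n mulr1 -addrA lerD2l.
by rewrite mulr2n -addrA lerDl addr_ge0.
Qed.

(** Summation of the remainders of the powers; the resulting bound is quadratic
    and uniform on smaller discs. *)
Lemma rep_remainder f a f' (s : R) : rep f a -> rep f' (dera a) -> s < 1 ->
  exists K, 0 <= K /\ forall z h, normc z <= s -> normc (z + h) <= s ->
    normc (f (z + h) - f z - f' z * h) <= K * normc h ^+ 2.
Proof.
move=> fa fa' s1; have [s0|s0] := ltP 0 s; last first.
  exists 0; split=> // z h zs zhs.
  have z0 : z = 0 by apply/eqP; rewrite -nc_eq0 eq_le nc_ge0 (le_trans zs).
  have zh0 : z + h = 0 by apply/eqP; rewrite -nc_eq0 eq_le nc_ge0 (le_trans zhs).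
  move: zh0; rewrite z0 add0r => ->.
  by rewrite subrr mulr0 subrr nc0 mul0r.
have g2 : growth (fun n => n%:R * (n%:R * a n)).
  exact: growth_natM (growth_natM (rep_growth fa)).
have [M [q [M0 q0 q1 hk]]] := growth_dom g2 (ltW s0) s1.
exists (M / (1 - q) / s ^+ 2); split.
  by rewrite divr_ge0 ?sqr_ge0 // divr_ge0 // subr_ge0 ltW.
move=> z h zs zhs.
have dz : disc z by exact: le_lt_trans zs s1.
have dzh : disc (z + h) by exact: le_lt_trans zhs s1.
have := ctoB (ctoB (cto_shift 1 (fa _ dzh)) (cto_shift 1 (fa _ dz)))
   (ctoZ h (fa' _ dz)); rewrite [h * f' z]mulrC => hc.
apply: (cto_bound hc) => n; rewrite addn1 /psum.
rewrite !big_ord_recl !expr0 !mulr1 /=.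
rewrite opprD addrACA subrr add0r mulr_sumr -!sumrB.
rewrite mulrAC ler_pdivlMr ?exprn_gt0 // mulrC.
apply: (le_trans (ler_wpM2l (sqr_ge0 s) (nc_sum _ _ _))); rewrite mulr_sumr.
apply: (@le_trans _ _ (\sum_(k < n) M * q ^+ k.+1 * normc h ^+ 2)).
  apply: ler_sum => k _; rewrite /bump /= add1n.
  have -> : a k.+1 * (z + h) ^+ k.+1 - a k.+1 * z ^+ k.+1 - h * (dera a k * z ^+ k)
     = a k.+1 * ((z + h) ^+ k.+1 - z ^+ k.+1 - k.+1%:R * z ^+ k * h).
    by rewrite /dera; ring.
  rewrite ncM mulrCA; apply: (le_trans (ler_wpM2l (nc_ge0 _) (pow_remainder _ zs zhs))).
  have -> : normc (a k.+1) * (k.+1%:R ^+ 2 * s ^+ k.+1 * normc h ^+ 2) =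
    normc (k.+1%:R * (k.+1%:R * a k.+1)) * s ^+ k.+1 * normc h ^+ 2.
    by rewrite !ncM nc_nat; ring.
  by rewrite ler_wpM2r ?exprn_ge0 ?nc_ge0.
rewrite -mulr_suml -mulr_sumr ler_wpM2r ?exprn_ge0 ?nc_ge0 // ler_wpM2l //.
apply: (le_trans _ (geom_sum_le n q0 q1)); apply: ler_sum => k _.
by rewrite exprS ler_piMl ?exprn_ge0 // ltW.
Qed.

Lemma repD f g a b : rep f a -> rep g b ->
  rep (fun z => f z + g z) (fun n => a n + b n).
Proof.
move=> fa gb z dz; apply: cto_eq (ctoD (fa z dz) (gb z dz)) => n.
by rewrite /psum -big_split /=; apply: eq_bigr => k _; rewrite mulrDl.
Qed.

Lemma repZ c f a : rep f a -> rep (fun z => c * f z) (fun n => c * a n).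
Proof.
move=> fa z dz; apply: cto_eq (ctoZ c (fa z dz)) => n.
by rewrite /psum mulr_sumr; apply: eq_bigr => k _; rewrite mulrA.
Qed.

Lemma repB f g a b : rep f a -> rep g b ->
  rep (fun z => f z - g z) (fun n => a n - b n).
Proof.
move=> fa gb z dz; apply: cto_eq (ctoB (fa z dz) (gb z dz)) => n.
by rewrite /psum -sumrB; apply: eq_bigr => k _; rewrite mulrBl.
Qed.

Lemma rep_ext f g a b : (forall z, disc z -> f z = g z) -> a =1 b ->
  rep f a -> rep g b.
Proof. by move=> fg ab fa z dz; rewrite -fg // -(funext ab); exact: fa. Qed.

End PowerSeries.

(** * Complex differentiability *)

Section Derivability.
Variable R : realType.
Implicit Types (a : nat -> R[i]) (f g : R[i] -> R[i]) (z w l : R[i]).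

(** Complex differentiability through real bounds. The increment [h = 0] is
    included, so that paths passing through [z] cause no case distinction. *)
Definition cdiff f z l : Prop := forall e : R, 0 < e -> exists d : R, 0 < d /\
  forall h, normc h <= d -> normc (f (z + h) - f z - l * h) <= e * normc h.

Lemma derivable_cdiff f z : derivable (f : cplx R -> cplx R) z 1 ->
  exists l, cdiff f z l.
Proof.
move=> df; exists ('D_1 (f : cplx R -> cplx R) z) => e e0.
have e0c : (0 : cplx R) < (e%:C : R[i]) by rewrite ltcR.
have /cvgrPdist_le /(_ _ e0c) := df.
rewrite /nbhs /= => -[x /= x0 hx].
have [rx0 xE] : 0 < complex.Re x /\ x = (complex.Re x)%:C.
  move: x0; rewrite ltcE => /andP[/eqP i0 r0]; split => //.
  by case: x i0 r0 {hx} => a b /= ->.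
exists (complex.Re x / 2); split=> [|h hd]; first by rewrite divr_gt0.
have [->|h0] := eqVneq h 0.
  by rewrite addr0 subrr mulr0 subr0 nc0 mulr0.
have hb : ball_ [eta Num.Def.normr] (0 : cplx R) x h.
  rewrite /ball_ /= sub0r normrN xE /Num.Def.normr /= ltcR.
  by apply: (le_lt_trans hd); rewrite ltr_pdivrMr // mulr_natr mulr2n ltrDl.
have := hx h hb h0; rewrite {1}/Num.Def.normr /= lecR.
rewrite /GRing.scale /= mulr1 [h + z]addrC => le1.
rewrite -ler_pdivrMr ?nc_gt0 // -ncV -ncM mulrBl -mulrA mulfV // mulr1 ncC.
by rewrite [_ / h]mulrC.
Qed.

Lemma cdiff_derive1 f z l : cdiff f z l ->
  derivable (f : cplx R -> cplx R) z 1 /\ derive1 (f : cplx R -> cplx R) z = l.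
Proof.
move=> df.
have hc : (h^-1 *: (f (h + z) - f z) : cplx R) @[h --> (0 : cplx R)^'] --> (l : cplx R).
  apply/cvgrPdist_le => e e0.
  have [re0 eE] : 0 < complex.Re e /\ e = (complex.Re e)%:C.
    move: e0; rewrite ltcE => /andP[/eqP i0 r0]; split => //.
    by case: e i0 r0 => a b /= ->.
  have [d [d0 hd]] := df _ re0.
  exists (d%:C); first by rewrite /= ltcR.
  move=> h /=; rewrite sub0r normrN /Num.Def.normr /= ltcR => hltd h0.
  rewrite eE lecR /GRing.scale /= [h + z]addrC.
  have := hd h (ltW hltd); rewrite -ler_pdivrMr ?nc_gt0 // -ncV -ncM mulrBl -mulrA mulfV // mulr1 ncC.
  by rewrite [_ / h]mulrC.
split.
  rewrite /derivable; apply/cvg_ex; exists l.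
  apply: cvg_trans hc; apply: near_eq_cvg; apply: nearW => h /=.
  by rewrite /GRing.scale /= mulr1.
by rewrite /derive1; apply: (cvg_lim _ hc) => //; exact: norm_hausdorff.
Qed.

Lemma rep_cdiff f f' a z : rep f a -> rep f' (dera a) -> disc z ->
  cdiff f z (f' z).
Proof.
move=> fa fa' dz e e0; pose s := (1 + normc z) / 2.
have z1 : normc z < 1 := dz.
have [zs s1] : normc z < s /\ s < 1 by rewrite /s; split; lra.
have [K [K0 hK]] := rep_remainder fa fa' s1.
exists (Num.min (s - normc z) (e / (K + 1))); split.
  by rewrite lt_min subr_gt0 zs divr_gt0 // ltr_wpDl.
move=> h; rewrite le_min => /andP[h1 h2].
have zh : normc (z + h) <= s.
  by apply: (le_trans (ncD _ _)); rewrite -lerBrDl.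
apply: (le_trans (hK z h (ltW zs) zh)); rewrite expr2 mulrA.
rewrite ler_wpM2r ?nc_ge0 //.
have K1 : 0 < K + 1 by rewrite ltr_wpDl.
rewrite ler_pdivlMr // in h2; apply: (le_trans _ h2).
by rewrite mulrDr mulr1 mulrC lerDl nc_ge0.
Qed.

Lemma rep_holo f a : rep f a -> holomorphic_on_disc f.
Proof.
move=> fa z dz; have [f' fa'] := growth_rep (growth_dera (rep_growth fa)).
by have [] := cdiff_derive1 (rep_cdiff fa fa' dz).
Qed.

Lemma rep_derive1 f a : rep f a ->
  rep (derive1 (f : cplx R -> cplx R)) (dera a).
Proof.
move=> fa; have [f' fa'] := growth_rep (growth_dera (rep_growth fa)).
apply: (rep_ext _ _ fa') => // z dz.
by have [_ <-] := cdiff_derive1 (rep_cdiff fa fa' dz).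
Qed.

(** Continuity in the form used for line integrals. *)
Definition ccont f z : Prop := forall e : R, 0 < e -> exists d : R, 0 < d /\
  forall h, normc h <= d -> normc (f (z + h) - f z) <= e.

Lemma cdiff_cont f z l : cdiff f z l -> ccont f z.
Proof.
move=> df e e0; have [d [d0 hd]] := df 1 ltr01.
have l1 : 0 < 1 + normc l by rewrite ltr_pwDl ?nc_ge0.
exists (Num.min d (e / (1 + normc l))); split; first by rewrite lt_min d0 divr_gt0.
move=> h; rewrite le_min ler_pdivlMr // => /andP[/hd h1 h2]; apply: (le_trans _ h2).
rewrite -[f (z + h) - f z](subrK (l * h)); apply: (le_trans (ncD _ _)).
by rewrite ncM mulrDr mulr1 [normc h * normc l]mulrC lerD2r (le_trans h1) ?mul1r.
Qed.

Lemma ccontB f g z : ccont f z -> ccont g z -> ccont (fun z => f z - g z) z.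
Proof.
move=> cf cg e e0; have e2 : 0 < e / 2 by rewrite divr_gt0.
have [d [d0 hd]] := cf _ e2; have [d' [d'0 hd']] := cg _ e2.
exists (Num.min d d'); split=> [|h]; first by rewrite lt_min d0.
rewrite le_min => /andP[/hd h1 /hd' h2]; rewrite [e]splitr.
apply: (le_trans _ (lerD h1 h2)); apply: (le_trans _ (ncB _ _)).
by rewrite le_eqVlt; apply/orP; left; apply/eqP; congr normc; ring.
Qed.

End Derivability.

(** * Integrals of complex functions of a real variable *)

Section RealPaths.
Variable R : realType.
Implicit Types (F G U V : R -> R[i]) (s t : R).

(** Continuity and derivatives of paths are read on real and imaginary parts,
    where the theory of real functions applies. *)
Definition rct F t : Prop :=
  ({for t, continuous (fun s => complex.Re (F s))}) /\
  ({for t, continuous (fun s => complex.Im (F s))}).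

Lemma real_contP (f : R -> R) t : {for t, continuous f} <->
  forall e, 0 < e -> exists d, 0 < d /\ forall h, `|h| <= d -> `|f (t + h) - f t| <= e.
Proof.
split=> [/cvgrPdist_le h e e0|h].
  have [d /= d0 hd] := h e e0.
  exists (d / 2); split=> [|u ud]; first by rewrite divr_gt0.
  rewrite distrC; apply: hd => /=; rewrite opprD addrA subrr sub0r normrN.
  by apply: (le_lt_trans ud); rewrite ltr_pdivrMr // mulr_natr mulr2n ltrDl.
apply/cvgrPdist_le => e e0; have [d [d0 hd]] := h e e0.
exists d => // s /= sd; rewrite distrC -[s](subrKC t); apply: hd.
by rewrite distrC ltW.
Qed.

Lemma rctP F t : rct F t <->
  forall e, 0 < e -> exists d, 0 < d /\ forall h, `|h| <= d -> normc (F (t + h) - F t) <= e.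
Proof.
split=> [[/real_contP hr /real_contP hi] e e0|h].
  have e2 : 0 < e / 2 by rewrite divr_gt0.
  have [d1 [d10 h1]] := hr _ e2; have [d2 [d20 h2]] := hi _ e2.
  exists (Num.min d1 d2); split=> [|u]; first by rewrite lt_min d10.
  rewrite le_min => /andP[/h1 u1 /h2 u2]; apply: (le_trans (nc_le_ReIm _)).
  by rewrite ReD ImD ReN ImN [e]splitr lerD.
split; apply/real_contP => e /h [d [d0 hd]]; exists d; split=> // u /hd.
  by apply: le_trans; rewrite -ReN -ReD nc_Re.
by apply: le_trans; rewrite -ImN -ImD nc_Im.
Qed.

Lemma rct_cst (c : R[i]) t : rct (fun=> c) t.
Proof. by split; exact: cvg_cst. Qed.

Lemma rctD F G t : rct F t -> rct G t -> rct (fun s => F s + G s) t.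
Proof.
move=> [a b] [c d]; split; rewrite /prop_for /continuous_at.
  by rewrite (_ : (fun _ => _) = (fun s => complex.Re (F s) + complex.Re (G s)));
    [rewrite ReD; exact: cvgD|apply/funext => s; rewrite ReD].
by rewrite (_ : (fun _ => _) = (fun s => complex.Im (F s) + complex.Im (G s)));
  [rewrite ImD; exact: cvgD|apply/funext => s; rewrite ImD].
Qed.

Lemma rctM F G t : rct F t -> rct G t -> rct (fun s => F s * G s) t.
Proof.
move=> [a b] [c d]; split; rewrite /prop_for /continuous_at.
  rewrite (_ : (fun _ => _) = (fun s => complex.Re (F s) * complex.Re (G s) -
    complex.Im (F s) * complex.Im (G s))); last by apply/funext => s; rewrite ReM.
  by rewrite ReM; apply: cvgB; exact: cvgM.
rewrite (_ : (fun _ => _) = (fun s => complex.Re (F s) * complex.Im (G s) +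
    complex.Im (F s) * complex.Re (G s))); last by apply/funext => s; rewrite ImM.
by rewrite ImM; apply: cvgD; exact: cvgM.
Qed.

Lemma rctN F t : rct F t -> rct (fun s => - F s) t.
Proof.
move=> h; rewrite (_ : (fun s => - F s) = (fun s => (-1) * F s)).
  by apply: rctM => //; exact: rct_cst.
by apply/funext => s; rewrite mulN1r.
Qed.

Lemma rctB F G t : rct F t -> rct G t -> rct (fun s => F s - G s) t.
Proof. by move=> a b; apply: rctD => //; exact: rctN. Qed.

Lemma rctX F n t : rct F t -> rct (fun s => F s ^+ n) t.
Proof.
move=> h; elim: n => [|n IH].
  by rewrite (_ : (fun _ => _) = (fun=> 1)); [exact: rct_cst|apply/funext => s; rewrite expr0].
rewrite (_ : (fun _ => _) = (fun s => F s * F s ^+ n)); first exact: rctM.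
by apply/funext => s; rewrite exprS.
Qed.

Lemma rct_sum n (F : nat -> R -> R[i]) t : (forall k, rct (F k) t) ->
  rct (fun s => \sum_(k < n) F k s) t.
Proof.
move=> h; elim: n => [|n IH].
  by rewrite (_ : (fun _ => _) = (fun=> 0)); [exact: rct_cst|apply/funext => s; rewrite big_ord0].
rewrite (_ : (fun _ => _) = (fun s => \sum_(k < n) F k s + F n s)); first exact: rctD.
by apply/funext => s; rewrite big_ord_recr.
Qed.

Lemma rct_conj F t : rct F t -> rct (fun s => conjc (F s)) t.
Proof.
move=> [a b]; split; rewrite /prop_for /continuous_at.
  rewrite (_ : (fun _ => _) = (fun s => complex.Re (F s))); first by rewrite ReJ.
  by apply/funext => s; rewrite ReJ.
rewrite (_ : (fun _ => _) = (fun s => - complex.Im (F s))).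
  by rewrite ImJ; exact: cvgN.
by apply/funext => s; rewrite ImJ.
Qed.

Lemma rct_comp (f : R[i] -> R[i]) G t : ccont f (G t) -> rct G t ->
  rct (fun s => f (G s)) t.
Proof.
move=> fc /rctP Gc; apply/rctP => e e0; have [d [d0 hd]] := fc e e0.
have [d' [d'0 hd']] := Gc d d0; exists d'; split=> // h /hd' h1.
by rewrite -[G (t + h)](subrKC (G t)); exact: hd.
Qed.

Definition rder U t (l : R[i]) : Prop :=
  is_derive t 1 (fun s => complex.Re (U s)) (complex.Re l) /\
  is_derive t 1 (fun s => complex.Im (U s)) (complex.Im l).

Lemma rder_ct U t l : rder U t l -> rct U t.
Proof.
by case=> [[h _] [h' _]]; split; apply: differentiable_continuous; apply/derivable1_diffP.
Qed.

Lemma rder_cst (c : R[i]) t : rder (fun=> c) t 0.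
Proof. by split; exact: is_derive_cst. Qed.

Lemma rderD U V t a b : rder U t a -> rder V t b -> rder (fun s => U s + V s) t (a + b).
Proof.
move=> [h1 h2] [h3 h4]; split.
  rewrite ReD (_ : (fun _ => _) = (fun s => complex.Re (U s)) \+ (fun s => complex.Re (V s))).
    exact: is_deriveD.
  by apply/funext => s /=; rewrite ReD.
rewrite ImD (_ : (fun _ => _) = (fun s => complex.Im (U s)) \+ (fun s => complex.Im (V s))).
  exact: is_deriveD.
by apply/funext => s /=; rewrite ImD.
Qed.

Lemma rderM U V t a b : rder U t a -> rder V t b ->
  rder (fun s => U s * V s) t (a * V t + U t * b).
Proof.
move=> [h1 h2] [h3 h4]; split.
  rewrite (_ : (fun _ => _) = (fun s => complex.Re (U s)) * (fun s => complex.Re (V s))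
     - (fun s => complex.Im (U s)) * (fun s => complex.Im (V s))).
    apply: is_derive_eq; rewrite /GRing.scale /= ReD !ReM; ring.
  by apply/funext => s /=; rewrite ReM.
rewrite (_ : (fun _ => _) = (fun s => complex.Re (U s)) * (fun s => complex.Im (V s))
     + (fun s => complex.Im (U s)) * (fun s => complex.Re (V s))).
  apply: is_derive_eq; rewrite /GRing.scale /= ImD !ImM; ring.
by apply/funext => s /=; rewrite ImM.
Qed.

Lemma rderZ (c : R[i]) U t a : rder U t a -> rder (fun s => c * U s) t (c * a).
Proof.
move=> h; have := rderM (rder_cst c t) h; by rewrite mul0r add0r.
Qed.

Lemma rderX U t a n : rder U t a -> rder (fun s => U s ^+ n) t (n%:R * a * U t ^+ n.-1).
Proof.
move=> h; elim: n => [|n IH].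
  rewrite mul0r mul0r (_ : (fun _ => _) = (fun=> 1)); first exact: rder_cst.
  by apply/funext => s; rewrite expr0.
rewrite (_ : (fun s => _) = (fun s => U s * U s ^+ n)); last first.
  by apply/funext => s; rewrite exprS.
have := rderM h IH; congr (rder _ _ _); case: n {IH} => [|n] /=; last rewrite exprS.
  by rewrite !expr0; ring.
by rewrite -[n.+2]addn1 natrD; ring.
Qed.

Lemma rder_id t : rder (fun s => s%:C) t 1.
Proof.
by split=> /=; [exact: is_derive_id|exact: is_derive_cst].
Qed.

(** The unit circle [e^{it}]. *)
Definition cis t : R[i] := cos t +i* sin t.

Lemma rder_cis t : rder cis t ('i * cis t).
Proof.
split; rewrite /cis /=.
  rewrite (_ : (fun s => _) = cos) //; apply: is_derive_eq; ring.
rewrite (_ : (fun s => _) = sin) //; apply: is_derive_eq; ring.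
Qed.

Lemma nc_cis t : normc (cis t) = 1.
Proof. by rewrite /normc /= cos2Dsin2 sqrtr1. Qed.

Lemma cis0 : cis 0 = 1.
Proof. by rewrite /cis cos0 sin0. Qed.

Lemma cis2pi : cis (2 * pi) = 1.
Proof. by rewrite /cis mulr_natl cos2pi sin2pi. Qed.

Lemma circle_cis r t : circle_point r t = r%:C * cis t.
Proof. by apply: c_ext; rewrite /circle_point ?ReM ?ImM /=; ring. Qed.

End RealPaths.

Section ComplexIntegral.
Variable R : realType.
Implicit Types (F G U V : R -> R[i]) (a b c s t : R).
Notation mu := (@lebesgue_measure R).

Definition cint a b F : R[i] :=
  (\int[mu]_(t in `[a, b]) complex.Re (F t)) +i*
  (\int[mu]_(t in `[a, b]) complex.Im (F t)).

Definition rcts a b F := forall t, a <= t -> t <= b -> rct F t.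

Lemma real_integrable (f : R -> R) a b :
  (forall t, a <= t -> t <= b -> {for t, continuous f}) ->
  mu.-integrable `[a, b] (EFin \o f).
Proof.
move=> h; apply: continuous_compact_integrable; first exact: segment_compact.
apply: continuous_in_subspaceT => t; rewrite inE /= in_itv /= => /andP[]; exact: h.
Qed.

Lemma rcts_Re a b F : rcts a b F -> mu.-integrable `[a, b] (EFin \o (fun t => complex.Re (F t))).
Proof. by move=> h; apply: real_integrable => t ta tb; have [] := h t ta tb. Qed.

Lemma rcts_Im a b F : rcts a b F -> mu.-integrable `[a, b] (EFin \o (fun t => complex.Im (F t))).
Proof. by move=> h; apply: real_integrable => t ta tb; have [] := h t ta tb. Qed.

Lemma cint_ext a b F G : (forall t, a <= t -> t <= b -> F t = G t) ->
  cint a b F = cint a b G.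
Proof.
move=> h; rewrite /cint; congr (_ +i* _); apply: eq_Rintegral => t;
  by rewrite inE /= in_itv /= => /andP[ta tb]; rewrite h.
Qed.

Lemma cintD a b F G : rcts a b F -> rcts a b G ->
  cint a b (fun t => F t + G t) = cint a b F + cint a b G.
Proof.
move=> hF hG; apply: c_ext; rewrite ?ReD ?ImD /=.
  rewrite -RintegralD //; [|exact: rcts_Re|exact: rcts_Re].
  by apply: eq_Rintegral => t _; rewrite ReD.
rewrite -RintegralD //; [|exact: rcts_Im|exact: rcts_Im].
by apply: eq_Rintegral => t _; rewrite ImD.
Qed.

Lemma cintZ (k : R[i]) a b F : rcts a b F ->
  cint a b (fun t => k * F t) = k * cint a b F.
Proof.
move=> hF; have [hr hi] := (rcts_Re hF, rcts_Im hF).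
have hZ (x : R) f : mu.-integrable `[a, b] (EFin \o f) ->
    mu.-integrable `[a, b] (EFin \o (fun t => x * f t)).
  move=> hf; rewrite (_ : EFin \o _ = (fun t => x%:E * (f t)%:E)%E).
    exact: integrableZl.
  by apply/funext => t /=; rewrite EFinM.
apply: c_ext; rewrite ?ReM ?ImM /=.
  rewrite -!RintegralZl // -RintegralB //; [|exact: hZ|exact: hZ].
  by apply: eq_Rintegral => t _; rewrite ReM.
rewrite -!RintegralZl // -RintegralD //; [|exact: hZ|exact: hZ].
by apply: eq_Rintegral => t _; rewrite ImM.
Qed.

Lemma rcts_cst a b (k : R[i]) : rcts a b (fun=> k).
Proof. by move=> t _ _; exact: rct_cst. Qed.

Lemma rctsM a b F G : rcts a b F -> rcts a b G -> rcts a b (fun t => F t * G t).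
Proof. by move=> h g t ta tb; apply: rctM; [exact: h|exact: g]. Qed.

Lemma rctsZ a b (k : R[i]) F : rcts a b F -> rcts a b (fun t => k * F t).
Proof. by move=> h; apply: rctsM => //; exact: rcts_cst. Qed.

Lemma rctsB a b F G : rcts a b F -> rcts a b G -> rcts a b (fun t => F t - G t).
Proof. by move=> h g t ta tb; apply: rctB; [exact: h|exact: g]. Qed.

Lemma cintB a b F G : rcts a b F -> rcts a b G ->
  cint a b (fun t => F t - G t) = cint a b F - cint a b G.
Proof.
move=> hF hG; rewrite -mulN1r -cintZ // -cintD //; last exact: rctsZ.
by apply: cint_ext => t _ _; rewrite mulN1r.
Qed.

Lemma cint_sum a b n (F : nat -> R -> R[i]) : (forall k, rcts a b (F k)) ->
  cint a b (fun t => \sum_(k < n) F k t) = \sum_(k < n) cint a b (F k).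
Proof.
move=> h; elim: n => [|n IH].
  rewrite big_ord0 -[RHS](mul0r (cint a b (fun=> 0))) -cintZ; last exact: rcts_cst.
  by apply: cint_ext => t _ _; rewrite big_ord0 mul0r.
rewrite big_ord_recr /= -IH -cintD //; last by move=> t ta tb; apply: rct_sum => k; exact: h.
by apply: cint_ext => t _ _; rewrite big_ord_recr.
Qed.

Lemma Rintegral_cat (f : R -> R) a b c : a <= b -> b <= c ->
  mu.-integrable `[a, c] (EFin \o f) ->
  (\int[mu]_(t in `[a, c]) f t) = (\int[mu]_(t in `[a, b]) f t) + (\int[mu]_(t in `[b, c]) f t).
Proof.
move=> ab bc hf; have := @Rintegral_itvB _ f (BLeft a) (BRight c) b hf.
rewrite !bnd_simp => /(_ ab bc) h.
rewrite -(@Rintegral_itv_obnd_cbnd _ b (BRight c)); last first.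
  by apply: integrableS hf => //; apply: subset_itv; rewrite bnd_simp.
by rewrite -h addrCA subrr addr0.
Qed.

Lemma cint_cat a b c F : a <= b -> b <= c -> rcts a c F ->
  cint a c F = cint a b F + cint b c F.
Proof.
move=> ab bc h; apply: c_ext; rewrite ?ReD ?ImD /=; apply: Rintegral_cat => //.
  exact: rcts_Re.
exact: rcts_Im.
Qed.

Lemma Rintegral_bound (f : R -> R) a b M : a <= b ->
  mu.-integrable `[a, b] (EFin \o f) ->
  (forall t, a <= t -> t <= b -> `|f t| <= M) ->
  `|\int[mu]_(t in `[a, b]) f t| <= M * (b - a).
Proof.
move=> ab hf h; apply: (le_trans (le_normr_Rintegral _ hf)) => //.
have -> : M * (b - a) = \int[mu]_(t in `[a, b]) M.
  rewrite Rintegral_cst //= lebesgue_measure_itv /= lte_fin.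
  have [//|ba] := ltP a b; have -> : a = b by apply/eqP; rewrite eq_le ab ba.
  by rewrite subrr mulr0.
apply: le_Rintegral => //.
- rewrite (_ : EFin \o _ = abse \o (EFin \o f)) //.
  exact: integrable_abse.
- by apply: real_integrable => t _ _; exact: cst_continuous.
by move=> t /=; rewrite in_itv /= => /andP[]; exact: h.
Qed.

Lemma cint_bound a b F M : a <= b -> rcts a b F ->
  (forall t, a <= t -> t <= b -> normc (F t) <= M) ->
  normc (cint a b F) <= 2 * M * (b - a).
Proof.
move=> ab hF h; apply: (le_trans (nc_le_ReIm _)) => /=.
rewrite -mulrA mulr_natl mulr2n; apply: lerD; apply: Rintegral_bound => //.
- exact: rcts_Re.
- by move=> t ta tb; apply: (le_trans (nc_Re _)); exact: h.
- exact: rcts_Im.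
- by move=> t ta tb; apply: (le_trans (nc_Im _)); exact: h.
Qed.

Lemma Rintegral_FTC (f F : R -> R) a b : a <= b ->
  (forall t, a <= t -> t <= b -> is_derive t 1 F (f t)) ->
  (forall t, a <= t -> t <= b -> {for t, continuous f}) ->
  \int[mu]_(t in `[a, b]) f t = F b - F a.
Proof.
move=> ab dF cf; move: ab; rewrite le_eqVlt => /predU1P[<-|ab].
  by rewrite set_itv1 Rintegral_set1 subrr.
have cF t : a <= t -> t <= b -> {for t, continuous F}.
  by move=> ta tb; apply: differentiable_continuous; apply/derivable1_diffP; case: (dF t ta tb).
rewrite /Rintegral (@continuous_FTC2 _ f F a b) //.
- apply: continuous_in_subspaceT => t; rewrite inE /= in_itv /= => /andP[]; exact: cf.
- split.
  + by move=> t; rewrite in_itv /= => /andP[ta tb]; case: (dF t (ltW ta) (ltW tb)).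
  + by apply: cvg_at_right_filter; exact: cF (ltW ab).
  + by apply: cvg_at_left_filter; exact: cF (ltW ab) _.
move=> t; rewrite in_itv /= => /andP[ta tb].
by rewrite derive1E; case: (dF t (ltW ta) (ltW tb)).
Qed.

Lemma cint_FTC a b U V : a <= b ->
  (forall t, a <= t -> t <= b -> rder U t (V t)) -> rcts a b V ->
  cint a b V = U b - U a.
Proof.
move=> ab dU cV; apply: c_ext; rewrite ?ReD ?ImD ?ReN ?ImN /=.
  apply: (@Rintegral_FTC (fun t => complex.Re (V t)) (fun t => complex.Re (U t))) => // t ta tb.
    by have [] := dU t ta tb.
  by have [] := cV t ta tb.
apply: (@Rintegral_FTC (fun t => complex.Im (V t)) (fun t => complex.Im (U t))) => // t ta tb.
  by have [] := dU t ta tb.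
by have [] := cV t ta tb.
Qed.

Lemma cint_cst a b (k : R[i]) : a <= b -> cint a b (fun=> k) = (b - a)%:C * k.
Proof.
move=> ab; rewrite (@cint_FTC a b (fun s => k * s%:C)) //.
- by rewrite -mulrBr -rmorphB mulrC.
- by move=> t _ _; have := rderZ k (rder_id t); rewrite mulr1.
- exact: rcts_cst.
Qed.

End ComplexIntegral.

(** * Cauchy's theorem *)

Section Bisection.
Variable R : realType.

(** The bisection argument of Goursat's lemma, separated from the line
    integrals it is applied to: a nested sequence of quarters keeps its share
    of the value, which contradicts the smallness near the common point. *)
Lemma bisection (J : R -> R -> R -> R -> R[i]) (A B C D : R) :
  A <= B -> C <= D ->
  (forall s1 m s2 t1 t2, A <= s1 -> s1 <= m -> m <= s2 -> s2 <= B ->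
     C <= t1 -> t1 <= t2 -> t2 <= D ->
     J s1 s2 t1 t2 = J s1 m t1 t2 + J m s2 t1 t2) ->
  (forall s1 s2 t1 m t2, A <= s1 -> s1 <= s2 -> s2 <= B ->
     C <= t1 -> t1 <= m -> m <= t2 -> t2 <= D ->
     J s1 s2 t1 t2 = J s1 s2 t1 m + J s1 s2 m t2) ->
  (forall s t, A <= s -> s <= B -> C <= t -> t <= D ->
     forall e : R, 0 < e -> exists d : R, 0 < d /\
     forall s1 s2 t1 t2, A <= s1 -> s1 <= s -> s <= s2 -> s2 <= B ->
       C <= t1 -> t1 <= t -> t <= t2 -> t2 <= D -> s2 - s1 <= d -> t2 - t1 <= d ->
       normc (J s1 s2 t1 t2) <= e * ((s2 - s1) + (t2 - t1)) ^+ 2) ->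
  J A B C D = 0.
Proof.
move=> AB CD addS addT loc; apply/eqP; apply: contraT; rewrite -nc_gt0.
set eta : R := normc _ => eta0.
pose S k := (B - A) / 2 ^+ k; pose T k := (D - C) / 2 ^+ k.
have S0 k : 0 <= S k by rewrite divr_ge0 ?subr_ge0 // exprn_ge0.
have T0 k : 0 <= T k by rewrite divr_ge0 ?subr_ge0 // exprn_ge0.
have hS k : S k = S k.+1 + S k.+1.
  by rewrite /S exprS; field; rewrite expf_eq0 pnatr_eq0 andbF.
have hT k : T k = T k.+1 + T k.+1.
  by rewrite /T exprS; field; rewrite expf_eq0 pnatr_eq0 andbF.
pose P k (p : R * R) := [/\ A <= p.1, p.1 + S k <= B, C <= p.2, p.2 + T k <= D &
   eta <= 4 ^+ k * normc (J p.1 (p.1 + S k) p.2 (p.2 + T k))].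
pose N k (p q : R * R) := [/\ p.1 <= q.1, q.1 + S k.+1 <= p.1 + S k,
   p.2 <= q.2 & q.2 + T k.+1 <= p.2 + T k].
have step k p : exists q, P k p -> P k.+1 q /\ N k p q.
  have [Pp|nPp] := pselect (P k p); last by exists p.
  case: (Pp) => As sB Ct tD big.
  have [Sk Tk] := (S0 k.+1, T0 k.+1).
  set s := p.1; set t := p.2.
  pose q11 := (s, t); pose q12 := (s, t + T k.+1).
  pose q21 := (s + S k.+1, t); pose q22 := (s + S k.+1, t + T k.+1).
  pose I (q : R * R) := J q.1 (q.1 + S k.+1) q.2 (q.2 + T k.+1).
  have JE : J s (s + S k) t (t + T k) = I q11 + I q12 + (I q21 + I q22).
    move: As sB Ct tD; rewrite -/s -/t hS hT => As sB Ct tD.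
    have -> := addS s (s + S k.+1) (s + (S k.+1 + S k.+1)) t (t + (T k.+1 + T k.+1))
      ltac:(lra) ltac:(lra) ltac:(lra) ltac:(lra) ltac:(lra) ltac:(lra) ltac:(lra).
    have -> := addT s (s + S k.+1) t (t + T k.+1) (t + (T k.+1 + T k.+1))
      ltac:(lra) ltac:(lra) ltac:(lra) ltac:(lra) ltac:(lra) ltac:(lra) ltac:(lra).
    have -> := addT (s + S k.+1) (s + (S k.+1 + S k.+1)) t (t + T k.+1) (t + (T k.+1 + T k.+1))
      ltac:(lra) ltac:(lra) ltac:(lra) ltac:(lra) ltac:(lra) ltac:(lra) ltac:(lra).
    by rewrite /I /= !addrA.
  have h4 : eta <= 4 ^+ k * (normc (I q11) + normc (I q12) + (normc (I q21) + normc (I q22))).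
    apply: (le_trans big); rewrite ler_pM2l ?exprn_gt0 // JE.
    by apply: (le_trans (ncD _ _)); apply: lerD; exact: ncD.
  have geo q : q \in [:: q11; q12; q21; q22] ->
      [/\ A <= q.1, q.1 + S k.+1 <= B, C <= q.2 & q.2 + T k.+1 <= D] /\ N k p q.
    move: As sB Ct tD; rewrite /N hS hT -/s -/t => As sB Ct tD.
    by clear -As sB Ct tD Sk Tk; rewrite !inE => /or4P[] /eqP -> /=; do !split; lra.
  (* one quarter carries at least a quarter of the modulus *)
  have : exists2 q, q \in [:: q11; q12; q21; q22] & eta <= 4 ^+ k.+1 * normc (I q).
    have [h|h1] := leP eta (4 ^+ k.+1 * normc (I q11)).
      by exists q11 => //; rewrite !inE eqxx.
    have [h|h2] := leP eta (4 ^+ k.+1 * normc (I q12)).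
      by exists q12 => //; rewrite !inE eqxx ?orbT.
    have [h|h3] := leP eta (4 ^+ k.+1 * normc (I q21)).
      by exists q21 => //; rewrite !inE eqxx ?orbT.
    exists q22; first by rewrite !inE eqxx ?orbT.
    rewrite !exprS in h1 h2 h3 *; lra.
  case=> q qin qbig; exists q => _; have [[a1 a2 a3 a4] nq] := geo q qin.
  by split.
have [nxt hnxt] := @choice (nat * (R * R)) (R * R)
  (fun kp q => P kp.1 kp.2 -> P kp.1.+1 q /\ N kp.1 kp.2 q)
  (fun kp => step kp.1 kp.2).
pose f := fix f k := if k is k'.+1 then nxt (k', f k') else (A, C).
have Pf k : P k (f k).
  elim: k => [|k IH] /=; last by case: (hnxt (k, f k) IH).
  rewrite /P /S /T /= expr0 !divr1 mul1r; split; rewrite ?subrKC //.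
have Nf k : N k (f k) (f k.+1) by case: (hnxt (k, f k) (Pf k)).
have mono i k : [/\ (f i).1 <= (f (i + k)%N).1, (f (i + k)%N).1 + S (i + k)%N <= (f i).1 + S i,
    (f i).2 <= (f (i + k)%N).2 & (f (i + k)%N).2 + T (i + k)%N <= (f i).2 + T i].
  elim: k => [|k [a b c d]]; first by rewrite addn0; split.
  rewrite addnS; case: (Nf (i + k)%N) => a' b' c' d'.
  by split; [exact: le_trans a'|exact: le_trans b|exact: le_trans c'|exact: le_trans d].
have cross i j : (f i).1 <= (f j).1 + S j /\ (f i).2 <= (f j).2 + T j.
  have [ij|ji] := leqP i j.
    have [a _ c _] := mono i (j - i)%N; rewrite subnKC // in a c.
    by split; [apply: (le_trans a)|apply: (le_trans c)]; rewrite lerDl.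
  have [_ b _ d] := mono j (i - j)%N; rewrite subnKC ?(ltnW ji) // in b d.
  by split; [apply: (le_trans _ b)|apply: (le_trans _ d)]; rewrite lerDl.
(* the lower left corners increase and stay below all upper right corners *)
pose s := sup (range (fun k => (f k).1)); pose t := sup (range (fun k => (f k).2)).
have hs k : (f k).1 <= s /\ s <= (f k).1 + S k.
  split; last first.
    apply: sup_le_ub; first by exists (f 0%N).1; exists 0%N.
    by move=> _ [i _ <-]; case: (cross i k).
  apply: ub_le_sup; last by exists k.
  by exists ((f 0%N).1 + S 0%N) => _ [i _ <-]; case: (cross i 0%N).
have ht k : (f k).2 <= t /\ t <= (f k).2 + T k.
  split; last first.
    apply: sup_le_ub; first by exists (f 0%N).2; exists 0%N.
    by move=> _ [i _ <-]; case: (cross i k).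
  apply: ub_le_sup; last by exists k.
  by exists ((f 0%N).2 + T 0%N) => _ [i _ <-]; case: (cross i 0%N).
have [sA sB] : A <= s /\ s <= B.
  have [a1 a2 _ _ _] := Pf 0%N; have [h1 h2] := hs 0%N.
  by split; [exact: le_trans h1|exact: le_trans a2].
have [tC tD] : C <= t /\ t <= D.
  have [_ _ a1 a2 _] := Pf 0%N; have [h1 h2] := ht 0%N.
  by split; [exact: le_trans h1|exact: le_trans a2].
pose L := (B - A) + (D - C); have L0 : 0 <= L by rewrite addr_ge0 ?subr_ge0.
have L21 : 0 < L ^+ 2 + 1 by rewrite ltr_wpDl ?sqr_ge0.
have [d [d0 hd]] := loc s t sA sB tC tD (eta / (L ^+ 2 + 1)) (divr_gt0 eta0 L21).
have [k hk] : exists k, L * 2^-1 ^+ k <= d.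
  have c0 : (fun k => L * 2^-1 ^+ k) @ \oo --> (0 : R).
    rewrite -[X in _ --> X](mulr0 L); apply: cvgMr; apply: cvg_expr.
    by rewrite ger0_norm // invf_lt1 // ltr1n.
  have [k /(_ k (leqnn k))] := (cvgnP _ _).1 c0 _ d0.
  by rewrite subr0 => /(le_trans (ler_norm _)) ?; exists k.
have LST : L * 2^-1 ^+ k = S k + T k by rewrite exprVn /S /T /L mulrDl.
have [a1 a2 a3 a4 a5] := Pf k; have [b1 b2] := hs k; have [c1 c2] := ht k.
have := hd _ _ _ _ a1 b1 b2 a2 a3 c1 c2 a4.
have eK (x y : R) : x + y - x = y by rewrite addrC addKr.
rewrite !eK => hJ.
have Sd : S k <= d by apply: (le_trans _ hk); rewrite LST lerDl.
have Td : T k <= d by apply: (le_trans _ hk); rewrite LST lerDr.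
have {}hJ := hJ Sd Td.
have : eta <= eta / (L ^+ 2 + 1) * L ^+ 2.
  apply: (le_trans a5); apply: (le_trans (ler_wpM2l _ hJ)); first exact: exprn_ge0.
  rewrite -LST exprMn -exprM mulnC exprM.
  have -> : (2^-1 ^+ 2 : R) = 4^-1 by rewrite exprVn -natrX.
  rewrite mulrCA [4 ^+ k * _]mulrCA exprVn mulfV ?mulr1 //.
rewrite mulrAC ler_pdivlMr // ler_pM2l // => h; exfalso; move: h.
by rewrite leNgt ltrDl ltr01.
Qed.

End Bisection.

Section Homotopy.
Variable R : realType.
Variables (w : R[i]) (r : R).
Hypotheses (wr : normc w < r) (r1 : r < 1).
Implicit Types (K : R[i] -> R[i]) (s t : R).

(* Circles shrinking linearly to w: the homotopy along which the Cauchy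
   integral is transported. *)
Let c t : R[i] := r%:C * cis t - w.
Let c' t : R[i] := r%:C * ('i * cis t).
Let G s t : R[i] := w + s%:C * c t.

Let r0 : 0 < r. Proof. exact: le_lt_trans (nc_ge0 w) wr. Qed.

Lemma nc_rcis t : normc (r%:C * cis t) = r.
Proof. by rewrite ncM nc_cis mulr1 nc_real ger0_norm // ltW. Qed.

Let rder_c t : rder c t (c' t).
Proof.
have := rderD (rderZ r%:C (rder_cis t)) (rder_cst (- w) t).
by rewrite addr0.
Qed.

Let c_le t : normc (c t) <= 2.
Proof.
apply: (le_trans (ncB _ _)); rewrite nc_rcis.
by move: wr r1; lra.
Qed.

Let rct_c' t : rct c' t.
Proof.
apply: rctM; [exact: rct_cst|apply: rctM; [exact: rct_cst|]].
exact: rder_ct (rder_cis t).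
Qed.

Let c_ge t : r - normc w <= normc (c t).
Proof. by rewrite -{1}(nc_rcis t); exact: nc_sub_le. Qed.

Let c'_le t : normc (c' t) <= 2.
Proof.
have nci : normc ('i : R[i]) = 1 by rewrite /normc /= expr0n expr1n add0r sqrtr1.
by rewrite /c' mulrCA ncM nc_rcis nci mul1r; move: r1; lra.
Qed.

Let c_neq0 t : c t != 0.
Proof. by rewrite -nc_gt0; apply: (lt_le_trans _ (c_ge t)); rewrite subr_gt0. Qed.

Let c_lip t t' : normc (c t' - c t) <= 4 * `|t' - t|.
Proof.
have h u v : u <= v -> normc (c v - c u) <= 4 * (v - u).
  move=> uv; rewrite -(@cint_FTC _ u v c c') //.
    by apply: (le_trans (cint_bound (M := 2) uv _ _)) => //; rewrite ?ler_wpM2r ?subr_ge0 //; lra.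
have [tt'|t't] := leP t t'.
  by rewrite ger0_norm ?subr_ge0 ?h.
by rewrite ncC distrC ger0_norm ?subr_ge0 ?h // ltW.
Qed.

Let G_disc s t : 0 <= s -> s <= 1 -> disc (G s t).
Proof.
move=> s0 s1; rewrite /disc /mkset.
have -> : G s t = (1 - s)%:C * w + s%:C * (r%:C * cis t).
  by rewrite /G /c rmorphB rmorph1; ring.
apply: (le_lt_trans (ncD _ _)); rewrite !ncM nc_cis mulr1 !nc_real !ger0_norm ?subr_ge0 ?(ltW r0) //.
by move: wr r1; nra.
Qed.

Let rder_Gs s t : rder (fun s => G s t) s (c t).
Proof.
have := rderD (rder_cst w s) (rderM (rder_id s) (rder_cst (c t) s)).
by rewrite add0r mul1r mulr0 addr0.
Qed.

Let rder_Gt s t : rder (fun t => G s t) t (s%:C * c' t).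
Proof.
have := rderD (rder_cst w t) (rderZ s%:C (rder_c t)).
by rewrite add0r.
Qed.

Let G_lip s s' t t' : 0 <= s -> s <= 1 ->
  normc (G s' t' - G s t) <= 4 * (`|s' - s| + `|t' - t|).
Proof.
move=> s0 s1.
have -> : G s' t' - G s t = (s' - s)%:C * c t' + s%:C * (c t' - c t).
  by rewrite /G rmorphB; ring.
apply: (le_trans (ncD _ _)); rewrite !ncM !nc_real (ger0_norm s0) mulrDr.
apply: lerD.
  by rewrite mulrC ler_wpM2r //; apply: (le_trans (c_le _)); lra.
apply: (@le_trans _ _ (1 * normc (c t' - c t))); first by rewrite ler_wpM2r ?nc_ge0.
by rewrite mul1r c_lip.
Qed.

Let H K t s1 s2 := cint s1 s2 (fun s => K (G s t) * c t).
Let V K s t1 t2 := cint t1 t2 (fun t => K (G s t) * (s%:C * c' t)).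
(* The circulation of [K(z) dz] along the image under [G] of the boundary of a
   rectangle. *)
Let J K s1 s2 t1 t2 := (H K t1 s1 s2 + V K s2 t1 t2) - (H K t2 s1 s2 + V K s1 t1 t2).

Let H_cts K t s1 s2 : (forall s, s1 <= s -> s <= s2 -> ccont K (G s t)) ->
  rcts s1 s2 (fun s => K (G s t) * c t).
Proof.
move=> h s h1 h2; apply: rctM; last exact: rct_cst.
by apply: rct_comp; [exact: h|exact: rder_ct (rder_Gs s t)].
Qed.

Let V_cts K s t1 t2 : (forall t, t1 <= t -> t <= t2 -> ccont K (G s t)) ->
  rcts t1 t2 (fun t => K (G s t) * (s%:C * c' t)).
Proof.
move=> h t h1 h2; apply: rctM.
  by apply: rct_comp; [exact: h|exact: rder_ct (rder_Gt s t)].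
by apply: rctM => //; exact: rct_cst.
Qed.

Let J_affine (a b : R[i]) s1 s2 t1 t2 : s1 <= s2 -> t1 <= t2 ->
  J (fun z => a + b * z) s1 s2 t1 t2 = 0.
Proof.
move=> s12 t12; pose Q z := a * z + b / 2 * z ^+ 2.
have rQ U t l : rder U t l -> rder (fun t => Q (U t)) t ((a + b * U t) * l).
  move=> h; have := rderD (rderZ a h) (rderZ (b / 2) (rderX 2 h)).
  by congr (rder _ _ _); rewrite /= expr1; field.
have cQ z : ccont (fun z => a + b * z) z.
  move=> e e0; exists (e / (normc b + 1)).
  have b1 : 0 < normc b + 1 by rewrite ltr_wpDl ?nc_ge0.
  split; first by rewrite divr_gt0.
  move=> h; rewrite ler_pdivlMr // => he.
  have -> : a + b * (z + h) - (a + b * z) = b * h by ring.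
  by rewrite ncM; apply: (le_trans _ he); rewrite mulrDr mulr1 mulrC lerDl nc_ge0.
have hH t : H (fun z => a + b * z) t s1 s2 = Q (G s2 t) - Q (G s1 t).
  apply: (@cint_FTC _ s1 s2 (fun s => Q (G s t))) => // [s _ _|].
    exact: (rQ (fun s => G s t)).
  by apply: (@H_cts (fun z => a + b * z)) => s' _ _; exact: cQ.
have hV s : V (fun z => a + b * z) s t1 t2 = Q (G s t2) - Q (G s t1).
  apply: (@cint_FTC _ t1 t2 (fun t => Q (G s t))) => // [t _ _|].
    exact: (rQ (fun t => G s t)).
  by apply: (@V_cts (fun z => a + b * z)) => s' _ _; exact: cQ.
by rewrite /J !hH !hV; ring.
Qed.

(** Near a point of differentiability [K] is the sum of an affine function,
    which has a primitive and contributes nothing, and of an error small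
    compared to the size of the rectangle; [bisection] concludes. *)
Lemma goursat K (A C D : R) : 0 <= A -> A <= 1 -> C <= D ->
  (forall s t, A <= s -> s <= 1 -> C <= t -> t <= D -> exists l, cdiff K (G s t) l) ->
  J K A 1 C D = 0.
Proof.
move=> A0 A1 CD dK.
have cK s t : A <= s -> s <= 1 -> C <= t -> t <= D -> ccont K (G s t).
  by move=> h1 h2 h3 h4; have [l /cdiff_cont] := dK s t h1 h2 h3 h4.
apply: (@bisection R (J K) A 1 C D) => //.
- move=> s1 m s2 t1 t2 h1 h2 h3 h4 h5 h6 h7.
  rewrite /J /H !(cint_cat h2 h3); last 2 first.
  + by apply: H_cts => s *; apply: cK; lra.
  + by apply: H_cts => s *; apply: cK; lra.
  by ring.
- move=> s1 s2 t1 m t2 h1 h2 h3 h4 h5 h6 h7.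
  rewrite /J /V !(cint_cat h5 h6); last 2 first.
  + by apply: V_cts => s *; apply: cK; lra.
  + by apply: V_cts => s *; apply: cK; lra.
  by ring.
move=> s t As s1 Ct tD e e0.
have [l dl] := dK s t As s1 Ct tD.
(* [G] is 4-Lipschitz, the sides are run through at speed at most 2 and
   [cint_bound] loses a factor 2: each of the two pairs of opposite sides
   contributes at most 32 times the error of the difference quotient. *)
have e64 : 0 < e / 64 by rewrite divr_gt0.
have [d [d0 hd]] := dl _ e64.
exists (d / 8); split; first by rewrite divr_gt0.
move=> a b u v Aa as_ sb b1 Cu ut tv vD ab uv.
pose P z := (K (G s t) - l * G s t) + l * z.
pose E z := K z - P z.
pose L := (b - a) + (v - u).
have L0 : 0 <= L by rewrite addr_ge0 ?subr_ge0; lra.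
have hE s' t' : a <= s' -> s' <= b -> u <= t' -> t' <= v ->
    normc (E (G s' t')) <= e / 16 * L.
  move=> h1 h2 h3 h4; pose h := G s' t' - G s t.
  have hL : normc h <= 4 * L.
    have := @G_lip s s' t t' (le_trans A0 As) s1; move=> /le_trans; apply.
    rewrite ler_wpM2l //; apply: lerD; rewrite ler_norml; apply/andP; split; lra.
  have hd' : normc h <= d.
    apply: (le_trans hL); rewrite /L; lra.
  have := hd h hd'; rewrite /h subrKC -/h.
  have -> : K (G s' t') - K (G s t) - l * h = E (G s' t').
    by rewrite /E /P /h; ring.
  by move=> /le_trans; apply; rewrite -mulrA; nra.
have cP z : ccont P z.
  apply: (@cdiff_cont _ _ _ l) => e' e'0; exists 1; split=> // h _.
  have -> : P (z + h) - P z - l * h = 0 by rewrite /P; ring.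
  by rewrite nc0 mulr_ge0 ?nc_ge0 // ltW.
have hJ : J K a b u v = J E a b u v.
  have hH t' : u <= t' -> t' <= v -> H E t' a b = H K t' a b - H P t' a b.
    move=> h1 h2; rewrite /H -cintB.
    - by apply: cint_ext => s' _ _; rewrite -mulrBl.
    - by apply: H_cts => s' *; apply: cK; lra.
    - by apply: H_cts => s' *; exact: cP.
  have hV s' : a <= s' -> s' <= b -> V E s' u v = V K s' u v - V P s' u v.
    move=> h1 h2; rewrite /V -cintB.
    - by apply: cint_ext => t' _ _; rewrite -mulrBl.
    - by apply: V_cts => t' *; apply: cK; lra.
    - by apply: V_cts => t' *; exact: cP.
  have := @J_affine (K (G s t) - l * G s t) l a b u v; rewrite -/P => JP.
  have {}JP : J P a b u v = 0 by apply: JP; lra.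
  have [hab huv] : a <= b /\ u <= v by split; lra.
  rewrite -[LHS]subr0 -JP /J (hH u) // (hH v) // (hV a) // (hV b) //.
  by ring.
rewrite hJ /J.
have cE s' t' : a <= s' -> s' <= b -> u <= t' -> t' <= v -> ccont E (G s' t').
  move=> h1 h2 h3 h4; apply: ccontB; first by apply: cK; lra.
  exact: cP.
have bH t' : u <= t' -> t' <= v -> normc (H E t' a b) <= e / 4 * L * (b - a).
  move=> h1 h2; apply: (le_trans (cint_bound (M := e / 16 * L * 2) _ _ _)).
  - by lra.
  - by apply: H_cts => s' *; exact: cE.
  - by move=> s' h3 h4; rewrite ncM; apply: ler_pM; rewrite ?nc_ge0 ?hE ?c_le.
  - by rewrite le_eqVlt; apply/orP; left; apply/eqP; field.
have bV s' : a <= s' -> s' <= b -> normc (V E s' u v) <= e / 4 * L * (v - u).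
  move=> h1 h2; apply: (le_trans (cint_bound (M := e / 16 * L * 2) _ _ _)).
  - by lra.
  - by apply: V_cts => t' *; exact: cE.
  - move=> t' h3 h4; rewrite ncM; apply: ler_pM; rewrite ?nc_ge0 ?hE //.
    rewrite ncM nc_real ger0_norm; last lra.
    by rewrite -[leRHS]mul1r; apply: ler_pM; rewrite ?nc_ge0 ?c'_le //; lra.
  - by rewrite le_eqVlt; apply/orP; left; apply/eqP; field.
have b1' := bH u (lexx _) ltac:(lra).
have b2' := bH v ltac:(lra) (lexx _).
have b3' := bV a (lexx _) ltac:(lra).
have b4' := bV b ltac:(lra) (lexx _).
apply: (le_trans (ncB _ _)); apply: (le_trans (lerD (ncD _ _) (ncD _ _))).
have -> : e * (b - a + (v - u)) ^+ 2 = e * L * (b - a) + e * L * (v - u).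
  by rewrite /L; ring.
have h1 : 0 <= e * L * (b - a) by rewrite !mulr_ge0 ?subr_ge0 ?(ltW e0) //; lra.
have h2 : 0 <= e * L * (v - u) by rewrite !mulr_ge0 ?subr_ge0 ?(ltW e0) //; lra.
move: b1' b2' b3' b4'.
have -> : e / 4 * L * (b - a) = e * L * (b - a) / 4 by field.
have -> : e / 4 * L * (v - u) = e * L * (v - u) / 4 by field.
lra.
Qed.

(** Cauchy's formula for the disc, in the form: the difference quotient at [w]
    integrates to zero. The integral over the circle equals that over
    arbitrarily small circles around [w], on which [f z - f w] is small while
    the length of the circle compensates [1 / (z - w)]. *)
Lemma cauchy_kernel (f : R[i] -> R[i]) : (forall z, disc z -> exists l, cdiff f z l) ->
  (forall z, disc z -> z != w -> exists l, cdiff (fun z => (f z - f w) / (z - w)) z l) ->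
  cint 0 (2 * pi) (fun t => (f (r%:C * cis t) - f w) *
     (r%:C * cis t / (r%:C * cis t - w))) = 0.
Proof.
move=> df dK; pose K z := (f z - f w) / (z - w).
have pi20 : 0 <= 2 * pi :> R by rewrite mulr_ge0 ?pi_ge0.
have Gw s t : 0 < s -> G s t != w.
  move=> s0; rewrite -subr_eq0 /G [w + _]addrC addrK mulf_neq0 //.
  by rewrite -nc_gt0 nc_real normr_gt0 gt_eqF.
have dKG s t : 0 < s -> s <= 1 -> exists l, cdiff K (G s t) l.
  by move=> s0 s1; apply: dK; [apply: G_disc => //; exact: ltW|exact: Gw].
have V1A A : 0 < A -> A <= 1 -> V K 1 0 (2 * pi) = V K A 0 (2 * pi).
  move=> A0 A1; have := @goursat K A 0 (2 * pi) (ltW A0) A1 pi20.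
  have -> : J K A 1 0 (2 * pi) = V K 1 0 (2 * pi) - V K A 0 (2 * pi).
    rewrite /J (_ : H K (2 * pi) A 1 = H K 0 A 1); first by ring.
    by rewrite /H; apply: cint_ext => s _ _; rewrite /G /c cis2pi cis0.
  move=> h; apply/eqP; rewrite -subr_eq0; apply/eqP; apply: h => s t As s1 _ _.
  by apply: dKG => //; exact: lt_le_trans As.
have cV1 : rcts 0 (2 * pi) (fun t => K (G 1 t) * (1%:C * c' t)).
  by apply: V_cts => t _ _; have [l /cdiff_cont] := dKG 1 t ltr01 (lexx _).
have wd : disc w by exact: lt_trans wr r1.
have V0 : V K 1 0 (2 * pi) = 0.
  apply/eqP; rewrite -nc_eq0 eq_le nc_ge0 andbT.
  pose M : R := 2 * (2 / (r - normc w)) * (2 * pi).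
  have rw0 : 0 < r - normc w by rewrite subr_gt0.
  have M0 : 0 <= M by rewrite !mulr_ge0 ?invr_ge0 ?(ltW rw0) ?pi_ge0.
  apply/ler_addgt0Pr => e e0; rewrite add0r.
  have M1 : 0 < M + 1 by rewrite ltr_wpDl.
  have [l /cdiff_cont cf] := df w wd.
  have [d [d0 hd]] := cf _ (divr_gt0 e0 M1).
  pose A := Num.min 1 (d / 2).
  have A0 : 0 < A by rewrite lt_min ltr01 divr_gt0.
  have A1 : A <= 1 by rewrite ge_min lexx.
  have Ad : A * 2 <= d by rewrite -ler_pdivlMr // ge_min lexx orbT.
  rewrite (V1A A A0 A1).
  apply: (le_trans (cint_bound (M := e / (M + 1) * (2 / (r - normc w))) pi20 _ _)).
  - by apply: V_cts => t _ _; have [l' /cdiff_cont] := dKG A t A0 A1.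
  - move=> t _ _; have nc_c : c t != 0 := c_neq0 t.
    have AC : A%:C != 0 :> R[i] by rewrite -nc_gt0 nc_real normr_gt0 gt_eqF.
    have -> : K (G A t) * (A%:C * c' t) = (f (w + A%:C * c t) - f w) * (c' t / c t).
      by rewrite /K /G [w + _ - w]addrC addKr; field; rewrite nc_c AC.
    rewrite ncM; apply: ler_pM; rewrite ?nc_ge0 //.
      apply: hd; rewrite ncM nc_real gtr0_norm //; apply: (le_trans _ Ad).
      by rewrite ler_wpM2l // ltW.
    rewrite ncM ncV; apply: ler_pM; rewrite ?nc_ge0 ?invr_ge0 ?nc_ge0 //.
    by rewrite lef_pV2 ?posrE ?nc_gt0.
  rewrite subr0.
  have -> : 2 * (e / (M + 1) * (2 / (r - normc w))) * (2 * pi) = e * (M / (M + 1)).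
    by rewrite /M; ring.
  by rewrite ler_piMr ?(ltW e0) // ler_pdivrMr // mul1r lerDl.
have h : V K 1 0 (2 * pi) = 'i * cint 0 (2 * pi) (fun t => (f (r%:C * cis t) - f w) *
     (r%:C * cis t / (r%:C * cis t - w))).
  have e t : K (G 1 t) * (1%:C * c' t) = 'i * ((f (r%:C * cis t) - f w) *
     (r%:C * cis t / (r%:C * cis t - w))).
    by rewrite /K /G /c' /c rmorph1 !mul1r subrKC; ring.
  rewrite -cintZ; first by apply: cint_ext => t _ _; rewrite e.
  move=> t t0 t2; have := cV1 t t0 t2; rewrite (funext e) => hh.
  have -> : (fun t => (f (r%:C * cis t) - f w) * (r%:C * cis t / (r%:C * cis t - w))) =
      (fun t => - 'i * ('i * ((f (r%:C * cis t) - f w) * (r%:C * cis t / (r%:C * cis t - w))))).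
    have ii : - 'i * 'i = 1 :> R[i] by rewrite mulNr -expr2 sqr_i opprK.
    by apply/funext => u; rewrite [RHS]mulrA ii mul1r.
  by apply: rctM => //; exact: rct_cst.
move: h; rewrite V0 => /esym/eqP; rewrite mulf_eq0 => /orP[|/eqP //].
by rewrite eq_complex /= oner_eq0 andbF.
Qed.

End Homotopy.

(** * Taylor expansion and Parseval's formula *)

Section Taylor.
Variable R : realType.
Implicit Types (f g : R[i] -> R[i]) (a b : nat -> R[i]) (r t : R).

Let pi20 : 0 <= 2 * pi :> R. Proof. by rewrite mulr_ge0 ?pi_ge0. Qed.

Lemma cint_cisX n : cint 0 (2 * pi) (fun t => cis t ^+ n.+1) = 0 :> R[i].
Proof.
have h : n.+1%:R * 'i * cint 0 (2 * pi) (fun t => cis t ^+ n.+1) = 0 :> R[i].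
  have cX : rcts 0 (2 * pi) (fun t : R => cis t ^+ n.+1).
    by move=> t *; apply: rctX; exact: rder_ct (rder_cis t).
  rewrite -cintZ // (@cint_FTC _ _ _ (fun t => cis t ^+ n.+1)) //.
  - by rewrite cis2pi cis0 subrr.
  - move=> t _ _; have := rderX n.+1 (rder_cis t).
    by congr (rder _ _ _); rewrite exprS /=; ring.
  - exact: rctsZ.
move/eqP: h; rewrite !mulf_eq0 pnatr_eq0 /= => /orP[|/eqP //].
by rewrite eq_complex /= oner_eq0 andbF.
Qed.

Lemma cis_conj t : cis t * conjc (cis t) = 1.
Proof. by rewrite conj_ncE nc_cis expr1n. Qed.

Lemma cint_conj (u v : R) F : rcts u v F ->
  cint u v (fun t => conjc (F t)) = conjc (cint u v F).
Proof.
move=> cF; apply: c_ext; rewrite ?ReJ ?ImJ /=.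
  by apply: eq_Rintegral => t _; rewrite ReJ.
rewrite -mulN1r -RintegralZl //; last exact: rcts_Im.
by apply: eq_Rintegral => t _; rewrite ImJ mulN1r.
Qed.

Lemma cint_cis_orth n m :
  cint 0 (2 * pi) (fun t => cis t ^+ n * conjc (cis t) ^+ m) =
  if n == m then (2 * pi)%:C else 0 :> R[i].
Proof.
have cX k : rcts 0 (2 * pi) (fun t : R => cis t ^+ k).
  by move=> t *; apply: rctX; exact: rder_ct (rder_cis t).
have cE t : cis t ^+ n * conjc (cis t) ^+ m =
    if (m <= n)%N then cis t ^+ (n - m) else conjc (cis t ^+ (m - n)).
  have [mn|nm] := leqP m n.
    by rewrite -{1}(subnK mn) exprD -mulrA -exprMn cis_conj expr1n mulr1.
  rewrite -{1}(subnK (ltnW nm)) [_ ^+ (m - n + n)]exprD mulrCA -exprMn cis_conj.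
  by rewrite expr1n mulr1 rmorphXn.
rewrite (cint_ext (fun t _ _ => cE t)).
have [->|nm] := eqVneq n m.
  rewrite leqnn subnn (@cint_ext _ _ _ _ (fun=> 1)) => [|t _ _]; last by rewrite expr0.
  by rewrite cint_cst // subr0 mulr1.
case: leqP => h.
  by rewrite -(subnSK (_ : m < n)%N) ?cint_cisX // ltn_neqAle eq_sym nm.
by rewrite cint_conj // -(subnSK h) cint_cisX conjc0.
Qed.

Lemma rcts_bounded (u v : R) F : u <= v -> rcts u v F ->
  exists M, 0 <= M /\ forall t, u <= t -> t <= v -> normc (F t) <= M.
Proof.
move=> uv cF.
have hb (h : R -> R) : (forall t, u <= t -> t <= v -> {for t, continuous h}) ->
    exists M, 0 <= M /\ forall t, u <= t -> t <= v -> `|h t| <= M.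
  move=> ch.
  have cw : {within `[u, v], continuous (fun t => `|h t|)}.
    apply: continuous_in_subspaceT => t; rewrite inE /= in_itv /= => /andP[ut tv].
    by apply: cvg_norm; exact: ch.
  have [c _ hc] := EVT_max uv cw.
  by exists (`|h c|); split=> // t ut tv; apply: hc; rewrite in_itv /= ut.
have [M [M0 hM]] := hb _ (fun t ut tv => (cF t ut tv).1).
have [N [N0 hN]] := hb _ (fun t ut tv => (cF t ut tv).2).
exists (M + N); split; first exact: addr_ge0.
by move=> t ut tv; apply: (le_trans (nc_le_ReIm _)); apply: lerD; [exact: hM|exact: hN].
Qed.

Definition fourier_coef f r n : R[i] :=
  (2 * pi)%:C^-1 * cint 0 (2 * pi) (fun t => f (r%:C * cis t) * (r%:C * cis t) ^- n).

Lemma ccont_inv (c : R[i]) : c != 0 -> ccont (fun z => z^-1) c.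
Proof.
move=> c0 e e0; pose m := normc c; have m0 : 0 < m by rewrite nc_gt0.
exists (Num.min (m / 2) (e * (m * m / 2))); split.
  by rewrite lt_min !(divr_gt0, mulr_gt0).
move=> h; rewrite le_min => /andP[h1 h2].
have ch : m / 2 <= normc (c + h).
  have := nc_sub_le c (- h); rewrite opprK ncN -/m; lra.
have ch0 : c + h != 0 by rewrite -nc_gt0; apply: lt_le_trans ch; rewrite divr_gt0.
have -> : (c + h)^-1 - c^-1 = - h / (c * (c + h)) by field; rewrite ch0 c0.
rewrite ncM ncN ncV ncM -/m ler_pdivrMr; last by rewrite mulr_gt0 // nc_gt0.
by apply: (le_trans h2); rewrite ler_pM2l // -mulrA ler_pM2l.
Qed.

Lemma nc_circle r t : 0 <= r -> normc (r%:C * cis t) = r.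
Proof. by move=> r0; rewrite ncM nc_cis mulr1 nc_real ger0_norm. Qed.

Lemma rct_circle r t : rct (fun t => r%:C * cis t) t.
Proof. by apply: rctM; [exact: rct_cst|exact: rder_ct (rder_cis t)]. Qed.

Lemma rcts_kernel r (w : R[i]) : normc w < r ->
  rcts 0 (2 * pi) (fun t => r%:C * cis t / (r%:C * cis t - w)).
Proof.
move=> wr t _ _; have r0 : 0 < r := le_lt_trans (nc_ge0 w) wr.
apply: rctM; first exact: rct_circle.
apply: (rct_comp (G := fun t => r%:C * cis t - w)).
  apply: ccont_inv; rewrite -nc_gt0; apply: (lt_le_trans _ (nc_sub_le _ _)).
  by rewrite nc_circle ?subr_gt0 // ltW.
by apply: rctB; [exact: rct_circle|exact: rct_cst].
Qed.

(** Expansion of the Cauchy kernel into a geometric series on a circle. *)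
Lemma cauchy_kernel_series F r (w : R[i]) : normc w < r -> rcts 0 (2 * pi) F ->
  cto (fun n => \sum_(k < n) w ^+ k * cint 0 (2 * pi) (fun t => F t * (r%:C * cis t) ^- k))
      (cint 0 (2 * pi) (fun t => F t * (r%:C * cis t / (r%:C * cis t - w)))).
Proof.
move=> wr cF; have r0 : 0 < r := le_lt_trans (nc_ge0 w) wr.
pose z t : R[i] := r%:C * cis t.
have ncz t : normc (z t) = r by rewrite ncM nc_cis mulr1 nc_real ger0_norm // ltW.
have z0 t : z t != 0 by rewrite -nc_gt0 ncz.
have zw t : z t - w != 0.
  by rewrite -nc_gt0; apply: (lt_le_trans _ (nc_sub_le _ _)); rewrite ncz subr_gt0.
have zwge t : r - normc w <= normc (z t - w) by rewrite -(ncz t); exact: nc_sub_le.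
have cz t : rct z t := rct_circle r t.
have czV t : rct (fun t => (z t)^-1) t by apply: rct_comp => //; exact: ccont_inv.
have czVX k : rcts 0 (2 * pi) (fun t => (z t) ^- k).
  move=> t _ _; rewrite (_ : (fun t => _) = (fun t => (z t)^-1 ^+ k)); first exact: rctX.
  by apply/funext => u; rewrite exprVn.
have czw : rcts 0 (2 * pi) (fun t => z t / (z t - w)) := rcts_kernel wr.
have [M [M0 hM]] := rcts_bounded pi20 cF.
pose q := normc w / r.
have q0 : 0 <= q by rewrite divr_ge0 ?nc_ge0 // ltW.
have q1 : q < 1 by rewrite ltr_pdivrMr // mul1r.
pose N := 2 * (M * (r / (r - normc w))) * (2 * pi).
apply: (@cto_le _ _ _ (fun n => N * q ^+ n)); last first.
  rewrite -[X in _ --> X](mulr0 N); apply: cvgMr; apply: cvg_expr.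
  by rewrite ger0_norm.
move=> n; rewrite /=.
have geo t : z t / (z t - w) = \sum_(k < n) w ^+ k * z t ^- k + (w / z t) ^+ n * (z t / (z t - w)).
  have -> : \sum_(k < n) w ^+ k * z t ^- k = \sum_(k < n) (w / z t) ^+ k.
    by apply: eq_bigr => k _; rewrite expr_div_n.
  have := subrX1 (w / z t) n; set X := (w / z t) ^+ n; set S := \sum_(k < n) _ => hS.
  have : (z t - w) * S = z t * (1 - X).
    have -> : z t * (1 - X) = - z t * (X - 1) by ring.
    by rewrite hS; field; exact: z0.
  move=> h; apply: (mulfI (zw t)); rewrite mulrDr h; field; exact: zw.
have cS : rcts 0 (2 * pi) (fun t => \sum_(k < n) w ^+ k * (F t * z t ^- k)).
  move=> t t0 t2; apply: (@rct_sum _ n (fun k t => w ^+ k * (F t * z t ^- k))) => k.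
  by apply: rctM; [exact: rct_cst|apply: rctM; [exact: cF|exact: czVX]].
have -> : \sum_(k < n) w ^+ k * cint 0 (2 * pi) (fun t => F t * (r%:C * cis t) ^- k)
   = cint 0 (2 * pi) (fun t => \sum_(k < n) w ^+ k * (F t * z t ^- k)).
  rewrite (@cint_sum _ _ _ n (fun k t => w ^+ k * (F t * z t ^- k))); last first.
    by move=> k; apply: rctsZ; apply: rctsM.
  by apply: eq_bigr => k _; rewrite cintZ //; apply: rctsM.
rewrite ncC -/(z _) -cintB //; last exact: rctsM.
have -> : N * q ^+ n = 2 * (M * (q ^+ n * (r / (r - normc w)))) * (2 * pi - 0).
  by rewrite /N subr0; ring.
apply: cint_bound => //; first by apply: rctsB => //; exact: rctsM.
move=> t t0 t2.
have -> : F t * (z t / (z t - w)) - \sum_(k < n) w ^+ k * (F t * z t ^- k)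
   = F t * ((w / z t) ^+ n * (z t / (z t - w))).
  rewrite {1}geo mulrDr mulr_sumr addrAC -sumrB big1 ?add0r // => k _; ring.
rewrite ncM; apply: ler_pM; rewrite ?nc_ge0 ?hM //.
rewrite ncM ncX !ncM !ncV ncz; apply: ler_pM; rewrite ?exprn_ge0 ?mulr_ge0 ?invr_ge0 ?nc_ge0 //.
  exact: ltW.
by rewrite -ncM ncz ler_pM2l // lef_pV2 ?posrE ?subr_gt0 ?nc_gt0.
Qed.

(** The formula of [cauchy_kernel], with the kernel expanded into a geometric
    series. *)
Lemma taylor_local f r (w : R[i]) : holomorphic_on_disc f -> normc w < r -> r < 1 ->
  cto (psum (fourier_coef f r) w) (f w).
Proof.
move=> hf wr r1; have r0 : 0 < r := le_lt_trans (nc_ge0 w) wr.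
have df z : disc z -> exists l, cdiff f z l by move=> /hf; exact: derivable_cdiff.
have dK z : disc z -> z != w -> exists l, cdiff (fun z => (f z - f w) / (z - w)) z l.
  move=> dz zw; apply: derivable_cdiff.
  pose F : cplx R -> cplx R := fun z => f z - f w.
  pose G : cplx R -> cplx R := fun z => z - w.
  have d1 : derivable F z 1.
    by apply: derivableB; [exact: hf|exact: derivable_cst].
  have d2 : derivable G z 1.
    by apply: derivableB; [exact: derivable_id|exact: derivable_cst].
  have Gz : G z != 0 by rewrite subr_eq0.
  exact: (derivableM d1 (derivableV Gz d2)).
have := cauchy_kernel wr r1 df dK.
pose z t : R[i] := r%:C * cis t.
have zd t : disc (z t).
  by rewrite /disc /mkset ncM nc_cis mulr1 nc_real ger0_norm // ltW.
have cz t : rct z t := rct_circle r t.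
have cf : rcts 0 (2 * pi) (fun t => f (z t)).
  by move=> t _ _; apply: rct_comp => //; have [l /cdiff_cont] := df _ (zd t).
have s1 := cauchy_kernel_series wr cf.
have s2 := cauchy_kernel_series wr (@rcts_cst _ 0 (2 * pi) 1).
set I2 := cint _ _ _ in s2.
set I1 := cint _ _ _ in s1.
have I2E : I2 = (2 * pi)%:C.
  apply: (cto_uniq (cto_shift 1 s2)); apply: (cto_eq _ (cto_cst _)) => n.
  rewrite addn1 big_ord_recl big1 ?addr0 => [|k _].
    rewrite expr0 mul1r (@cint_ext _ _ _ _ (fun=> 1)) ?cint_cst ?subr0 ?mulr1 //.
    by move=> t _ _; rewrite expr0 invr1 mulr1.
  have -> : cint 0 (2 * pi) (fun t => 1 * (r%:C * cis t) ^- lift ord0 k) =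
      cint 0 (2 * pi) (fun t => r%:C ^- k.+1 * (cis t ^+ 0 * conjc (cis t) ^+ k.+1)).
    apply: cint_ext => t _ _; rewrite mul1r /= /bump /= add1n exprMn invfM mul1r.
    congr (_ * _); have c0 : cis t != 0 by rewrite -nc_gt0 nc_cis.
    apply: (mulfI (expf_neq0 k.+1 c0)).
    by rewrite mulfV ?expf_neq0 // -exprMn cis_conj expr1n.
  rewrite cintZ ?cint_cis_orth ?mulr0 // => t _ _.
  apply: rctM; apply: rctX; first exact: rder_ct (rder_cis t).
  by apply: rct_conj; exact: rder_ct (rder_cis t).
have ck := rcts_kernel wr.
rewrite (@cint_ext _ _ _ _ (fun t => f (z t) * (z t / (z t - w)) -
   f w * (1 * (z t / (z t - w))))); last by move=> t _ _; rewrite mulrBl mul1r.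
rewrite cintB; last 2 first.
- exact: rctsM.
- by apply: rctsZ; apply: rctsM => //; exact: rcts_cst.
rewrite cintZ; last by apply: rctsM => //; exact: rcts_cst.
rewrite -/I1 -/I2 I2E => /eqP; rewrite subr_eq0 => /eqP I1E.
have p0 : (2 * pi)%:C != 0 :> R[i].
  by rewrite -nc_gt0 nc_real normr_gt0 mulf_neq0 // gt_eqF // pi_gt0.
have := ctoZ ((2 * pi)%:C^-1) s1; rewrite I1E [f w * _]mulrC mulKf //.
apply: cto_eq => n; rewrite mulr_sumr; apply: eq_bigr => k _.
by rewrite /fourier_coef mulrCA mulrC.
Qed.

End Taylor.

Section Parseval.
Variable R : realType.
Implicit Types (f g : R[i] -> R[i]) (a b : nat -> R[i]) (r t : R).

Let pi20 : 0 <= 2 * pi :> R. Proof. by rewrite mulr_ge0 ?pi_ge0. Qed.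

Let p0 : (2 * pi)%:C != 0 :> R[i].
Proof. by rewrite -nc_gt0 nc_real normr_gt0 mulf_neq0 // gt_eqF // pi_gt0. Qed.

Lemma circle_innerE f g r : circle_inner f g r =
  (2 * pi)%:C^-1 * cint 0 (2 * pi) (fun t => f (r%:C * cis t) * conjc (g (r%:C * cis t))).
Proof.
rewrite /circle_inner /= -fmorphV; congr (_ * _); rewrite /cint.
by congr (_ +i* _); apply: eq_Rintegral => t _; rewrite circle_cis.
Qed.

Lemma conj_circle r t : conjc (r%:C * cis t) = r%:C * conjc (cis t).
Proof. by apply: c_ext; rewrite !(ReJ, ImJ, ReM, ImM) /=; ring. Qed.

Lemma disc_circle r t : 0 <= r -> r < 1 -> disc (r%:C * cis t).
Proof. by move=> r0 r1; rewrite /disc /mkset nc_circle. Qed.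

Lemma rep_circle_cts f a r : rep f a -> 0 <= r -> r < 1 ->
  rcts 0 (2 * pi) (fun t => f (r%:C * cis t)).
Proof.
move=> fa r0 r1 t _ _; apply: rct_comp; last exact: rct_circle.
have [f' fa'] := growth_rep (growth_dera (rep_growth fa)).
exact: cdiff_cont (rep_cdiff fa fa' (disc_circle t r0 r1)).
Qed.

Lemma psum_circle_cts a r n : rcts 0 (2 * pi) (fun t => psum a (r%:C * cis t) n).
Proof.
move=> t _ _; apply: (@rct_sum _ n (fun k t => a k * (r%:C * cis t) ^+ k)) => k.
by apply: rctM; [exact: rct_cst|apply: rctX; exact: rct_circle].
Qed.

Lemma psum_conj b r t n : conjc (psum b (r%:C * cis t) n) =
  \sum_(j < n) conjc (b j) * (r%:C * conjc (cis t)) ^+ j.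
Proof.
rewrite /psum rmorph_sum; apply: eq_bigr => j _.
transitivity (conjc (b j) * conjc (r%:C * cis t) ^+ j).
  by rewrite -rmorphXn -rmorphM.
by rewrite conj_circle.
Qed.

Lemma psum_inner a b r n :
  cint 0 (2 * pi) (fun t => psum a (r%:C * cis t) n * conjc (psum b (r%:C * cis t) n)) =
  (2 * pi)%:C * \sum_(k < n) a k * conjc (b k) * (r ^+ (2 * k))%:C.
Proof.
have cc i j : rcts 0 (2 * pi) (fun t : R => cis t ^+ i * conjc (cis t) ^+ j).
  by move=> t _ _; apply: rctM; apply: rctX; [|apply: rct_conj]; exact: rder_ct (rder_cis t).
have e t : psum a (r%:C * cis t) n * conjc (psum b (r%:C * cis t) n) =
   \sum_(i < n) \sum_(j < n) (a i * conjc (b j) * (r ^+ (i + j))%:C) *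
      (cis t ^+ i * conjc (cis t) ^+ j).
  rewrite psum_conj /psum mulr_suml; apply: eq_bigr => i _.
  rewrite mulr_sumr; apply: eq_bigr => j _.
  by rewrite exprD rmorphM !rmorphXn !exprMn; ring.
rewrite (cint_ext (fun t _ _ => e t)).
rewrite (@cint_sum _ _ _ n (fun i t => \sum_(j < n) (a i * conjc (b j) * (r ^+ (i + j))%:C) *
      (cis t ^+ i * conjc (cis t) ^+ j))); last first.
  move=> i t t0 t2; apply: (@rct_sum _ n (fun j t => (a i * conjc (b j) * (r ^+ (i + j))%:C) *
      (cis t ^+ i * conjc (cis t) ^+ j))) => j.
  by apply: rctM; [exact: rct_cst|exact: cc].
rewrite mulr_sumr; apply: eq_bigr => i _.
rewrite (@cint_sum _ _ _ n (fun j t => (a i * conjc (b j) * (r ^+ (i + j))%:C) *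
      (cis t ^+ i * conjc (cis t) ^+ j))); last by move=> j; apply: rctsZ; exact: cc.
rewrite (bigD1 i) //= big1 ?addr0 => [|j ji].
  by rewrite cintZ; [rewrite cint_cis_orth eqxx addnn -mul2n mulrC|exact: cc].
rewrite cintZ; last exact: cc.
rewrite cint_cis_orth.
by case: eqP => [ij|_]; [move/eqP: ji; case; exact: val_inj|rewrite mulr0].
Qed.

Lemma rep_circle_dom f a r : rep f a -> 0 <= r -> r < 1 ->
  exists C q, [/\ 0 <= C, 0 <= q, q < 1 & forall n t,
    normc (f (r%:C * cis t) - psum a (r%:C * cis t) n) <= C * q ^+ n /\
    normc (psum a (r%:C * cis t) n) <= C].
Proof.
move=> fa r0 r1; have [M [q [M0 q0 q1 h]]] := growth_dom (rep_growth fa) r0 r1.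
exists (M / (1 - q)), q; split=> //; first by rewrite divr_ge0 // subr_ge0 ltW.
move=> n t; have ht : normc (r%:C * cis t) <= r by rewrite nc_circle.
have hk := growth_term ht h; split.
  have := geom_lim_tail q0 q1 hk (fa _ (disc_circle t r0 r1)) n.
  by rewrite [_ / _ * _]mulrAC.
by have := geom_tail q0 q1 hk 0 n; rewrite add0n big_ord0 subr0 expr0 mulr1.
Qed.

(** Orthogonality of the powers of [cis] computes the pairing of partial sums,
    which converge uniformly on the circle. *)
Lemma parseval f g a b r : rep f a -> rep g b -> 0 <= r -> r < 1 ->
  cto (fun n => \sum_(k < n) a k * conjc (b k) * (r ^+ (2 * k))%:C) (circle_inner f g r).
Proof.
move=> fa gb r0 r1.
have [C [q [C0 q0 q1 hC]]] := rep_circle_dom fa r0 r1.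
have [D [p [D0 p0' p1 hD]]] := rep_circle_dom gb r0 r1.
have cf := rep_circle_cts fa r0 r1.
have cg : rcts 0 (2 * pi) (fun t => conjc (g (r%:C * cis t))).
  by move=> t t0 t2; apply: rct_conj; exact: (rep_circle_cts gb r0 r1).
pose N := normc ((2 * pi)%:C^-1 : R[i]) * (2 * (2 * pi - 0)).
have N0 : 0 <= N by rewrite mulr_ge0 ?nc_ge0 // mulr_ge0 // subr0.
apply: (@cto_le _ _ _ (fun n => N * (C * (D + D)) * q ^+ n + N * (C * D) * p ^+ n)); last first.
  rewrite -[X in _ --> X](addr0 (0:R)); apply: cvgD.
    rewrite -[X in _ --> X](mulr0 (N * (C * (D + D)))); apply: cvgMr.
    by apply: cvg_expr; rewrite ger0_norm.
  rewrite -[X in _ --> X](mulr0 (N * (C * D))); apply: cvgMr.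
  by apply: cvg_expr; rewrite ger0_norm.
move=> n /=; rewrite circle_innerE.
have ca := psum_circle_cts a r n.
have cb : rcts 0 (2 * pi) (fun t => conjc (psum b (r%:C * cis t) n)).
  by move=> t t0 t2; apply: rct_conj; exact: psum_circle_cts.
rewrite -[\sum_(k < n) _](mulKf p0) -psum_inner -mulrBr -cintB; [|exact: rctsM|exact: rctsM].
rewrite ncM.
have -> : N * (C * (D + D)) * q ^+ n + N * (C * D) * p ^+ n =
   normc ((2 * pi)%:C^-1 : R[i]) * (2 * (C * q ^+ n * (D + D) + C * (D * p ^+ n)) * (2 * pi - 0)).
  by rewrite /N; ring.
apply: ler_wpM2l; first exact: nc_ge0.
apply: cint_bound => //; first by apply: rctsB; apply: rctsM.
move=> t _ _.
set F := f _; set G := g _; set Fn := psum a _ _; set Gn := psum b _ _.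
have -> : Fn * conjc Gn - F * conjc G = (Fn - F) * conjc G + Fn * (conjc Gn - conjc G) by ring.
apply: (le_trans (ncD _ _)); rewrite !ncM -rmorphB !nc_conj.
have [h1 h2] := hC n t; have [h3 h4] := hD n t.
have hG : normc G <= D + D.
  rewrite -[G](subrK Gn); apply: (le_trans (ncD _ _)); apply: lerD => //.
  by apply: (le_trans h3); rewrite ler_piMr // exprn_ile1 // ltW.
apply: lerD; apply: ler_pM; rewrite ?nc_ge0 //; first by rewrite ncC.
by rewrite ncC.
Qed.

Lemma rep_pow n : rep (fun z : R[i] => z ^+ n) (fun k => (k == n)%:R).
Proof.
move=> z _; apply/ctoP => e e0; exists n.+1 => m nm.
rewrite /psum (bigD1 (Ordinal nm)) //= eqxx mul1r big1 ?addr0 ?subrr ?nc0 ?ltW //.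
by move=> i /eqP im; case: eqP => [h|_]; rewrite ?mul0r //; case: im; exact: val_inj.
Qed.

(** The expansion on the larger disc holds on the smaller circle, where pairing
    with a power of [z] by Parseval's formula reads off a coefficient. *)
Lemma fourier_coef_indep f r s n : holomorphic_on_disc f -> 0 < s -> s < r -> r < 1 ->
  fourier_coef f s n = fourier_coef f r n.
Proof.
move=> hf s0 sr r1; have r0 := lt_trans s0 sr.
pose a k := fourier_coef f r k * r%:C ^+ k.
have fa : rep (fun z => f (r%:C * z)) a.
  move=> z dz; have rz : normc (r%:C * z) < r.
    by rewrite ncM nc_real gtr0_norm // -[ltRHS]mulr1 ltr_pM2l.
  apply: cto_eq (taylor_local hf rz r1) => m; apply: eq_bigr => k _.
  by rewrite /a exprMn mulrA.
have q0 : 0 <= s / r by rewrite divr_ge0 // ltW.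
have q1 : s / r < 1 by rewrite ltr_pdivrMr // mul1r.
have := parseval fa (rep_pow n) q0 q1.
have cs0 : s%:C != 0 :> R[i] by rewrite -nc_gt0 nc_real normr_gt0 gt_eqF.
have cr0 : r%:C != 0 :> R[i] by rewrite -nc_gt0 nc_real normr_gt0 gt_eqF.
have c0 t : cis t != 0 :> R[i] by rewrite -nc_gt0 nc_cis.
have -> : circle_inner (fun z => f (r%:C * z)) (fun z => z ^+ n) (s / r) =
    fourier_coef f s n * (s%:C ^+ n * (s / r)%:C ^+ n).
  rewrite circle_innerE /fourier_coef -mulrA; congr (_ * _); rewrite [RHS]mulrC -cintZ.
    apply: cint_ext => t _ _; rewrite mulrA -rmorphM [r * _]mulrC divfK ?gt_eqF //.
    have -> : conjc (((s / r)%:C * cis t) ^+ n) = ((s / r)%:C * conjc (cis t)) ^+ n.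
      by rewrite -conj_circle -rmorphXn.
    have -> : conjc (cis t) = (cis t)^-1.
      by apply: (mulfI (c0 t)); rewrite cis_conj mulfV.
    rewrite !exprMn !exprVn rmorphM /= fmorphV; field.
    by rewrite ?expf_neq0 // cr0 c0.
  move=> t _ _; rewrite (_ : (fun t => _) = (fun t => f (s%:C * cis t) * (s%:C * cis t)^-1 ^+ n)).
    have [l /cdiff_cont cf] := derivable_cdiff (hf _ (disc_circle t (ltW s0) (lt_trans sr r1))).
    apply: rctM; first by apply: rct_comp => //; exact: rct_circle.
    apply: rctX; apply: rct_comp; last exact: rct_circle.
    by apply: ccont_inv; rewrite mulf_neq0.
  by apply/funext => u; rewrite exprVn.
move=> /(cto_shift n.+1) h; have {}h := cto_uniq h.
have : cto (fun m : nat => a n * ((s / r) ^+ (2 * n))%:C) (a n * ((s / r) ^+ (2 * n))%:C).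
  exact: cto_cst.
move=> h2; have {h2}h2 : cto (fun m => \sum_(k < m + n.+1)
    a k * conjc ((k == n :> nat)%:R) * ((s / r) ^+ (2 * k))%:C) (a n * ((s / r) ^+ (2 * n))%:C).
  apply: cto_eq h2 => m; have nm : (n < m + n.+1)%N by rewrite addnS ltnS leq_addl.
  rewrite (bigD1 (Ordinal nm)) //= eqxx conjc1 mulr1 big1 ?addr0 // => i /eqP im.
  case: eqP => [hh|_]; last by rewrite conjc0 mulr0 mul0r.
  by case: im; exact: val_inj.
have e2 : ((s / r) ^+ (2 * n))%:C = (s / r)%:C ^+ n * (s / r)%:C ^+ n :> R[i].
  by rewrite mul2n -addnn exprD rmorphM rmorphXn.
have := h _ h2; rewrite /a e2.
have sr0 : (s / r)%:C ^+ n != 0 :> R[i].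
  by rewrite expf_neq0 // rmorphM fmorphV mulf_neq0 ?invr_eq0.
have -> : s%:C ^+ n = r%:C ^+ n * (s / r)%:C ^+ n :> R[i].
  by rewrite -exprMn -rmorphM mulrCA mulfV ?mulr1 // gt_eqF.
move=> hh; apply: (mulIf (expf_neq0 n cr0)); apply: (mulIf sr0); apply: (mulIf sr0).
by move: (fourier_coef f s n) (fourier_coef f r n) hh => X Y; rewrite !mulrA.
Qed.

(** The local expansions have the same coefficients, so one power series
    represents [f] on the whole disc. *)
Lemma holo_rep f : holomorphic_on_disc f -> exists a, rep f a.
Proof.
move=> hf; exists (fourier_coef f 2^-1) => w dw.
pose r := (1 + Num.max (normc w) 2^-1) / 2.
have h2 : 2^-1 < 1 :> R by rewrite invf_lt1 // ltr1n.
have hm : Num.max (normc w) 2^-1 < 1 by rewrite gt_max h2 andbT; exact: dw.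
have hw : normc w <= Num.max (normc w) 2^-1 by rewrite le_max lexx.
have h2' : 2^-1 <= Num.max (normc w) 2^-1 by rewrite le_max lexx orbT.
have [r1 wr r2] : [/\ r < 1, normc w < r & 2^-1 < r].
  by rewrite /r; move: hm hw h2'; set m := Num.max _ _; split; lra.
apply: cto_eq (taylor_local hf wr r1) => n; apply: eq_bigr => k _.
by rewrite (@fourier_coef_indep f r 2^-1).
Qed.

End Parseval.

(** * Coefficient energies and the Hardy norm *)

Section Hardy.
Variable R : realType.
Implicit Types (f g : R[i] -> R[i]) (a b : nat -> R[i]) (w : nat -> R) (r X : R).

Definition wle w a X : Prop := forall n, \sum_(k < n) w k * normc (a k) ^+ 2 <= X.

Definition one_weight : nat -> R := fun=> 1.

(** Bernoulli's inequality. *)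
Lemma pow_ge_lin r m : 0 <= r -> r <= 1 -> 1 - m%:R * (1 - r) <= r ^+ m.
Proof.
move=> r0 r1; elim: m => [|m IH]; first by rewrite mul0r subr0 expr0.
have rm1 : r ^+ m <= 1 by rewrite exprn_ile1.
have : (1 - r) * r ^+ m <= 1 - r by rewrite -[leRHS]mulr1 ler_wpM2l // subr_ge0.
rewrite exprS -natr1 mulrDl mul1r.
move=> h; have -> : r * r ^+ m = r ^+ m - (1 - r) * r ^+ m by ring.
lra.
Qed.

Lemma circle_mean_sqE f a r : rep f a -> 0 <= r -> r < 1 ->
  circle_mean_sq f r = (complex.Re (circle_inner f f r))%:E.
Proof.
move=> fa r0 r1.
have cf := rep_circle_cts fa r0 r1.
have cff : rcts 0 (2 * pi) (fun t => f (r%:C * cis t) * conjc (f (r%:C * cis t))).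
  by apply: rctsM => // t t0 t2; apply: rct_conj; exact: cf.
have int := rcts_Re cff.
rewrite circle_innerE -fmorphV ReM /= mul0r subr0 EFinM /circle_mean_sq; congr (_ * _)%E.
rewrite /Rintegral fineK; last exact: integrable_fin_num.
by apply: eq_integral => t _; rewrite nc_sqrE circle_cis.
Qed.

Lemma circle_mean_sq_cvg f a r : rep f a -> 0 <= r -> r < 1 ->
  (\sum_(k < n) normc (a k) ^+ 2 * r ^+ (2 * k)) @[n --> \oo] -->
  complex.Re (circle_inner f f r).
Proof.
move=> fa r0 r1; have := cto_Re (parseval fa fa r0 r1).
rewrite (_ : (fun n => _) = (fun n => \sum_(k < n) normc (a k) ^+ 2 * r ^+ (2 * k))) //.
apply/funext => n; rewrite Re_sum; apply: eq_bigr => k _.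
by rewrite conj_ncE -rmorphM.
Qed.

Lemma wle_ge0 w a X : wle w a X -> 0 <= X.
Proof. by move=> /(_ 0%N); rewrite big_ord0. Qed.

Lemma hardy_sup_le f a X : rep f a -> wle one_weight a X ->
  (ereal_sup [set circle_mean_sq f r | r in `[0%R, 1%R[] <= X%:E)%E.
Proof.
move=> fa aX; apply: ge_ereal_sup => _ /= [r rI <-]; move: rI; rewrite /= in_itv /= => /andP[r0 r1].
rewrite (circle_mean_sqE fa) // lee_fin.
apply: (cvg_le_cst (circle_mean_sq_cvg fa r0 r1)) => n; apply: (le_trans _ (aX n)).
by apply: ler_sum => k _; rewrite mul1r ler_piMr ?sqr_ge0 // exprn_ile1 // ltW.
Qed.

Lemma sqrte_le (x : \bar R) X : (x <= X%:E)%E -> (sqrte x <= (Num.sqrt X)%:E)%E.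
Proof.
case: x => [y| |] /=.
- by rewrite !lee_fin => h; exact: ler_wsqrtr.
- by rewrite leye_eq.
by move=> _; rewrite lee_fin sqrtr_ge0.
Qed.

Lemma hardy_norm_le f a X : rep f a -> wle one_weight a X ->
  (hardy_norm f <= (Num.sqrt X)%:E)%E.
Proof. by move=> fa aX; apply: sqrte_le; exact: hardy_sup_le fa aX. Qed.

Lemma sqrte_ltoo (x : \bar R) : (sqrte x < +oo)%E -> (x < +oo)%E.
Proof. by case: x => [y| |] //= _; rewrite ltry. Qed.

(** Partial sums in Parseval's formula are bounded uniformly in the radius;
    Bernoulli's inequality controls the limit at radius one. *)
Lemma hardy_norm_fin f a : rep f a -> (hardy_norm f < +oo)%E ->
  exists X, wle one_weight a X.
Proof.
move=> fa /sqrte_ltoo; set S := ereal_sup _ => Soo.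
have hS r : 0 <= r -> r < 1 -> (circle_mean_sq f r <= S)%E.
  by move=> r0 r1; apply: ereal_sup_ubound; exists r => //=; rewrite in_itv /= r0.
have [X SX] : exists X, (S <= X%:E)%E.
  by case: S Soo hS => [y| |] // _ _; [exists y|exists 0; rewrite leNye].
exists X => n; pose c k := normc (a k) ^+ 2.
pose D := \sum_(k < n) (2 * k)%:R * c k.
have D0 : 0 <= D by apply: sumr_ge0 => k _; rewrite mulr_ge0 // sqr_ge0.
have key r : 0 <= r -> r < 1 -> \sum_(k < n) c k * r ^+ (2 * k) <= X.
  move=> r0 r1; have hr := hS r r0 r1.
  have {}hr : complex.Re (circle_inner f f r) <= X.
    by rewrite -lee_fin -(circle_mean_sqE fa) // (le_trans hr).
  apply: (le_trans _ hr).
  apply: (cvg_ge_partial (circle_mean_sq_cvg fa r0 r1)) => m p mp.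
  rewrite -(subnKC mp) big_split_ord /= lerDl; apply: sumr_ge0 => k _.
  by rewrite mulr_ge0 ?sqr_ge0 // exprn_ge0.
apply/ler_addgt0Pr => e e0; have D1 : 0 < D + 1 by rewrite ltr_wpDl.
pose s := Num.min 1 (e / (D + 1)).
have s0 : 0 < s by rewrite lt_min ltr01 divr_gt0.
have s1 : s <= 1 by rewrite ge_min lexx.
have sD : s * D <= e.
  apply: (@le_trans _ _ (s * (D + 1))); first by rewrite ler_wpM2l ?(ltW s0) ?lerDl.
  by rewrite -ler_pdivlMr // ge_min lexx orbT.
have := key (1 - s) ltac:(by rewrite subr_ge0) ltac:(by rewrite gtrBl).
move=> h; apply: (le_trans _ (lerD h sD)).
rewrite mulr_sumr -big_split /=; apply: ler_sum => k _; rewrite mul1r.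
have := @pow_ge_lin (1 - s) (2 * k) ltac:(by rewrite subr_ge0) ltac:(by rewrite gerBl ltW).
have -> : 1 - (1 - s) = s by ring.
move=> h2.
have c0 : 0 <= c k := sqr_ge0 _.
have -> : s * ((2 * k)%:R * c k) = c k * ((2 * k)%:R * s) by ring.
by rewrite -mulrDr -[leLHS]mulr1 ler_wpM2l // -lerBlDr.
Qed.

(** Absolute convergence at a geometric rate makes the limit at the boundary
    elementary, by Bernoulli's inequality. *)
Lemma hardy_innerE f g a b (C q : R) (l : R[i]) : rep f a -> rep g b ->
  0 <= q -> q < 1 -> (forall k, normc (a k * conjc (b k)) <= C * q ^+ k) ->
  cto (fun n => \sum_(k < n) a k * conjc (b k)) l -> hardy_inner f g = l.
Proof.
move=> fa gb q0 q1 hC hl.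
have C0 : 0 <= C by have := hC 0%N; rewrite expr0 mulr1; apply: le_trans; exact: nc_ge0.
pose p := (1 + q) / 2; have [p0 p1 qp] : [/\ 0 < p, p < 1 & q < p] by rewrite /p; split; lra.
have [qp0 qp1] : 0 <= q / p /\ q / p < 1.
  by split; [rewrite divr_ge0 // ltW|rewrite ltr_pdivrMr // mul1r].
pose K := 2 * C * (1 - q / p)^-1 * (1 - p)^-1.
have K0 : 0 <= K by rewrite !mulr_ge0 ?invr_ge0 ?subr_ge0 // ltW.
have key r : 0 <= r -> r < 1 -> normc (circle_inner f g r - l) <= (1 - r) * K.
  move=> r0 r1; apply: (cto_bound (ctoB (parseval fa gb r0 r1) hl)) => n.
  rewrite -sumrB; apply: (le_trans (nc_sum _ _ _)).
  apply: (@le_trans _ _ (\sum_(k < n) (1 - r) * (2 * C * (1 - q / p)^-1) * p ^+ k)).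
    apply: ler_sum => k _.
    have -> : a k * conjc (b k) * (r ^+ (2 * k))%:C - a k * conjc (b k) =
        a k * conjc (b k) * (r ^+ (2 * k) - 1)%:C by rewrite rmorphB rmorph1; ring.
    rewrite ncM nc_real distrC ger0_norm ?subr_ge0 ?exprn_ile1 ?(ltW r1) //.
    have h1 := pow_ge_lin (2 * k) r0 (ltW r1).
    have h2 : 1 - r ^+ (2 * k) <= (2 * k)%:R * (1 - r) by rewrite lerBlDr -lerBlDl.
    have h3 : 0 <= 1 - r ^+ (2 * k) by rewrite subr_ge0 exprn_ile1 // ltW.
    apply: (le_trans (ler_pM (nc_ge0 _) h3 (hC k) h2)).
    have -> : C * q ^+ k * ((2 * k)%:R * (1 - r)) =
        (1 - r) * 2 * C * (k%:R * (q / p) ^+ k) * p ^+ k.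
      by rewrite expr_div_n natrM; field; rewrite expf_neq0 // gt_eqF.
    rewrite ler_wpM2r ?exprn_ge0 ?(ltW p0) // !mulrA -!(mulrA (1 - r)).
    rewrite -!mulrA; do 3 (rewrite ler_wpM2l ?subr_ge0 ?(ltW r1) //).
    exact: nat_geom_bound.
  rewrite -mulr_sumr /K !mulrA ler_wpM2l ?geom_sum_le ?(ltW p0) //.
  by rewrite !mulr_ge0 ?invr_ge0 ?subr_ge0 // ltW.
suff hc : (circle_inner f g r : cplx R) @[r --> (1 : R)^'-] --> (l : cplx R).
  by rewrite /hardy_inner; apply: (cvg_lim _ hc) => //; exact: norm_hausdorff.
apply/cvgrPdist_le => e e0.
have [re0 eE] : 0 < complex.Re e /\ e = (complex.Re e)%:C.
  move: e0; rewrite ltcE => /andP[/eqP i0 r0]; split => //.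
  by case: e i0 r0 => x y /= ->.
have K1 : 0 < K + 1 by rewrite ltr_wpDl.
pose d := Num.min 1 (complex.Re e / (K + 1)).
have d0 : 0 < d by rewrite lt_min ltr01 divr_gt0.
exists d => // r /= hr r1.
have [h1 h2] : 0 <= r /\ 1 - r <= d.
  move: hr; rewrite gtr0_norm ?subr_gt0 // => /ltW hr; split => //.
  have : 1 - r <= 1 by apply: (le_trans hr); rewrite ge_min lexx.
  by rewrite lerBlDl lerDr.
rewrite eE /Num.Def.normr /= lecR ncC; apply: (le_trans (key r h1 r1)).
have : (1 - r) * (K + 1) <= complex.Re e.
  by rewrite -ler_pdivlMr // (le_trans h2) // ge_min lexx orbT.
by apply: le_trans; rewrite ler_wpM2l ?lerDl // subr_ge0 ltW.
Qed.

End Hardy.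

(** * Invariance of planar Lebesgue measure *)

Ltac meas := repeat first [exact: measurable_fst | exact: measurable_snd
  | exact: measurable_cst | apply: measurable_funB | apply: measurable_funD
  | apply: measurable_funM | done].

Section Invariance.
Variable R : realType.
Notation mu := (@lebesgue_measure R).
Notation R := (R : Type).
Implicit Types (F : R * R -> \bar R) (c s : R).

Lemma lebesgue_translation (g : R -> \bar R) c : measurable_fun setT g ->
  (forall x, 0 <= g x)%E ->
  (\int[mu]_x g (x + c)%R = \int[mu]_x g x)%E.
Proof.
move=> mg g0.
have mphi : measurable_fun setT (fun x : R => (x + c)%R : R).
  by apply: continuous_measurable_fun => x; apply: cvgD; [exact: cvg_id|exact: cvg_cst].
have := @ge0_integral_pushforward _ _ (measurableTypeR R) (measurableTypeR R) R _ mphi mu setT g measurableT mg (fun y _ => g0 y).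
rewrite preimage_setT => <-.
apply: eq_measure_integral => A mA _; apply/esym/lebesgue_measure_unique => // _ [[a b]] _ <-.
transitivity (mu `]a - c, b - c]%classic); last first.
  congr (mu _); apply/seteqP; split => x /=; by rewrite !in_itv /= ltrBlDr lerBrDr.
rewrite !lebesgue_measure_itv /= !lte_fin ltrD2r; case: ifP => // _.
by congr (_%:E); lra.
Qed.

Lemma lebesgue_scaling (g : R -> \bar R) c : 0 < c -> measurable_fun setT g ->
  (forall x, 0 <= g x)%E ->
  (\int[mu]_x g x = c%:E * \int[mu]_x g (c * x)%R)%E.
Proof.
move=> c0 mg g0.
have mphi : measurable_fun setT (fun x : R => (c * x)%R : R).
  by apply: continuous_measurable_fun => x; apply: cvgM; [exact: cvg_cst|exact: cvg_id].
have := @ge0_integral_pushforward _ _ (measurableTypeR R) (measurableTypeR R) R _ mphi mu setT g measurableT mg (fun y _ => g0 y).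
rewrite preimage_setT => <-.
have c0' : 0 <= c by exact: ltW.
have mphi' : measurable_fun setT (fun x : measurableTypeR R => (c * x)%R : measurableTypeR R).
  exact: mphi.
pose pf := measure_function_pushforward__canonical__measure_function_Measure mu mphi'.
pose nu := mscale (NngNum c0') pf.
transitivity (\int[nu]_x g x)%E; last by rewrite ge0_integral_mscale.
apply: eq_measure_integral => A mA _; apply: lebesgue_measure_unique => // _ [[a b]] _ <-.
transitivity (c%:E * mu `](c^-1 * a)%R, (c^-1 * b)%R]%classic)%E; last first.
  rewrite /nu /mscale /=; congr (_ * mu _)%E.
  by apply/seteqP; split => x /=; rewrite !in_itv /= ltr_pdivrMl // ler_pdivlMl.
rewrite !lebesgue_measure_itv /= !lte_fin ltr_pM2l ?invr_gt0 //; case: ifP => _.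
  by rewrite -EFinB -EFinM; congr (_%:E); rewrite mulrBr !mulrA mulfV ?gt_eqF // !mul1r.
by rewrite mule0.
Qed.

Lemma m_fst d (T : measurableType d) (f : T -> R) (g : T -> R) F :
  measurable_fun setT F -> measurable_fun setT f -> measurable_fun setT g ->
  measurable_fun setT (fun t => F (f t, g t)).
Proof.
by move=> mF mf mg; apply: (measurableT_comp mF); exact: measurable_fun_pair.
Qed.

Lemma plane_shear1 F c : measurable_fun setT F -> (forall p, 0 <= F p)%E ->
  (\int[mu \x mu]_p F (p.1 + c * p.2, p.2)%R = \int[mu \x mu]_p F p)%E.
Proof.
move=> mF F0; rewrite !fubini_tonelli2 //; last first.
  by apply: m_fst => //; meas.
apply: eq_integral => y _; rewrite /fubini_G /=.
by apply: (lebesgue_translation (g := fun x => F (x, y))) => //; exact: m_fst.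
Qed.

Lemma plane_shear2 F c : measurable_fun setT F -> (forall p, 0 <= F p)%E ->
  (\int[mu \x mu]_p F (p.1, p.2 + c * p.1)%R = \int[mu \x mu]_p F p)%E.
Proof.
move=> mF F0; rewrite !fubini_tonelli1 //; last first.
  by apply: m_fst => //; meas.
apply: eq_integral => x _; rewrite /fubini_F /=.
by apply: (lebesgue_translation (g := fun y => F (x, y))) => //; exact: m_fst.
Qed.

Lemma plane_scaling F c : 0 < c -> measurable_fun setT F -> (forall p, 0 <= F p)%E ->
  (\int[mu \x mu]_p F p = (c ^+ 2)%:E * \int[mu \x mu]_p F (c * p.1, c * p.2)%R)%E.
Proof.
move=> c0 mF F0; rewrite !fubini_tonelli1 //; last first.
  by apply: m_fst => //; meas.
have mG : measurable_fun setT (fubini_F mu F) by exact: measurable_fun_fubini_tonelli_F.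
have mF' : measurable_fun setT (fun p => F (p.1, c * p.2)%R).
  by apply: m_fst => //; meas.
have fE x : (fubini_F mu F x = c%:E * fubini_F mu (fun p => F (p.1, c * p.2)%R) x)%E.
  rewrite /fubini_F /= (@lebesgue_scaling (fun y => F (x, y)) c) //; exact: m_fst.
rewrite (@lebesgue_scaling (fubini_F mu F) c) //; last first.
  by move=> x; apply: integral_ge0.
under eq_integral do rewrite fE.
rewrite ge0_integralZl_EFin //; last 3 first.
- by move=> x _; apply: integral_ge0.
- apply: (measurableT_comp (f := fubini_F mu (fun p => F (p.1, c * p.2)%R))).
    exact: measurable_fun_fubini_tonelli_F.
  exact: measurable_funM.
- exact: ltW.
by rewrite muleA -EFinM -expr2.
Qed.

(** A rotation other than the half turn is a product of three shears, which
    preserve the measure by Tonelli's theorem and translation invariance; the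
    half turn is a product of two quarter turns. *)
Lemma plane_rotation F c s : c ^+ 2 + s ^+ 2 = 1 -> measurable_fun setT F ->
  (forall p, 0 <= F p)%E ->
  (\int[mu \x mu]_p F (c * p.1 - s * p.2, s * p.1 + c * p.2)%R = \int[mu \x mu]_p F p)%E.
Proof.
have gen c' s' F' : c' != -1 -> c' ^+ 2 + s' ^+ 2 = 1 -> measurable_fun setT F' ->
    (forall p, 0 <= F' p)%E ->
    (\int[mu \x mu]_p F' (c' * p.1 - s' * p.2, s' * p.1 + c' * p.2)%R = \int[mu \x mu]_p F' p)%E.
  move=> c1 cs mF F0; have c2 : 1 + c' != 0 by rewrite addrC -[1]opprK subr_eq0.
  pose k := - (s' / (1 + c')).
  pose F1 p := F' (p.1 + k * p.2, p.2)%R.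
  have mF1 : measurable_fun setT F1.
    by apply: m_fst => //; meas.
  pose F2 p := F1 (p.1, p.2 + s' * p.1)%R.
  have mF2 : measurable_fun setT F2.
    by apply: m_fst => //; meas.
  have e1 := plane_shear1 k mF F0.
  have e2 := plane_shear2 s' mF1 (fun p => F0 _).
  have e3 := plane_shear1 k mF2 (fun p => F0 _).
  apply: (etrans _ (etrans e3 (etrans e2 e1))).
  apply: eq_integral => -[x y] _; rewrite /F2 /F1 /=; congr F'.
  have s2 : s' ^+ 2 = 1 - c' ^+ 2 by rewrite -cs; ring.
  have ks : k * s' = c' - 1.
    by rewrite /k mulNr mulrAC -expr2 s2; field.
  have kc : k * (1 + c') = - s' by rewrite /k mulNr divfK.
  have ey : y + s' * (x + k * y) = s' * x + c' * y.
    by rewrite mulrDr [s' * (k * y)]mulrA [s' * k]mulrC ks; ring.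
  congr (_, _); last exact: esym.
  rewrite ey; have -> : x + k * y + k * (s' * x + c' * y) = (1 + k * s') * x + (k * (1 + c')) * y by ring.
  by rewrite ks kc; ring.
move=> cs mF F0; have [c1|c1] := eqVneq c (-1); last exact: gen.
have s0 : s = 0.
  by apply/eqP; rewrite -sqrf_eq0; apply/eqP; move: cs; rewrite c1 sqrrN expr1n; lra.
have cs1 : 0 ^+ 2 + 1 ^+ 2 = 1 :> R by rewrite expr0n expr1n add0r.
have n1 : 0 != -1 :> R by rewrite eq_sym oppr_eq0 oner_eq0.
rewrite -(gen 0 1 F n1 cs1 mF F0).
pose F1 p := F (0 * p.1 - 1 * p.2, 1 * p.1 + 0 * p.2)%R.
have mF1 : measurable_fun setT F1.
  by apply: m_fst => //; meas.
rewrite -(gen 0 1 F1 n1 cs1 mF1 (fun p => F0 _)).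
apply: eq_integral => -[x y] _; rewrite /F1 /=; congr F; rewrite c1 s0.
by congr (_, _); ring.
Qed.

End Invariance.

(** * Moments of the disc *)

Section Moments.
Variable R : realType.
Notation mu := (@lebesgue_measure R).

Definition rho (p : R * R) : R := p.1 ^+ 2 + p.2 ^+ 2.
Definition dsk (t : R) : set (R * R) := [set p | rho p < t ^+ 2].

Lemma measurable_rho : measurable_fun setT rho.
Proof.
by apply: measurable_funD; apply: measurable_funX; [exact: measurable_fst|exact: measurable_snd].
Qed.

Lemma measurable_dsk t : measurable (dsk t).
Proof.
have := @measurable_fun_ltr _ _ _ setT rho (cst (t ^+ 2)) measurable_rho (measurable_cst _).
have mt : measurable [set true] by [].
move=> /(_ measurableT [set true] mt); rewrite setTI.
by congr (measurable _); apply/seteqP; split => p.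
Qed.

Lemma rho_ge0 p : 0 <= rho p.
Proof. by rewrite addr_ge0 ?sqr_ge0. Qed.

Lemma discE : [set p : R * R | disc (p.1 +i* p.2)] = dsk 1.
Proof.
apply/seteqP; split => p /=; rewrite /disc /dsk /mkset => h.
  by rewrite -[rho p](nc_sqr (p.1 +i* p.2)) ltr_pXn2r // nnegrE ?nc_ge0.
by move: h; rewrite -[rho p](nc_sqr (p.1 +i* p.2)) ltr_pXn2r // nnegrE ?nc_ge0.
Qed.

Definition rhoX k (p : R * R) : \bar R := (rho p ^+ k)%:E.

Lemma measurable_rhoX k : measurable_fun setT (rhoX k).
Proof. by apply/measurable_EFinP; apply: measurable_funX; exact: measurable_rho. Qed.

Lemma rhoX_ge0 k p : (0 <= rhoX k p)%E.
Proof. by rewrite lee_fin exprn_ge0 // rho_ge0. Qed.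

Lemma measurable_rhoX_dsk k t : measurable_fun setT (rhoX k \_ (dsk t)).
Proof.
have [h _] := measurable_restrictT (rhoX k) (measurable_dsk t).
by apply: h; apply: measurable_funTS; exact: measurable_rhoX.
Qed.

Definition mom_on (A : set (R * R)) k : \bar R := (\int[mu \x mu]_(p in A) rhoX k p)%E.

Lemma mom_cst A c : measurable A ->
  (\int[mu \x mu]_(p in A) c%:E = c%:E * (mu \x mu) A)%E.
Proof. by move=> mA; rewrite integral_cst. Qed.

Lemma mom_scale t k : 0 < t -> mom_on (dsk t) k = ((t ^+ (2 * k.+1))%:E * mom_on (dsk 1) k)%E.
Proof.
move=> t0; rewrite /mom_on integral_mkcond (@plane_scaling R _ t t0); last 2 first.
- exact: measurable_rhoX_dsk.
- by move=> p; rewrite patchE; case: ifP => // _; exact: rhoX_ge0.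
transitivity ((t ^+ 2)%:E * \int[mu \x mu]_p ((t ^+ (2 * k))%:E * (rhoX k \_ (dsk 1)) p))%E.
  congr (_ * _)%E; apply: eq_integral => p _; rewrite !patchE.
  have rt : rho (t * p.1, t * p.2) = t ^+ 2 * rho p by rewrite /rho /=; ring.
  have -> : ((t * p.1, t * p.2) \in dsk t) = (p \in dsk 1).
    apply/idP/idP; rewrite !inE /dsk /mkset rt expr1n => h.
      by rewrite -(ltr_pM2l (exprn_gt0 2 t0)) mulr1.
    by rewrite -[ltRHS]mulr1 (ltr_pM2l (exprn_gt0 2 t0)).
  case: ifP => _; last by rewrite mule0.
  by rewrite /rhoX rt -EFinM exprMn -exprM.
rewrite ge0_integralZl_EFin //; last 3 first.
- by move=> p _; rewrite patchE; case: ifP => // _; exact: rhoX_ge0.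
- exact: measurable_rhoX_dsk.
- by rewrite exprn_ge0 // ltW.
by rewrite -integral_mkcond muleA -EFinM -exprD -mulnS.
Qed.

Lemma mom_annulus t k : 0 < t -> t < 1 ->
  mom_on (dsk 1) k = (mom_on (dsk t) k + mom_on (dsk 1 `\` dsk t) k)%E.
Proof.
move=> t0 t1; rewrite /mom_on -ge0_integral_setU //.
- congr (integral _ _ _); rewrite setDUK // => p; rewrite /dsk /mkset => h.
  by apply: (lt_trans h); rewrite ltr_pXn2r // ?nnegrE ?ltW.
- exact: measurable_dsk.
- by apply: measurableD; exact: measurable_dsk.
- by apply: measurable_funTS; exact: measurable_rhoX.
- by move=> p _; exact: rhoX_ge0.
- by apply/disj_setPS => p [] h [].
Qed.

(** The area of the unit disc. *)
Definition kappa : R := fine (mom_on (dsk 1) 0).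

Lemma mom0E A : measurable A -> mom_on A 0 = ((mu \x mu) A)%E.
Proof.
by move=> mA; rewrite -[RHS]mul1e -mom_cst.
Qed.

Lemma square_measure (a b : R) : a <= b -> ((mu \x mu)%E (`[a, b] `*` `[a, b])) = ((b - a) ^+ 2)%:E.
Proof.
move=> ab; rewrite product_measure1E //= !lebesgue_measure_itv /= !lte_fin.
have [ab'|ba] := ltP a b; first by rewrite -EFinD -EFinM expr2.
have -> : a = b by apply/eqP; rewrite eq_le ab ba.
by rewrite subrr expr0n mule0.
Qed.

Lemma kappa_fin : mom_on (dsk 1) 0 = kappa%:E.
Proof.
rewrite /kappa fineK // ge0_fin_numE; last by apply: integral_ge0 => p _; exact: rhoX_ge0.
rewrite mom0E; last exact: measurable_dsk.
apply: (@le_lt_trans _ _ ((mu \x mu)%E (`[-1, 1] `*` `[-1, 1]))); last first.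
  by rewrite square_measure ?ltry //; lra.
apply: le_measure; rewrite ?inE; [exact: measurable_dsk|exact: measurableX|].
move=> p; rewrite /dsk /mkset /rho expr1n => h; split; rewrite /= in_itv /=; apply/andP; split; nra.
Qed.

Lemma kappa_gt0 : 0 < kappa.
Proof.
rewrite -lte_fin -kappa_fin mom0E; last exact: measurable_dsk.
apply: (@lt_le_trans _ _ ((mu \x mu)%E (`[0, 2^-1] `*` `[0, 2^-1]))).
  by rewrite square_measure // subr0 lte_fin exprn_gt0.
apply: le_measure; rewrite ?inE; [exact: measurableX|exact: measurable_dsk|].
move=> [x y] [] /=; rewrite !in_itv /= => /andP[x0 x1] /andP[y0 y1].
by rewrite /dsk /mkset /rho /= expr1n; nra.
Qed.

Lemma mom_fin k : exists m, mom_on (dsk 1) k = m%:E /\ 0 <= m.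
Proof.
have h0 : (0 <= mom_on (dsk 1) k)%E by apply: integral_ge0 => p _; exact: rhoX_ge0.
have h1 : (mom_on (dsk 1) k <= kappa%:E)%E.
  rewrite -kappa_fin; apply: ge0_le_integral.
  - exact: measurable_dsk.
  - by move=> p _; exact: rhoX_ge0.
  - by apply: measurable_funTS; exact: measurable_rhoX.
  - by apply: measurable_funTS; exact: measurable_rhoX.
  - move=> p; rewrite /dsk /mkset expr1n => h; rewrite lee_fin expr0.
    by rewrite exprn_ile1 ?rho_ge0 // ltW.
case: (mom_on _ k) h0 h1 => [m h0 _| |] //; first by exists m.
Qed.

(** Comparing the disc with its dilates determines all moments of [rho]: the
    annulus between radius [t] and [1] carries a fraction [1 - t^(2k+2)] of the
    [k]-th moment, while [rho^k] is between [t^(2k)] and [1] on it; now let [t]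
    tend to one. *)
Lemma momE k : mom_on (dsk 1) k = (kappa / k.+1%:R)%:E.
Proof.
have [m [mE m0]] := mom_fin k; rewrite mE; congr (_%:E).
pose S (t : R) := \sum_(j < k.+1) (t ^+ 2) ^+ j.
have key t : 0 < t -> t < 1 -> (t ^+ 2) ^+ k * kappa <= m * S t /\ m * S t <= kappa.
  move=> t0 t1.
  have t2 : 0 < 1 - t ^+ 2 by rewrite subr_gt0 exprn_ilt1 // ltW.
  have [A AE] : exists A, mom_on (dsk 1 `\` dsk t) k = A%:E.
    have := mom_annulus k t0 t1; rewrite mE mom_scale // mE -EFinM.
    case: (mom_on (dsk 1 `\` dsk t) k) => [A| |] //=; by exists A.
  have [A0 A0E] : exists A, mom_on (dsk 1 `\` dsk t) 0 = A%:E.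
    have := mom_annulus 0 t0 t1; rewrite kappa_fin mom_scale // kappa_fin -EFinM.
    case: (mom_on (dsk 1 `\` dsk t) 0) => [A'| |] //=; by exists A'.
  have mA : measurable (dsk 1 `\` dsk t) by apply: measurableD; exact: measurable_dsk.
  have eA : A = m * (1 - (t ^+ 2) ^+ k.+1).
    have := mom_annulus k t0 t1; rewrite mE mom_scale // mE AE -EFinM -EFinD => -[h].
    by rewrite mulrBr mulr1 {1}h -exprM; ring.
  have eA0 : A0 = kappa * (1 - t ^+ 2).
    have := mom_annulus 0 t0 t1; rewrite kappa_fin mom_scale // kappa_fin A0E -EFinM -EFinD => -[h].
    by rewrite mulrBr mulr1 {1}h muln1; ring.
  have geo : 1 - (t ^+ 2) ^+ k.+1 = (1 - t ^+ 2) * S t.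
    by have := subrX1 (t ^+ 2) k.+1; rewrite -/(S t) => h; rewrite -opprB h; ring.
  have up : A <= A0.
    rewrite -lee_fin -AE -A0E; apply: ge0_le_integral => //.
    - by move=> p _; exact: rhoX_ge0.
    - by apply: measurable_funTS; exact: measurable_rhoX.
    - by apply: measurable_funTS; exact: measurable_rhoX.
    - move=> p []; rewrite /dsk /mkset expr1n => h _; rewrite lee_fin expr0.
      by rewrite exprn_ile1 ?rho_ge0 // ltW.
  have lo : (t ^+ 2) ^+ k * A0 <= A.
    rewrite -lee_fin -AE EFinM -A0E /mom_on -ge0_integralZl_EFin //.
    - apply: ge0_le_integral => //.
      + by move=> p _; rewrite mule_ge0 ?rhoX_ge0 // lee_fin exprn_ge0 ?sqr_ge0.
      + by apply: measurable_funTS; apply: emeasurable_funM => //; exact: measurable_rhoX.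
      + by apply: measurable_funTS; exact: measurable_rhoX.
      + move=> p hpp; have hp := hpp.2; have h : t ^+ 2 <= rho p by rewrite leNgt; apply/negP.
        by rewrite /rhoX expr0 -EFinM mulr1 lee_fin lerXn2r // nnegrE ?sqr_ge0 ?rho_ge0.
    - by apply: measurable_funTS; exact: measurable_rhoX.
    - by rewrite exprn_ge0 ?sqr_ge0.
  rewrite eA geo eA0 in up lo; split.
    by rewrite -(ler_pM2l t2); move: lo; congr (_ <= _); ring.
  by rewrite -(ler_pM2l t2); move: up; congr (_ <= _); ring.
have k1 : 0 < k.+1%:R :> R by rewrite ltr0n.
apply/eqP; rewrite eq_sym eq_le; apply/andP; split.
  rewrite ler_pdivrMr //; apply/ler_addgt0Pr => e e0.
  have K0 : 0 < kappa * (2 * k)%:R + 1 by rewrite ltr_wpDl // mulr_ge0 // ltW // kappa_gt0.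
  pose s := Num.min (2^-1) (e / (kappa * (2 * k)%:R + 1)).
  have s0 : 0 < s by rewrite lt_min invr_gt0 ltr0n divr_gt0.
  have s1 : s < 1 by rewrite gt_min invf_lt1 // ltr1n.
  have se : s * (kappa * (2 * k)%:R) <= e.
    apply: (@le_trans _ _ (s * (kappa * (2 * k)%:R + 1))).
      by rewrite ler_wpM2l ?lerDl // ltW.
    by rewrite -ler_pdivlMr // ge_min lexx orbT.
  have [h1 _] := key (1 - s) ltac:(by rewrite subr_gt0) ltac:(by rewrite gtrBl).
  have S1 : S (1 - s) <= k.+1%:R.
    rewrite /S; apply: (@le_trans _ _ (\sum_(j < k.+1) 1)); last by rewrite sumr_const card_ord.
    apply: ler_sum => j _; rewrite -exprM exprn_ile1 ?subr_ge0 ?gerBl // ltW //.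
  have h2 := pow_ge_lin (2 * k) (ltac:(by rewrite subr_ge0 ltW) : 0 <= 1 - s)
    (ltac:(by rewrite gerBl ltW) : 1 - s <= 1).
  have h3 := ler_wpM2l m0 S1.
  have h4 : (1 - (2 * k)%:R * s) * kappa <= (1 - s) ^+ (2 * k) * kappa.
    rewrite ler_wpM2r ?(ltW kappa_gt0) //; apply: (le_trans _ h2).
    by have -> : 1 - (1 - s) = s by ring.
  rewrite exprM in h4; have h5 := le_trans (le_trans h4 h1) h3.
  have -> : kappa = (1 - (2 * k)%:R * s) * kappa + s * (kappa * (2 * k)%:R) by ring.
  exact: lerD.
rewrite ler_pdivlMr //; apply/ler_addgt0Pr => e e0.
pose D : R := \sum_(j < k.+1) (2 * j)%:R.
have D0 : 0 <= D by apply: sumr_ge0 => j _.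
have K0 : 0 < m * D + 1 by rewrite ltr_wpDl // mulr_ge0.
pose s := Num.min (2^-1) (e / (m * D + 1)).
have s0 : 0 < s by rewrite lt_min invr_gt0 ltr0n divr_gt0.
have s1 : s < 1 by rewrite gt_min invf_lt1 // ltr1n.
have se : s * (m * D) <= e.
  apply: (@le_trans _ _ (s * (m * D + 1))).
    by rewrite ler_wpM2l ?lerDl // ltW.
  by rewrite -ler_pdivlMr // ge_min lexx orbT.
have [_ h1] := key (1 - s) ltac:(by rewrite subr_gt0) ltac:(by rewrite gtrBl).
apply: (le_trans _ (lerD h1 se)).
have -> : m * S (1 - s) + s * (m * D) = m * (S (1 - s) + s * D) by ring.
rewrite ler_wpM2l // /S /D mulr_sumr -big_split /=.
apply: (@le_trans _ _ (\sum_(j < k.+1) (1 : R))); first by rewrite sumr_const card_ord.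
apply: ler_sum => j _; rewrite -exprM.
have h2 := pow_ge_lin (2 * j) (ltac:(by rewrite subr_ge0 ltW) : 0 <= 1 - s)
    (ltac:(by rewrite gerBl ltW) : 1 - s <= 1).
rewrite -lerBlDr; apply: (le_trans _ h2).
have e1 : 1 - (1 - s) = s by ring.
by rewrite e1 [s * _]mulrC.
Qed.

End Moments.

(** * Area integrals of power series *)

Section Area.
Variable R : realType.
Notation mu := (@lebesgue_measure R).
Implicit Types (f : R[i] -> R[i]) (a b : nat -> R[i]).

Definition cpx (p : R * R) : R[i] := p.1 +i* p.2.

Definition cmeas (g : R * R -> R[i]) : Prop :=
  measurable_fun setT (fun p => complex.Re (g p)) /\
  measurable_fun setT (fun p => complex.Im (g p)).

Lemma cmeasD (g h : R * R -> R[i]) : cmeas g -> cmeas h -> cmeas (fun p => g p + h p).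
Proof.
move=> [g1 g2] [h1 h2]; split.
  by under eq_fun do rewrite ReD; exact: measurable_funD.
by under eq_fun do rewrite ImD; exact: measurable_funD.
Qed.

Lemma cmeasM (g h : R * R -> R[i]) : cmeas g -> cmeas h -> cmeas (fun p => g p * h p).
Proof.
move=> [g1 g2] [h1 h2]; split.
  by under eq_fun do rewrite ReM; apply: measurable_funB; exact: measurable_funM.
by under eq_fun do rewrite ImM; apply: measurable_funD; exact: measurable_funM.
Qed.

Lemma cmeas_cst c : cmeas (fun=> c).
Proof. by split; exact: measurable_cst. Qed.

Lemma cmeas_psum a n : cmeas (fun p => psum a (cpx p) n).
Proof.
have cX k : cmeas (fun p => cpx p ^+ k).
  elim: k => [|k IH]; first by under eq_fun do rewrite expr0; exact: cmeas_cst.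
  under eq_fun do rewrite exprS; apply: cmeasM => //.
  by split; [exact: measurable_fst|exact: measurable_snd].
elim: n => [|n IH].
  by rewrite /psum; under eq_fun do rewrite big_ord0; exact: cmeas_cst.
rewrite /psum; under eq_fun do rewrite big_ord_recr /=.
by apply: cmeasD => //; apply: cmeasM => //; exact: cmeas_cst.
Qed.

Definition sqmod f (p : R * R) : \bar R := (normc (f (cpx p)) ^+ 2)%:E.

Lemma disc_cpx p : dsk 1 p -> disc (cpx p).
Proof. by rewrite -discE. Qed.

Lemma measurable_sqmod f a : rep f a -> measurable_fun setT (sqmod f \_ (dsk 1)).
Proof.
move=> fa; have [h _] := measurable_restrictT (sqmod f) (measurable_dsk (1 : R)).
apply: h; apply/measurable_EFinP.
apply: (@measurable_fun_cvg _ _ _ _ (fun n p => normc (psum a (cpx p) n) ^+ 2)).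
  move=> n; under eq_fun do rewrite nc_sqr.
  have [m1 m2] := cmeas_psum a n; apply: measurable_funTS.
  by apply: measurable_funD; apply: measurable_funX.
move=> p /disc_cpx dp; have := fa _ dp => hc.
rewrite (_ : (fun n => _) = (fun n => complex.Re (psum a (cpx p) n) * complex.Re (psum a (cpx p) n)
  + complex.Im (psum a (cpx p) n) * complex.Im (psum a (cpx p) n))); last first.
  by apply/funext => n; rewrite nc_sqr !expr2.
rewrite nc_sqr !expr2.
by apply: cvgD; apply: cvgM; (exact: cto_Re hc || exact: cto_Im hc).
Qed.

Lemma sqmod_ge0 f p : (0 <= sqmod f p)%E.
Proof. by rewrite lee_fin sqr_ge0. Qed.

Lemma restr_ge0 (u : R * R -> \bar R) A p : (forall p, 0 <= u p)%E -> (0 <= (u \_ A) p)%E.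
Proof. by move=> u0; rewrite patchE; case: ifP. Qed.

Definition rot (t : R) (p : R * R) : R * R :=
  (cos t * p.1 - sin t * p.2, sin t * p.1 + cos t * p.2).

Lemma cpx_rot t p : cpx (rot t p) = cis t * cpx p.
Proof. by apply: c_ext; rewrite ?ReM ?ImM /=; ring. Qed.

Lemma rho_rot t p : rho (rot t p) = rho p.
Proof.
rewrite /rho /rot /=.
have := cos2Dsin2 t => h.
transitivity ((cos t ^+ 2 + sin t ^+ 2) * (p.1 ^+ 2 + p.2 ^+ 2)); first by ring.
by rewrite h mul1r.
Qed.

Lemma rhoE p : rho p = normc (cpx p) ^+ 2.
Proof. by rewrite nc_sqr. Qed.

Lemma eseries_cvg (c : nat -> R) (l : R) :
  \sum_(k < n) c k @[n --> \oo] --> l -> (\sum_(0 <= k <oo) (c k)%:E = l%:E)%E.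
Proof.
move=> h; apply/cvg_lim => //.
rewrite (_ : (fun n => _) = (fun n => (\sum_(k < n) c k)%:E)).
  by apply: cvg_EFin => //; apply: nearW.
by apply/funext => n; rewrite sumEFin big_mkord.
Qed.

(** Averaging over rotations, by Parseval on the circle through [p]. *)
Lemma rotation_mean f a p : rep f a -> dsk 1 p ->
  (\int[mu]_(t in `[0%R, (2 * pi)%R]) sqmod f (rot t p) =
   (2 * pi)%:E * \sum_(0 <= k <oo) (normc (a k) ^+ 2 * rho p ^+ k)%:E)%E.
Proof.
move=> fa dp; have dz := disc_cpx dp; set z := cpx p in dz *.
pose r := (1 + normc z) / 2.
have z1 : normc z < 1 := dz; have z0 := nc_ge0 z.
have [r0 r1 zr] : [/\ 0 < r, r < 1 & normc z < r] by rewrite /r; split; lra.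
have cr0 : r%:C != 0 :> R[i] by rewrite -nc_gt0 nc_real normr_gt0 gt_eqF.
pose g (x : R[i]) := f (x * (z / r%:C)); pose b k := a k * (z / r%:C) ^+ k.
have gb : rep g b.
  move=> x dx; have dxz : disc (x * (z / r%:C)).
    rewrite /disc /mkset !ncM ncV nc_real gtr0_norm //.
    have zr1 : normc z / r < 1 by rewrite ltr_pdivrMr // mul1r.
    rewrite -[ltRHS]mulr1; apply: ltr_pM; rewrite ?nc_ge0 //.
    by rewrite mulr_ge0 ?nc_ge0 // invr_ge0 ltW.
  apply: cto_eq (fa _ dxz) => n; apply: eq_bigr => k _.
  by rewrite /b [(x * _) ^+ k]exprMn -mulrA [_ * x ^+ k]mulrC.
have gE t : g (circle_point r t) = f (cpx (rot t p)).
  rewrite /g circle_cis cpx_rot -/z; congr f; field; exact: cr0.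
have pi0 : 0 < 2 * pi :> R by rewrite mulr_gt0 // pi_gt0.
have := circle_mean_sqE gb (ltW r0) r1; rewrite /circle_mean_sq.
set I := (\int[mu]_(t in _) _)%E => hI.
have -> : (\int[mu]_(t in `[0%R, (2 * pi)%R]) sqmod f (rot t p) = I)%E.
  by apply: eq_integral => t _; rewrite /sqmod -gE.
have -> : (I = (2 * pi)%:E * (((2 * pi)^-1)%:E * I))%E.
  by rewrite muleA -EFinM mulfV ?gt_eqF // mul1e.
rewrite hI; congr (_ * _)%E; apply/esym/eseries_cvg.
have := circle_mean_sq_cvg gb (ltW r0) r1.
rewrite (_ : (fun n => _) = (fun n => \sum_(k < n) normc (a k) ^+ 2 * rho p ^+ k)) //.
apply/funext => n; apply: eq_bigr => k _; rewrite rhoE -/z /b ncM ncX ncM ncV nc_real gtr0_norm //.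
rewrite exprMn -mulrA; congr (_ * _).
by rewrite -!exprM [(k * 2)%N]mulnC -exprMn divfK // gt_eqF.
Qed.

Lemma measurable_crho (c : R) k :
  measurable_fun setT (fun p : R * R => (c * rho p ^+ k)%:E).
Proof.
under eq_fun do rewrite EFinM.
by apply: emeasurable_funM; [exact: measurable_cst|exact: measurable_rhoX].
Qed.

Definition rsum a (p : R * R) : \bar R :=
  (\sum_(0 <= k <oo) (normc (a k) ^+ 2 * rho p ^+ k)%:E)%E.

Lemma crho_ge0 a k p : (0 <= (normc (a k) ^+ 2 * rho p ^+ k)%:E)%E.
Proof. by rewrite lee_fin mulr_ge0 ?sqr_ge0 // exprn_ge0 // rho_ge0. Qed.

Lemma rsum_ge0 a p : (0 <= rsum a p)%E.
Proof. by apply: nneseries_ge0 => k _ _; exact: crho_ge0. Qed.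

Lemma measurable_rsum a : measurable_fun setT (rsum a).
Proof.
rewrite /rsum; apply: (@ge0_emeasurable_sum _ _ _ _
  (fun k p => (normc (a k) ^+ 2 * rho p ^+ k)%:E) xpredT).
  by move=> k p _ _; exact: crho_ge0.
by move=> k _; exact: measurable_crho.
Qed.

Lemma measurable_rsum_disc (c : R) a :
  measurable_fun setT ((fun p => c%:E * rsum a p)%E \_ (dsk 1)).
Proof.
have [h _] := measurable_restrictT (fun p => c%:E * rsum a p)%E (measurable_dsk (1 : R)).
apply: h; apply: measurable_funTS; apply: emeasurable_funM; first exact: measurable_cst.
exact: measurable_rsum.
Qed.

Lemma rsum_disc_ge0 (c : R) a p : 0 <= c ->
  (0 <= ((fun p => c%:E * rsum a p)%E \_ (dsk 1)) p)%E.
Proof.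
by move=> c0; apply: restr_ge0 => q; apply: mule_ge0; [rewrite lee_fin|exact: rsum_ge0].
Qed.

Lemma mulE_cancel (c : R) (x y : \bar R) : c != 0 ->
  (c%:E * x = c%:E * y -> x = y)%E.
Proof.
move=> c0 h; have : (c^-1%:E * (c%:E * x) = c^-1%:E * (c%:E * y))%E by rewrite h.
by rewrite !muleA -!EFinM mulVf // !mul1e.
Qed.

(** The disc is invariant under rotations, so [|f|^2] may be replaced by its
    mean over all rotations; Tonelli's theorem exchanges the mean with the area
    integral. *)
Lemma area_rotation f a : rep f a ->
  (\int[mu \x mu]_(p in dsk 1) sqmod f p = \int[mu \x mu]_(p in dsk 1) rsum a p)%E.
Proof.
move=> fa; pose F := sqmod f \_ (dsk 1).
have mF : measurable_fun setT F := measurable_sqmod fa.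
have F0 p : (0 <= F p)%E by apply: restr_ge0; exact: sqmod_ge0.
have FE p : dsk 1 p -> F p = sqmod f p by move=> h; rewrite /F patchE mem_set.
have F_out p : ~ dsk 1 p -> F p = 0%E by move=> h; rewrite /F patchE memNset.
pose D : set R := `[0%R, (2 * pi)%R]%classic.
pose G (q : (R * R) * R) : \bar R := ((\1_D q.1.1)%:E * F (rot q.1.1 (q.1.2, q.2)))%E.
have G0 q : (0 <= G q)%E by rewrite mule_ge0 // lee_fin indicE; case: (_ \in _).
have mD : measurable D by exact: measurable_itv.
have m1D : measurable_fun setT (\1_D : R -> R) by exact: measurable_indic.
have m11 : measurable_fun setT (fun q : (R * R) * R => q.1.1).
  by apply: measurableT_comp; [exact: measurable_fst|exact: measurable_fst].
have m12 : measurable_fun setT (fun q : (R * R) * R => q.1.2).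
  by apply: measurableT_comp; [exact: measurable_snd|exact: measurable_fst].
have mcos : measurable_fun setT (fun q : (R * R) * R => cos q.1.1).
  by apply: (measurableT_comp (f := @cos R)) => //; apply: continuous_measurable_fun; exact: continuous_cos.
have msin : measurable_fun setT (fun q : (R * R) * R => sin q.1.1).
  by apply: (measurableT_comp (f := @sin R)) => //; apply: continuous_measurable_fun; exact: continuous_sin.
have mG : measurable_fun setT G.
  apply: emeasurable_funM.
    by apply/measurable_EFinP; exact: (measurableT_comp m1D m11).
  apply: m_fst => //; [apply: measurable_funB|apply: measurable_funD];
    by apply: measurable_funM => //; exact: measurable_snd.
have pi0 : 0 < 2 * pi :> R by rewrite mulr_gt0 // pi_gt0.
set I := (\int[mu \x mu]_(p in dsk 1) sqmod f p)%E.
have hD : (mu D = (2 * pi)%:E)%E.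
  by rewrite /D lebesgue_measure_itv /= lte_fin pi0 -EFinD subr0.
have IE t : (\int[mu]_x \int[mu]_y F (rot t (x, y)) = I)%E.
  have cs : cos t ^+ 2 + sin t ^+ 2 = 1 := cos2Dsin2 t.
  rewrite /I [RHS]integral_mkcond -[RHS](plane_rotation cs mF F0) fubini_tonelli1 //.
  by apply: m_fst => //; meas.
have step1 : ((2 * pi)%:E * I = \int[mu]_t \int[mu]_x \int[mu]_y G ((t, x), y))%E.
  transitivity (\int[mu]_t ((\1_D t)%:E * I))%E.
    rewrite ge0_integralZr //; last 2 first.
    - by apply/measurable_EFinP; exact: measurable_indic.
    - by apply: integral_ge0 => p _; exact: sqmod_ge0.
    by rewrite integral_indic // setIT; congr (_ * _)%E; exact: (esym hD).
  apply: eq_integral => t _; rewrite -(IE t).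
  pose Ft p := F (rot t p).
  have mFt : measurable_fun setT Ft by apply: m_fst => //; meas.
  have Ft0 p : (0 <= Ft p)%E by exact: F0.
  rewrite -ge0_integralZl_EFin //; last 2 first.
  - by move=> x _; exact: (@integral_ge0 _ _ R mu setT (fun y => F (rot t (x, y))) (fun y _ => F0 _)).
  - have hm := @measurable_fun_fubini_tonelli_F _ _ _ _ R mu Ft mFt Ft0; exact: hm.
  apply: eq_integral => x _; rewrite -ge0_integralZl_EFin //.
  by apply: (measurableT_comp mFt); exact: measurable_fun_pair.
have mGy : measurable_fun setT (fun q : R * R => \int[mu]_y G (q, y))%E.
  have hm := @measurable_fun_fubini_tonelli_F _ _ _ _ R mu G mG G0; exact: hm.
have step2 : (\int[mu]_t \int[mu]_x \int[mu]_y G ((t, x), y) =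
    \int[mu]_x \int[mu]_t \int[mu]_y G ((t, x), y))%E.
  have Gy0 (q : R * R) : (0 <= \int[mu]_y G (q, y))%E.
    exact: (@integral_ge0 _ _ R mu setT (fun y => G (q, y)) (fun y _ => G0 _)).
  have h := @fubini_tonelli _ _ _ _ R mu mu (fun q : R * R => \int[mu]_y G (q, y))%E mGy Gy0.
  exact: h.
pose Phi := (fun p => (2 * pi)%:E * rsum a p)%E \_ (dsk 1).
have step3 x : (\int[mu]_t \int[mu]_y G ((t, x), y) = \int[mu]_y Phi (x, y))%E.
  have mGx : measurable_fun setT (fun q : R * R => G ((q.1, x), q.2)).
    apply: (measurableT_comp mG); apply: measurable_fun_pair; last exact: measurable_snd.
    by apply: measurable_fun_pair => //; exact: measurable_fst.
  have h := @fubini_tonelli _ _ _ _ R mu mu (fun q : R * R => G ((q.1, x), q.2)) mGx (fun q => G0 _).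
  apply: (etrans h); apply: eq_integral => y _; rewrite /= /Phi patchE.
  case: ifPn => [|ndp].
    rewrite inE => dp; rewrite /rsum -(rotation_mean fa dp) [RHS]integral_mkcond.
    apply: eq_integral => t _.
    rewrite /G patchE indicE /=; case: ifP => _; last by rewrite mul0e.
    rewrite mul1e FE; first exact: erefl.
    by rewrite /dsk /mkset rho_rot.
  apply: (etrans _ (integral0 mu setT)); apply: eq_integral => t _.
  have ho : ~ dsk 1 (rot t (x, y)).
    by rewrite /dsk /mkset rho_rot => hd'; move/negP: ndp; apply; rewrite inE.
  by rewrite /G /= (F_out _ ho) mule0.
have mPhi : measurable_fun setT Phi by exact: measurable_rsum_disc.
have Phi0 p : (0 <= Phi p)%E by apply: rsum_disc_ge0; exact: ltW.
have step4 : ((2 * pi)%:E * I = (2 * pi)%:E * \int[mu \x mu]_(p in dsk 1) rsum a p)%E.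
  have hZ := @ge0_integralZl_EFin _ _ R (mu \x mu)%E (dsk 1) (measurable_dsk 1) (rsum a)
    (fun p _ => rsum_ge0 a p) (measurable_funTS (measurable_rsum a)) (2 * pi) (ltW pi0).
  rewrite -hZ [RHS]integral_mkcond.
  have hF := @fubini_tonelli1 _ _ _ _ R mu mu Phi mPhi Phi0.
  rewrite [RHS]hF step1 step2; apply: eq_integral => x _; exact: step3.
exact: (@mulE_cancel (2 * pi) _ _ (lt0r_neq0 pi0) step4).
Qed.

(** After averaging over rotations, the series is integrated termwise with the
    moments of the disc. *)
Lemma area_series f a : rep f a ->
  (area_integral (fun z => (normc (f z) ^+ 2)%:E) =
   (pi^-1 * kappa R)%:E * \sum_(0 <= k <oo) (normc (a k) ^+ 2 / k.+1%:R)%:E)%E.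
Proof.
move=> fa; rewrite /area_integral discE.
have -> : (\int[mu \x mu]_(p in dsk 1) (normc (f (p.1 +i* p.2)) ^+ 2)%:E =
   \int[mu \x mu]_(p in dsk 1) rsum a p)%E by exact: area_rotation.
rewrite /rsum integral_nneseries; last 3 first.
- exact: measurable_dsk.
- by move=> k; apply: measurable_funTS; exact: measurable_crho.
- by move=> k p _; rewrite lee_fin mulr_ge0 ?sqr_ge0 // exprn_ge0 // rho_ge0.
rewrite EFinM -muleA; congr (_ * _)%E.
rewrite -nneseriesZl; last by move=> k _; rewrite lee_fin divr_ge0 ?sqr_ge0.
apply: eq_eseriesr => k _.
transitivity ((normc (a k) ^+ 2)%:E * mom_on (dsk 1) k)%E.
  rewrite /mom_on -ge0_integralZl_EFin //.
  - exact: measurable_dsk.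
  - by move=> p _; exact: rhoX_ge0.
  - by apply: measurable_funTS; exact: measurable_rhoX.
  - exact: sqr_ge0.
by rewrite momE -!EFinM; congr (_%:E); ring.
Qed.

End Area.

(** * The three norms in terms of Taylor coefficients *)

Section Norms.
Variable R : realType.
Implicit Types (f : R[i] -> R[i]) (a : nat -> R[i]) (w : nat -> R) (X c : R).

(** All that the proof uses of the three norms: finiteness and size are
    governed by the energy of weight [w] of the Taylor coefficients. *)
Definition norm_like (nrm : (R[i] -> R[i]) -> \bar R) w : Prop :=
  exists c, 0 <= c /\ forall f a, rep f a ->
    (forall X, wle w a X -> (nrm f <= (Num.sqrt (c * X))%:E)%E) /\
    ((nrm f < +oo)%E -> exists X, wle w a X).

Definition dir_weight k : R := k.+1%:R.
Definition berg_weight k : R := k.+1%:R^-1.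

Lemma hardy_norm_like : norm_like (@hardy_norm R) (@one_weight R).
Proof.
exists 1; split=> // f a fa; split=> [X aX|]; last exact: hardy_norm_fin.
by rewrite mul1r; exact: hardy_norm_le fa aX.
Qed.

Lemma eseries_le (u : nat -> R) X : (forall k, 0 <= u k) ->
  (forall n, \sum_(k < n) u k <= X) -> (\sum_(0 <= k <oo) (u k)%:E <= X%:E)%E.
Proof.
move=> u0 uX; apply: lime_le.
  by apply: is_cvg_nneseries => k _ _; rewrite lee_fin.
by apply: nearW => n; rewrite sumEFin big_mkord lee_fin.
Qed.

Lemma eseries_bound (u : nat -> R) : (forall k, 0 <= u k) ->
  (\sum_(0 <= k <oo) (u k)%:E < +oo)%E -> exists X, forall n, \sum_(k < n) u k <= X.
Proof.
move=> u0; set S := (\sum_(0 <= k <oo) _)%E => Soo.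
have S0 : (0 <= S)%E by apply: nneseries_ge0 => k _ _; rewrite lee_fin.
have hS n : ((\sum_(k < n) u k)%:E <= S)%E.
  have := @nneseries_lim_ge R (fun k => (u k)%:E) xpredT 0 n; rewrite sumEFin big_mkord.
  by apply=> k _ _; rewrite lee_fin.
case: S S0 Soo hS => [x| |] // _ _ hS; exists x => n.
by rewrite -lee_fin.
Qed.

Lemma area_le f a X : rep f a -> wle berg_weight a X ->
  (area_integral (fun z => (normc (f z) ^+ 2)%:E) <= (pi^-1 * kappa R * X)%:E)%E.
Proof.
move=> fa aX; rewrite (area_series fa) [(_ * X)%:E]EFinM lee_wpmul2l ?lee_fin //.
  by rewrite mulr_ge0 ?invr_ge0 ?pi_ge0 // ltW // kappa_gt0.
apply: eseries_le => [k|n]; first by rewrite divr_ge0 ?sqr_ge0.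
by apply: (le_trans _ (aX n)); apply: ler_sum => k _; rewrite mulrC.
Qed.

Lemma area_fin f a : rep f a ->
  (area_integral (fun z => (normc (f z) ^+ 2)%:E) < +oo)%E -> exists X, wle berg_weight a X.
Proof.
move=> fa; rewrite (area_series fa) => h.
have c0 : 0 < pi^-1 * kappa R by rewrite mulr_gt0 ?invr_gt0 ?pi_gt0 ?kappa_gt0.
set S := (\sum_(0 <= k <oo) _)%E in h.
have Soo : (S < +oo)%E.
  by case: S h => [x _| |] //; rewrite ?ltry // gt0_muley ?lte_fin.
have [k|X hX] := @eseries_bound (fun k => normc (a k) ^+ 2 / k.+1%:R) _ Soo.
  by rewrite divr_ge0 ?sqr_ge0.
exists X => n; apply: (le_trans _ (hX n)); apply: ler_sum => k _; by rewrite mulrC.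
Qed.

Lemma bergman_norm_like : norm_like (@bergman_norm R) berg_weight.
Proof.
exists (pi^-1 * kappa R); split.
  by rewrite mulr_ge0 ?invr_ge0 ?pi_ge0 // ltW // kappa_gt0.
move=> f a fa; split=> [X aX|/sqrte_ltoo]; last exact: area_fin.
by apply: sqrte_le; exact: area_le fa aX.
Qed.

Lemma rep0 f a : rep f a -> f 0 = a 0%N.
Proof.
move=> fa; have d0 : disc (0 : R[i]) by rewrite /disc /mkset nc0.
apply: (cto_uniq (cto_shift 1 (fa _ d0))); apply: (cto_eq _ (cto_cst _)) => n.
rewrite addn1 /psum big_ord_recl expr0 mulr1 big1 ?addr0 // => k _.
by rewrite expr0n mulr0.
Qed.

Lemma dera_term a k : berg_weight k * normc (dera a k) ^+ 2 = k.+1%:R * normc (a k.+1) ^+ 2.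
Proof.
rewrite /berg_weight /dera ncM nc_nat exprMn mulrA; congr (_ * _).
by rewrite expr2 mulrA mulVf ?mul1r // pnatr_eq0.
Qed.

(** The coefficients of the derivative are [(k + 1) a_(k + 1)], so its Bergman
    energy is [\sum_k (k + 1) |a_(k + 1)|^2]. *)
Lemma dirichlet_norm_like : norm_like (@dirichlet_norm R) dir_weight.
Proof.
have c0 : 0 <= pi^-1 * kappa R.
  by rewrite mulr_ge0 ?invr_ge0 ?pi_ge0 // ltW // kappa_gt0.
exists (1 + pi^-1 * kappa R); split; first by rewrite addr_ge0.
move=> f a fa; have fa' := rep_derive1 fa; split=> [X aX|/sqrte_ltoo].
  have aX' : wle berg_weight (dera a) X.
    move=> n; apply: (le_trans _ (aX n.+1)); rewrite big_ord_recl -[leLHS]add0r.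
    apply: lerD; first by rewrite mulr_ge0 ?sqr_ge0 // ler0n.
    apply: ler_sum => k _; rewrite dera_term /dir_weight /bump /= ?add1n.
    by rewrite ler_wpM2r ?sqr_ge0 // ler_nat.
  apply: sqrte_le; rewrite mulrDl mul1r EFinD; apply: leeD.
    rewrite lee_fin (rep0 fa); have := aX 1%N; rewrite big_ord1 /dir_weight mul1r.
    by [].
  exact: area_le fa' aX'.
move=> h.
have [|X aX] := area_fin fa'.
  apply: le_lt_trans h; rewrite -[leLHS]add0e; apply: leeD => //.
  by rewrite lee_fin sqr_ge0.
exists (normc (a 0%N) ^+ 2 + 2 * X) => n.
have X0 := wle_ge0 aX.
case: n => [|n]; first by rewrite big_ord0 addr_ge0 ?sqr_ge0 // mulr_ge0.
rewrite big_ord_recl /= {1}/dir_weight mul1r lerD2l.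
apply: (le_trans _ (ler_wpM2l _ (aX n))) => //; rewrite mulr_sumr; apply: ler_sum => k _.
rewrite dera_term /dir_weight /bump /= ?add1n [2 * (_ * _)]mulrA ler_wpM2r ?sqr_ge0 //.
by rewrite -natrM ler_nat mul2n -addnn addSn addnS !ltnS leq_addr.
Qed.

End Norms.

(** * Geometrically dominated series *)

Section GeometricSeries.
Variable R : realType.
Implicit Types (u v : nat -> R).

(** Domination by a geometric sequence: a class on which summation is linear
    and monotone, so that energies can be manipulated as finite sums. *)
Definition gd u : Prop := exists C q, [/\ 0 <= C, 0 <= q, q < 1 &
  forall k, `|u k| <= C * q ^+ k].

Definition tot u : R := limn (fun n => \sum_(k < n) u k).

Lemma gd_cvg u : gd u -> \sum_(k < n) u k @[n --> \oo] --> tot u.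
Proof.
move=> [C [q [C0 q0 q1 h]]].
have hC k : normc (u k)%:C <= C * q ^+ k by rewrite nc_real.
have [l hl] := geom_cvg q0 q1 hC.
have hc : \sum_(k < n) u k @[n --> \oo] --> complex.Re l.
  have := cto_Re hl; rewrite (_ : (fun n => _) = (fun n => \sum_(k < n) u k)) //.
  by apply/funext => n; rewrite Re_sum.
by rewrite /tot (cvg_lim _ hc).
Qed.

Lemma tot_eq u l : \sum_(k < n) u k @[n --> \oo] --> l -> tot u = l.
Proof. by move=> h; apply: (cvg_lim _ h). Qed.

Lemma gdD u v : gd u -> gd v -> gd (fun k => u k + v k).
Proof.
move=> [C [q [C0 q0 q1 h]]] [D [p [D0 p0 p1 k]]].
exists (C + D), (Num.max q p); split.
- exact: addr_ge0.
- by rewrite le_max q0.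
- by rewrite gt_max q1.
move=> n; apply: (le_trans (ler_normD _ _)); rewrite mulrDl; apply: lerD.
  apply: (le_trans (h n)); rewrite ler_wpM2l // lerXn2r ?nnegrE ?le_max ?q0 ?lexx //.
apply: (le_trans (k n)); rewrite ler_wpM2l // lerXn2r ?nnegrE ?le_max ?p0 ?lexx ?orbT //.
Qed.

Lemma gdZ c u : gd u -> gd (fun k => c * u k).
Proof.
move=> [C [q [C0 q0 q1 h]]]; exists (`|c| * C), q; split=> //; first by rewrite mulr_ge0.
by move=> k; rewrite normrM -mulrA ler_wpM2l.
Qed.

Lemma gdB u v : gd u -> gd v -> gd (fun k => u k - v k).
Proof.
move=> hu hv; have := gdD hu (gdZ (-1) hv).
by under [X in gd X]eq_fun do rewrite mulN1r.
Qed.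

Lemma gdS u : gd u -> gd (fun k => u k.+1).
Proof.
move=> [C [q [C0 q0 q1 h]]]; exists (C * q), q; split=> //; first by rewrite mulr_ge0.
by move=> k; rewrite -mulrA -exprS.
Qed.

Lemma totD u v : gd u -> gd v -> tot (fun k => u k + v k) = tot u + tot v.
Proof.
move=> /gd_cvg hu /gd_cvg hv; apply: tot_eq.
rewrite (_ : (fun n => _) = (fun n => \sum_(k < n) u k + \sum_(k < n) v k)).
  exact: cvgD.
by apply/funext => n; rewrite big_split.
Qed.

Lemma totZ c u : gd u -> tot (fun k => c * u k) = c * tot u.
Proof.
move=> /gd_cvg hu; apply: tot_eq.
rewrite (_ : (fun n => _) = (fun n => c * \sum_(k < n) u k)); first exact: cvgMr.
by apply/funext => n; rewrite mulr_sumr.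
Qed.

Lemma totB u v : gd u -> gd v -> tot (fun k => u k - v k) = tot u - tot v.
Proof.
move=> hu hv; rewrite -[- tot v]mulN1r -totZ // -totD //; last exact: gdZ.
by congr tot; apply/funext => k; rewrite mulN1r.
Qed.

Lemma tot_ge0 u : gd u -> (forall k, 0 <= u k) -> 0 <= tot u.
Proof.
move=> /gd_cvg hu u0; rewrite -oppr_le0; apply: (cvg_le_cst (cvgN hu)) => n.
by rewrite oppr_le0; apply: sumr_ge0.
Qed.

Lemma tot_le u v : gd u -> gd v -> (forall k, u k <= v k) -> tot u <= tot v.
Proof.
move=> hu hv uv; rewrite -subr_ge0 -totB //; apply: tot_ge0; first exact: gdB.
by move=> k; rewrite subr_ge0.
Qed.

Lemma partial_le_tot u n : gd u -> (forall k, 0 <= u k) -> \sum_(k < n) u k <= tot u.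
Proof.
move=> /gd_cvg hu u0; apply: (cvg_ge_partial hu) => m p mp.
by rewrite -(subnKC mp) big_split_ord /= lerDl; apply: sumr_ge0.
Qed.

Lemma tot_bound u M : gd u -> (forall n, \sum_(k < n) u k <= M) -> tot u <= M.
Proof. by move=> /gd_cvg hu; exact: cvg_le_cst hu. Qed.

Lemma totS u : gd u -> tot u = u 0%N + tot (fun k => u k.+1).
Proof.
move=> hu; have h1 := gd_cvg hu; have h2 := gd_cvg (gdS hu).
apply: tot_eq; rewrite -cvg_shiftS.
rewrite (_ : [sequence _]_n = (fun n => u 0%N + \sum_(k < n) u k.+1)).
  by apply: cvgD => //; exact: cvg_cst.
by apply/funext => n /=; rewrite big_ord_recl.
Qed.

Lemma gd_le u v : (forall k, `|u k| <= v k) -> gd v -> gd u.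
Proof.
move=> uv [C [q [C0 q0 q1 h]]]; exists C, q; split=> // k.
by apply: (le_trans (uv k)); apply: (le_trans _ (h k)); exact: ler_norm.
Qed.

Lemma gd_finite u N : (forall k, (N <= k)%N -> u k = 0) -> gd u.
Proof.
move=> h; exists (2 ^+ N * \sum_(k < N) `|u k|), 2^-1; split=> //.
- by rewrite mulr_ge0 ?exprn_ge0 // sumr_ge0.
- by rewrite invf_lt1 // ltr1n.
move=> k; have [Nk|kN] := leqP N k.
  by rewrite h // normr0 mulr_ge0 ?exprn_ge0 // mulr_ge0 ?exprn_ge0 // sumr_ge0.
rewrite (bigD1 (Ordinal kN)) //= mulrAC exprVn.
have h1 : 1 <= 2 ^+ N / 2 ^+ k :> R.
  by rewrite ler_pdivlMr ?exprn_gt0 // mul1r ler_weXn2l ?ler1n // ltnW.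
apply: (@le_trans _ _ (1 * `|u k|)); first by rewrite mul1r.
apply: ler_pM => //; by rewrite lerDl sumr_ge0.
Qed.

Lemma tot_finite u N : (forall k, (N <= k)%N -> u k = 0) -> tot u = \sum_(k < N) u k.
Proof.
move=> h; apply/tot_eq/cvgnP => e e0; exists N => n Nn.
rewrite -(subnKC Nn) big_split_ord /= [X in _ + X - _]big1 ?addr0 ?subrr ?normr0 ?ltW //.
by move=> k _; rewrite h // leq_addr.
Qed.

End GeometricSeries.

(** * Coefficient sequences and their weighted pairings *)

Section Pairings.
Variable R : realType.
Variable rho : R.
Hypotheses (rho0 : 0 < rho) (rho1 : rho < 1).
Implicit Types (x y z : nat -> R[i]) (w : nat -> R).

(** The rate [rho] is fixed, larger than the moduli of all zeros of the
    Blaschke product: multiplication and division by its factors then preserve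
    the class. *)
Definition geo x : Prop := exists K, 0 <= K /\ forall n, normc (x n) <= K * rho ^+ n.

Lemma geoD x y : geo x -> geo y -> geo (fun n => x n + y n).
Proof.
move=> [K [K0 h]] [L [L0 k]]; exists (K + L); split; first exact: addr_ge0.
by move=> n; apply: (le_trans (ncD _ _)); rewrite mulrDl lerD.
Qed.

Lemma geoZ (c : R[i]) x : geo x -> geo (fun n => c * x n).
Proof.
move=> [K [K0 h]]; exists (normc c * K); split; first by rewrite mulr_ge0 ?nc_ge0.
by move=> n; rewrite ncM -mulrA ler_wpM2l ?nc_ge0.
Qed.

Lemma geo_eq x y : x =1 y -> geo x -> geo y.
Proof. by move=> /funext ->. Qed.

Lemma geoN x : geo x -> geo (fun n => - x n).
Proof. by move=> h; apply: geo_eq (geoZ (-1) h) => n; rewrite mulN1r. Qed.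

Lemma geoB x y : geo x -> geo y -> geo (fun n => x n - y n).
Proof. by move=> hx hy; apply: geoD => //; exact: geoN. Qed.

Lemma geo0 : geo (fun=> 0).
Proof. by exists 0; split=> // n; rewrite nc0 mul0r. Qed.

Lemma geo_finite x N : (forall k, (N <= k)%N -> x k = 0) -> geo x.
Proof.
move=> h; exists (rho ^- N * \sum_(k < N) normc (x k)).
have S0 : 0 <= \sum_(k < N) normc (x k) by apply: sumr_ge0 => k _; exact: nc_ge0.
have rN0 : 0 <= rho ^- N by rewrite invr_ge0 exprn_ge0 // ltW.
split=> [|k]; first by rewrite mulr_ge0.
have [Nk|kN] := leqP N k.
  by rewrite h // nc0 mulr_ge0 ?exprn_ge0 ?(ltW rho0) // mulr_ge0.
rewrite (bigD1 (Ordinal kN)) //= mulrAC.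
apply: (@le_trans _ _ (1 * normc (x k))); first by rewrite mul1r.
apply: ler_pM; rewrite ?nc_ge0 //; last by rewrite lerDl sumr_ge0 // => i _; exact: nc_ge0.
rewrite mulrC ler_pdivlMr ?exprn_gt0 // mul1r ler_wiXn2l ?(ltW rho0) ?(ltW rho1) //.
exact: ltnW.
Qed.

(** Weights of at most quadratic growth: all the pairings used below converge. *)
Definition wok w : Prop := forall k, 0 <= w k <= k.+1%:R ^+ 2.

Definition dotw w x y : nat -> R := fun k => w k * complex.Re (x k * conjc (y k)).
Definition ip w x y : R := tot (dotw w x y).
Definition en w x : R := ip w x x.

Lemma gd_quad : gd (fun k => k.+1%:R ^+ 2 * (rho ^+ k) ^+ 2).
Proof.
pose s := (1 + rho) / 2; have [s0 s1 rs] : [/\ 0 < s, s < 1 & rho < s].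
  by move: rho0 rho1; rewrite /s; split; lra.
have [q0 q1] : 0 <= rho / s /\ rho / s < 1.
  by split; [rewrite divr_ge0 // ltW|rewrite ltr_pdivrMr // mul1r].
pose C := (1 - rho / s)^-1 + 1.
have C0 : 0 <= C by rewrite addr_ge0 // invr_ge0 subr_ge0 ltW.
exists (C ^+ 2), (s ^+ 2); split.
- exact: sqr_ge0.
- exact: sqr_ge0.
- by rewrite exprn_ilt1 // ltW.
move=> k; rewrite ger0_norm; last by rewrite mulr_ge0 ?sqr_ge0.
rewrite [(s ^+ 2) ^+ k]exprAC -!exprMn.
rewrite lerXn2r ?nnegrE ?mulr_ge0 ?exprn_ge0 ?(ltW rho0) ?(ltW s0) //.
have -> : rho ^+ k = (rho / s) ^+ k * s ^+ k by rewrite -exprMn divfK // gt_eqF.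
rewrite mulrA ler_wpM2r ?exprn_ge0 ?(ltW s0) // -natr1 mulrDl mul1r /C lerD //.
  exact: nat_geom_bound.
by rewrite exprn_ile1 // ltW.
Qed.

Lemma gd_dot w x y : wok w -> geo x -> geo y -> gd (dotw w x y).
Proof.
move=> hw [K [K0 hx]] [L [L0 hy]]; apply: gd_le (gdZ (K * L) gd_quad) => k.
have /andP[w0 w1] := hw k.
rewrite /dotw normrM ger0_norm //.
have -> : K * L * (k.+1%:R ^+ 2 * rho ^+ k ^+ 2) =
   k.+1%:R ^+ 2 * ((K * rho ^+ k) * (L * rho ^+ k)) by ring.
apply: ler_pM => //; apply: (le_trans (nc_Re _)); rewrite ncM nc_conj.
by apply: ler_pM; rewrite ?nc_ge0.
Qed.

Lemma ipDl w x y z : wok w -> geo x -> geo y -> geo z ->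
  ip w (fun n => x n + y n) z = ip w x z + ip w y z.
Proof.
move=> hw hx hy hz; rewrite /ip -totD; [|exact: gd_dot|exact: gd_dot].
by congr tot; apply/funext => k; rewrite /dotw mulrDl ReD mulrDr.
Qed.

Lemma ipC w x y : ip w x y = ip w y x.
Proof.
congr tot; apply/funext => k; rewrite /dotw !ReM !ReJ !ImJ; ring.
Qed.

Lemma ipDr w x y z : wok w -> geo x -> geo y -> geo z ->
  ip w x (fun n => y n + z n) = ip w x y + ip w x z.
Proof. by move=> *; rewrite ipC ipDl // !(ipC _ x). Qed.

Lemma ipZl w (c : R) x y : wok w -> geo x -> geo y ->
  ip w (fun n => c%:C * x n) y = c * ip w x y.
Proof.
move=> hw hx hy; rewrite /ip -totZ; last exact: gd_dot.
congr tot; apply/funext => k; rewrite /dotw !ReM ?ImM /=; ring.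
Qed.

Lemma ipZr w (c : R) x y : wok w -> geo x -> geo y ->
  ip w x (fun n => c%:C * y n) = c * ip w x y.
Proof. by move=> *; rewrite ipC ipZl // ipC. Qed.

Lemma enE w x : en w x = tot (fun k => w k * normc (x k) ^+ 2).
Proof. by congr tot; apply/funext => k; rewrite /dotw nc_sqrE. Qed.

Lemma gd_en w x : wok w -> geo x -> gd (fun k => w k * normc (x k) ^+ 2).
Proof.
move=> hw hx; have := gd_dot hw hx hx.
by rewrite (_ : dotw w x x = (fun k => w k * normc (x k) ^+ 2)) //;
  apply/funext => k; rewrite /dotw nc_sqrE.
Qed.

Lemma en_ge0 w x : wok w -> geo x -> 0 <= en w x.
Proof.
move=> hw hx; rewrite enE; apply: tot_ge0; first exact: gd_en.
by move=> k; rewrite mulr_ge0 ?sqr_ge0 //; have /andP[] := hw k.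
Qed.

Lemma enD w x y : wok w -> geo x -> geo y ->
  en w (fun n => x n + y n) = en w x + 2 * ip w x y + en w y.
Proof.
move=> hw hx hy; rewrite /en ipDl ?ipDr //; last exact: geoD.
rewrite (ipC _ y x); ring.
Qed.

Lemma enZ w (c : R[i]) x : wok w -> geo x ->
  en w (fun n => c * x n) = normc c ^+ 2 * en w x.
Proof.
move=> hw hx; rewrite !enE -totZ; last exact: gd_en.
by congr tot; apply/funext => k; rewrite ncM exprMn; ring.
Qed.

Lemma en_partial w x n : wok w -> geo x -> \sum_(k < n) w k * normc (x k) ^+ 2 <= en w x.
Proof.
move=> hw hx; rewrite enE; apply: partial_le_tot; first exact: gd_en.
by move=> k; rewrite mulr_ge0 ?sqr_ge0 //; have /andP[] := hw k.
Qed.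

Lemma en_bound w x M : wok w -> geo x ->
  (forall n, \sum_(k < n) w k * normc (x k) ^+ 2 <= M) -> en w x <= M.
Proof. by move=> hw hx h; rewrite enE; apply: tot_bound => //; exact: gd_en. Qed.

(** Weighted Cauchy-Schwarz inequality, in the additive form with a free
    parameter; it serves for all the cross terms. *)
Lemma ip_amgm w w1 w2 (t : R) x y : wok w -> wok w1 -> wok w2 -> 0 < t ->
  (forall k, w k ^+ 2 = w1 k * w2 k) -> geo x -> geo y ->
  2 * ip w x y <= t * en w1 x + t^-1 * en w2 y.
Proof.
move=> hw hw1 hw2 t0 ww hx hy.
have g1 := gd_en hw1 hx; have g2 := gd_en hw2 hy; have g3 := gd_dot hw hx hy.
have g1' := gdZ t g1; have g2' := gdZ t^-1 g2.
rewrite !enE /ip -!totZ // -totD //.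
apply: tot_le; [exact: gdZ|exact: gdD|].
move=> k; have /andP[a0 _] := hw k; have /andP[b0 _] := hw1 k; have /andP[c0 _] := hw2 k.
set X := normc (x k); set Y := normc (y k).
have X0 : 0 <= X := nc_ge0 _; have Y0 : 0 <= Y := nc_ge0 _.
have h1 : dotw w x y k <= w k * (X * Y).
  rewrite /dotw ler_wpM2l //; apply: (le_trans (ler_norm _)).
  by apply: (le_trans (nc_Re _)); rewrite ncM nc_conj.
apply: (@le_trans _ _ (2 * (w k * (X * Y)))); first by rewrite ler_wpM2l.
rewrite -(ler_pM2l t0) mulrDr mulrA [t * (t^-1 * _)]mulrA mulfV ?gt_eqF // mul1r.
pose P := Num.sqrt (w1 k); pose Q := Num.sqrt (w2 k).
have PQ : w k = P * Q.
  apply/eqP; rewrite -(@eqrXn2 _ 2) ?mulr_ge0 ?sqrtr_ge0 //.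
  by rewrite exprMn !sqr_sqrtr // ww.
have -> : w1 k = P ^+ 2 by rewrite sqr_sqrtr.
have -> : w2 k = Q ^+ 2 by rewrite sqr_sqrtr.
rewrite PQ -subr_ge0.
apply: (le_trans (sqr_ge0 (t * P * X - Q * Y))).
by rewrite le_eqVlt; apply/orP; left; apply/eqP; ring.
Qed.

Lemma ip_amgmN w w1 w2 (t : R) x y : wok w -> wok w1 -> wok w2 -> 0 < t ->
  (forall k, w k ^+ 2 = w1 k * w2 k) -> geo x -> geo y ->
  - (2 * ip w x y) <= t * en w1 x + t^-1 * en w2 y.
Proof.
move=> hw hw1 hw2 t0 ww hx hy; have hN := geoN hy.
have := ip_amgm hw hw1 hw2 t0 ww hx hN.
have -> : ip w x (fun n => - y n) = - ip w x y.
  rewrite -mulN1r -ipZr //; congr (ip _ _ _); apply/funext => n.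
  by rewrite rmorphN rmorph1 mulN1r.
have -> : en w2 (fun n => - y n) = en w2 y.
  by rewrite !enE; congr tot; apply/funext => n; rewrite ncN.
by rewrite mulrN.
Qed.

End Pairings.

(** * Blaschke factors acting on coefficient sequences *)

Section Operators.
Variable R : realType.
Implicit Types (x y : nat -> R[i]) (a b : R[i]).

Definition sh x : nat -> R[i] := fun n => if n is m.+1 then x m else 0.

(** Multiplication of power series by [z - a], by [1 - a^* z], and by the inverse
    of the latter. *)
Definition num a x : nat -> R[i] := fun n => sh x n - a * x n.
Definition den a x : nat -> R[i] := fun n => x n - conjc a * sh x n.
Fixpoint iden a x n : R[i] := if n is m.+1 then x n + conjc a * iden a x m else x 0%N.

Definition bf a x := num a (iden a x).
(** Multiplication by the Blaschke product with unimodular constant [c] and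
    zeros [s]. *)
Definition MB (c : R[i]) (s : seq R[i]) x : nat -> R[i] := fun n => c * foldr bf x s n.

Lemma iden_den a x : iden a (den a x) = x.
Proof.
apply/funext; elim=> [|n IH]; rewrite /= /den /=; first by rewrite mulr0 subr0.
by rewrite IH subrK.
Qed.

Lemma den_iden a x : den a (iden a x) = x.
Proof.
apply/funext; case=> [|n]; rewrite /den /=; first by rewrite mulr0 subr0.
by rewrite addrK.
Qed.

Lemma den_inj a x y : den a x = den a y -> x = y.
Proof. by move=> h; rewrite -(iden_den a x) h iden_den. Qed.

Lemma den_den a b x : den a (den b x) = den b (den a x).
Proof. by apply/funext; case=> [|[|n]]; rewrite /den /=; ring. Qed.

Lemma den_num a b x : den a (num b x) = num b (den a x).
Proof. by apply/funext; case=> [|[|n]]; rewrite /den /num /=; ring. Qed.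

Lemma iden_num a b x : iden a (num b x) = num b (iden a x).
Proof. by apply: (@den_inj a); rewrite den_num !den_iden. Qed.

Lemma den_iden_comm a b x : den a (iden b x) = iden b (den a x).
Proof. by apply: (@den_inj b); rewrite den_den !den_iden. Qed.

Lemma iden_foldr_num a x s : iden a (foldr num x s) = foldr num (iden a x) s.
Proof. by elim: s => //= b s <-; rewrite iden_num. Qed.

Lemma den_foldr_iden a x s : den a (foldr iden x s) = foldr iden (den a x) s.
Proof. by elim: s => //= b s <-; rewrite den_iden_comm. Qed.

Lemma foldr_bf x s : foldr bf x s = foldr num (foldr iden x s) s.
Proof. by elim: s => //= a s ->; rewrite /bf iden_foldr_num. Qed.

Lemma foldr_iden_den x s : foldr iden (foldr den x s) s = x.
Proof.
by elim: s x => //= a s IH x; rewrite -den_foldr_iden IH iden_den.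
Qed.

Definition lin (T : (nat -> R[i]) -> nat -> R[i]) : Prop :=
  (forall x y, T (fun n => x n + y n) = (fun n => T x n + T y n)) /\
  (forall k x, T (fun n => k * x n) = (fun n => k * T x n)).

Lemma lin_num a : lin (num a).
Proof.
split=> [x y|k x]; apply/funext; case=> [|n]; rewrite /num /=; ring.
Qed.

Lemma lin_den a : lin (den a).
Proof.
split=> [x y|k x]; apply/funext; case=> [|n]; rewrite /den /=; ring.
Qed.

Lemma lin_iden a : lin (iden a).
Proof.
have [dD dZ] := lin_den a.
by split=> [x y|k x]; apply: (@den_inj a); rewrite ?dD ?dZ !den_iden.
Qed.

Lemma lin_comp S T : lin S -> lin T -> lin (fun x => S (T x)).
Proof.
by move=> [SD SZ] [TD TZ]; split=> [x y|k x]; rewrite ?TD ?TZ ?SD ?SZ.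
Qed.

Lemma lin_foldr (F : R[i] -> (nat -> R[i]) -> nat -> R[i]) s :
  (forall a, lin (F a)) -> lin (fun x => foldr F x s).
Proof. by move=> h; elim: s => [|a s IH]; [split|exact: lin_comp]. Qed.

Lemma lin_MB c s : lin (MB c s).
Proof.
have [fD fZ] : lin (fun x => foldr bf x s).
  by apply: lin_foldr => a; apply: lin_comp; [exact: lin_num|exact: lin_iden].
split=> [x y|k x]; apply/funext => n; rewrite /MB ?fD ?fZ; ring.
Qed.

Lemma lin0 T : lin T -> T (fun=> 0) = (fun=> 0).
Proof.
move=> [_ TZ]; have := TZ 0 (fun=> 0); under [X in T X]eq_fun do rewrite mul0r.
by move=> ->; apply/funext => n; rewrite mul0r.
Qed.

(** * Power series of products *)

Lemma rep_num f x a : rep f x -> rep (fun z => (z - a) * f z) (num a x).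
Proof.
move=> fx z dz.
have h : cto (fun n => z * psum x z n) (z * f z) := ctoZ z (fx z dz).
have h2 : cto (fun n => psum (sh x) z n) (z * f z).
  apply/ctoP => e e0; have [N hN] := (ctoP _ _).1 h e e0.
  exists N.+1 => -[//|n] Nn; have := hN n Nn; congr (normc (_ - _) <= _).
  rewrite /psum big_ord_recl /= mul0r add0r mulr_sumr; apply: eq_bigr => k _.
  by rewrite /bump /= ?add1n exprS mulrCA.
rewrite mulrBl; apply: cto_eq (ctoB h2 (ctoZ a (fx z dz))) => n.
rewrite /psum mulr_sumr -sumrB; apply: eq_bigr => k _; rewrite /num; ring.
Qed.

Lemma rep_den f x a : rep f x -> rep (fun z => (1 - conjc a * z) * f z) (den a x).
Proof.
move=> fx; have h0 : rep (fun z => (z - 0) * f z) (num 0 x) := rep_num 0 fx.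
have h := repB fx (repZ (conjc a) h0).
apply: (rep_ext _ _ h) => [z _|n]; first by ring.
by rewrite /den /num mul0r subr0.
Qed.

(** The recursion defining [iden] preserves the rate [r] as soon as [|a| < r]. *)
Lemma iden_bound a x (K r : R) : normc a < r ->
  (forall n, normc (x n) <= K * r ^+ n) ->
  forall n, normc (iden a x n) <= (1 - normc a / r)^-1 * K * r ^+ n.
Proof.
move=> ar h; have r0 : 0 < r := le_lt_trans (nc_ge0 _) ar.
have q1 : 0 < 1 - normc a / r by rewrite subr_gt0 ltr_pdivrMr // mul1r.
set L := (1 - normc a / r)^-1.
have L0 : 0 < L by rewrite invr_gt0.
have K0 : 0 <= K by have := h 0%N; rewrite expr0 mulr1; apply: le_trans; exact: nc_ge0.
have L1 : 1 <= L by rewrite invf_ge1 // gerBl divr_ge0 ?nc_ge0 // ltW.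
elim=> [|n IH] /=.
  rewrite expr0 mulr1; apply: (le_trans (h 0%N)); rewrite expr0 mulr1.
  by rewrite -[leLHS]mul1r ler_wpM2r.
apply: (le_trans (ncD _ _)); rewrite ncM nc_conj.
apply: (@le_trans _ _ (K * r ^+ n.+1 + normc a * (L * K * r ^+ n))).
  by apply: lerD => //; rewrite ler_wpM2l ?nc_ge0.
have e : L * (1 - normc a / r) = 1 by rewrite mulVf // gt_eqF.
have -> : normc a * (L * K * r ^+ n) = L * (normc a / r) * (K * r ^+ n.+1).
  by rewrite exprS; field; rewrite gt_eqF.
have -> : L * (normc a / r) = L - 1 by rewrite -e mulrBr mulr1 opprB addrC subrK.
by rewrite mulrBl mul1r addrC subrK mulrA.
Qed.

Lemma growth_iden a x : normc a < 1 -> growth x -> growth (iden a x).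
Proof.
move=> a1 gx s s0 s1; pose t := (1 + s) / 2.
have [t0 st t1] : [/\ 0 < t, s < t & t < 1] by rewrite /t; split; lra.
have [M [M0 hM]] := gx t (ltW t0) t1.
have at1 : normc a < t^-1.
  by apply: (lt_trans a1); rewrite invf_gt1.
have hM' n : normc (x n) <= M * t^-1 ^+ n.
  by rewrite exprVn ler_pdivlMr ?exprn_gt0.
have h := iden_bound at1 hM'.
exists ((1 - normc a / t^-1)^-1 * M); split.
  by rewrite mulr_ge0 // invr_ge0 subr_ge0 invrK -ler_pdivlMr // mul1r ltW.
move=> n; apply: (@le_trans _ _ (normc (iden a x n) * t ^+ n)).
  by rewrite ler_wpM2l ?nc_ge0 // lerXn2r ?nnegrE ?(ltW t0) // ltW.
have := h n; rewrite exprVn ler_pdivlMr ?exprn_gt0 //.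
Qed.

Lemma one_sub_conj_neq0 a z : normc a < 1 -> disc z -> 1 - conjc a * z != 0.
Proof.
move=> a1 dz; rewrite -nc_gt0; apply: (lt_le_trans _ (nc_sub_le _ _)).
rewrite nc1 ncM nc_conj subr_gt0; apply: (le_lt_trans _ a1).
by rewrite ler_piMr ?nc_ge0 // ltW.
Qed.

Lemma rep_iden f x a : normc a < 1 -> rep f x ->
  rep (fun z => f z / (1 - conjc a * z)) (iden a x).
Proof.
move=> a1 fx; have [g gx] := growth_rep (growth_iden a1 (rep_growth fx)).
have h := rep_den a gx; rewrite den_iden in h.
apply: (rep_ext _ _ gx) => // z dz.
by rewrite (cto_uniq (fx z dz) (h z dz)) mulrC mulKf // one_sub_conj_neq0.
Qed.

Lemma rep_bf f x a : normc a < 1 -> rep f x ->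
  rep (fun z => (z - a) / (1 - conjc a * z) * f z) (bf a x).
Proof.
move=> a1 fx; apply: (rep_ext _ _ (rep_num a (rep_iden a1 fx))) => // z dz; ring.
Qed.

Lemma rep_MB (B : R[i] -> R[i]) c s f x : (forall a, a \in s -> normc a < 1) ->
  (forall z, disc z -> B z = c * \prod_(a <- s) ((z - a) / (1 - conjc a * z))) ->
  rep f x -> rep (fun z => B z * f z) (MB c s x).
Proof.
move=> hs hB fx.
have h : rep (fun z => \prod_(a <- s) ((z - a) / (1 - conjc a * z)) * f z) (foldr bf x s).
  elim: s hs {hB} => [|a s IH] hs /=.
    by apply: (rep_ext _ _ fx) => // z _; rewrite big_nil mul1r.
  have a1 : normc a < 1 by apply: hs; rewrite inE eqxx.
  have hs' b : b \in s -> normc b < 1 by move=> bs; apply: hs; rewrite inE bs orbT.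
  apply: (rep_ext _ _ (rep_bf a1 (IH hs'))) => // z _.
  by rewrite big_cons mulrA.
by apply: (rep_ext _ _ (repZ c h)) => // z dz; rewrite hB // mulrA.
Qed.

End Operators.

Arguments num {R} a x.
Arguments den {R} a x.
Arguments iden {R} a x n.
Arguments bf {R} a x.

(** * Energies of Blaschke multiples *)

Section BlaschkeEnergy.
Variable R : realType.
Variable rho : R.
Hypotheses (rho0 : 0 < rho) (rho1 : rho < 1).
Implicit Types (x y : nat -> R[i]) (a b : R[i]) (w : nat -> R).
Notation geo := (geo rho).

Notation w1 := (@one_weight R).
Definition wn : nat -> R := fun k => k%:R.
Definition wn2 : nat -> R := fun k => k%:R ^+ 2.

Lemma wok1 : wok w1.
Proof. by move=> k; rewrite ler01 -[leLHS](expr1n _ 2) lerXn2r ?nnegrE // ler1n. Qed.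

Lemma wokn : wok wn.
Proof.
move=> k; rewrite ler0n /=; apply: (@le_trans _ _ k.+1%:R); first by rewrite ler_nat.
by rewrite expr2 ler_peMr // ler1n.
Qed.

Lemma wokn2 : wok wn2.
Proof. by move=> k; rewrite sqr_ge0 /= lerXn2r ?nnegrE // ler_nat. Qed.

Lemma geo_sh x : geo x -> geo (sh x).
Proof.
move=> [K [K0 h]]; exists (K / rho); split; first by rewrite divr_ge0 // ltW.
case=> [|n]; rewrite /sh ?nc0; first by rewrite mulr_ge0 ?divr_ge0 ?exprn_ge0 // ltW.
by rewrite exprS mulrA divfK ?gt_eqF.
Qed.

Lemma geo_num a x : geo x -> geo (num a x).
Proof. by move=> h; apply: geoB; [exact: geo_sh|exact: geoZ]. Qed.

Lemma geo_den a x : geo x -> geo (den a x).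
Proof. by move=> h; apply: geoB => //; apply: geoZ; exact: geo_sh. Qed.

Lemma geo_iden a x : normc a < rho -> geo x -> geo (iden a x).
Proof.
move=> ar [K [K0 h]]; exists ((1 - normc a / rho)^-1 * K); split.
  by rewrite mulr_ge0 // invr_ge0 subr_ge0 ler_pdivrMr // mul1r ltW.
exact: iden_bound.
Qed.

Lemma geo_bf a x : normc a < rho -> geo x -> geo (bf a x).
Proof. by move=> ar h; apply: geo_num; exact: geo_iden. Qed.

Lemma geo_MB c s x : (forall a, a \in s -> normc a < rho) -> geo x -> geo (MB c s x).
Proof.
move=> hs h; apply: geoZ; elim: s hs => //= a s IH hs.
apply: geo_bf; first by apply: hs; rewrite inE eqxx.
by apply: IH => b bs; apply: hs; rewrite inE bs orbT.
Qed.

(** The weighted energies of [(z - a) h] and [(1 - a^* z) h] differ by a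
    telescoping sum. For constant weights this is the isometry of Blaschke factors
    on the Hardy space; for the weight [k] it gives Carleson's formula for
    the Dirichlet integral of a Blaschke multiple. *)
Lemma en_num_den w a h : wok w -> geo h ->
  en w (num a h) = en w (den a h) + (1 - normc a ^+ 2) *
    (tot (fun k => w k.+1 * normc (h k) ^+ 2) - en w h).
Proof.
move=> hw hh.
have gs := geo_sh hh; have gn := geo_num a hh; have gde := geo_den a hh.
have e1 : en w (sh h) = tot (fun k => w k.+1 * normc (h k) ^+ 2).
  rewrite enE totS; last exact: (gd_en rho0 rho1 hw gs).
  by rewrite {1}/sh nc0 expr0n mulr0 add0r.
rewrite -e1 -[LHS](subrK (en w (den a h))) addrC; congr (_ + _).
have [g1 g2] := (gd_en rho0 rho1 hw gs, gd_en rho0 rho1 hw hh).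
have [g3 g4] := (gd_en rho0 rho1 hw gn, gd_en rho0 rho1 hw gde).
rewrite !enE -!totB // -totZ; last exact: gdB.
congr tot; apply/funext => k.
rewrite /num /den; set u := sh h k; set v := h k.
rewrite -!mulrBr mulrCA; congr (_ * _).
rewrite !nc_sqr !ReD !ImD !ReN !ImN !ReM !ImM !ReJ !ImJ; ring.
Qed.

Lemma en1_bf a x : normc a < rho -> geo x -> en w1 (bf a x) = en w1 x.
Proof.
move=> ar hx; have hi := geo_iden ar hx.
rewrite /bf en_num_den //; last exact: wok1.
rewrite den_iden; have -> : tot (fun k => w1 k.+1 * normc (iden a x k) ^+ 2) = en w1 (iden a x).
  by rewrite enE.
by rewrite subrr mulr0 addr0.
Qed.

Lemma enn_bf a x : normc a < rho -> geo x ->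
  en wn (bf a x) = en wn x + (1 - normc a ^+ 2) * en w1 (iden a x).
Proof.
move=> ar hx; have hi := geo_iden ar hx.
rewrite /bf en_num_den //; last exact: wokn.
rewrite den_iden; congr (_ + _ * _); rewrite !enE -totB.
- by congr tot; apply/funext => k; rewrite /wn /one_weight -mulrBl -natr1 addrC addKr.
- exact: gdS (gd_en rho0 rho1 wokn (geo_sh hi)).
- exact: (gd_en rho0 rho1 wokn hi).
Qed.

(** Multiplication by [1 / (1 - a^* z)] has norm at most [1 / (1 - |a|)] on the
    Hardy space; this follows from the recursion defining [iden] and convexity
    of the square. *)
Lemma en1_iden_le a x : normc a < rho -> geo x ->
  en w1 (iden a x) <= (1 - normc a) ^- 2 * en w1 x.
Proof.
move=> ar hx; have hi := geo_iden ar hx; have hs := geo_sh hi.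
have a1 : normc a < 1 by exact: lt_trans rho1.
have a0 := nc_ge0 a; have p0 : 0 < 1 - normc a by rewrite subr_gt0.
have key k : normc (iden a x k) ^+ 2 <= (1 - normc a)^-1 * normc (x k) ^+ 2 +
    normc a * normc (sh (iden a x) k) ^+ 2.
  have : normc (iden a x k) <= normc (x k) + normc a * normc (sh (iden a x) k).
    case: k => [|k]; first by rewrite /sh nc0 mulr0 addr0.
    by apply: (le_trans (ncD _ _)); rewrite ncM nc_conj.
  set u := normc (x k); set v := normc (sh _ k) => h1.
  have u0 : 0 <= u := nc_ge0 _; have v0 : 0 <= v := nc_ge0 _.
  apply: (@le_trans _ _ ((u + normc a * v) ^+ 2)).
    by rewrite lerXn2r ?nnegrE ?nc_ge0 // addr_ge0 // mulr_ge0.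
  rewrite -(ler_pM2l p0) [leRHS]mulrDr mulVKf ?gt_eqF // -subr_ge0.
  have -> : u ^+ 2 + (1 - normc a) * (normc a * v ^+ 2) - (1 - normc a) * (u + normc a * v) ^+ 2
     = normc a * (u - (1 - normc a) * v) ^+ 2 by ring.
  by rewrite mulr_ge0 ?sqr_ge0.
have hshift : en w1 (sh (iden a x)) = en w1 (iden a x).
  rewrite !enE totS; last exact: (gd_en rho0 rho1 wok1 hs).
  by rewrite {1}/sh nc0 expr0n mulr0 add0r.
have : en w1 (iden a x) <= (1 - normc a)^-1 * en w1 x + normc a * en w1 (iden a x).
  rewrite -{2}hshift !enE; have g1 := gd_en rho0 rho1 wok1 hx.
  have g2 := gd_en rho0 rho1 wok1 hs; have g3 := gd_en rho0 rho1 wok1 hi.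
  rewrite -!totZ // -totD; [|exact: gdZ|exact: gdZ].
  apply: tot_le => // [|k]; first by apply: gdD; exact: gdZ.
  by rewrite /one_weight !mul1r.
rewrite -lerBlDr -{1}[en w1 (iden a x)]mul1r -mulrBl mulrC -ler_pdivlMr // => h.
by apply: (le_trans h); rewrite -exprVn expr2 mulrAC.
Qed.

Lemma en1_foldr_bf s x : (forall a, a \in s -> normc a < rho) -> geo x ->
  geo (foldr bf x s) /\ en w1 (foldr bf x s) = en w1 x.
Proof.
elim: s => [|a s IH] hs hx //=.
have [|h1 h2] := IH _ hx; first by move=> b bs; apply: hs; rewrite inE bs orbT.
have ar : normc a < rho by apply: hs; rewrite inE eqxx.
by split; [exact: geo_bf|rewrite en1_bf].
Qed.

(** No Blaschke factor decreases the Dirichlet integral, and the factor [z]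
    adds to it the square of the norm. This gain, due to the zero at the
    origin, is what makes the Dirichlet integral of [g B^k] grow with [k]. *)
Lemma enn_foldr_bf s x : (forall a, a \in s -> normc a < rho) -> geo x ->
  en wn x + (0 \in s)%:R * en w1 x <= en wn (foldr bf x s).
Proof.
elim: s => [|a s IH] hs hx //=; first by rewrite mul0r addr0.
have hs' b : b \in s -> normc b < rho by move=> bs; apply: hs; rewrite inE bs orbT.
have ar : normc a < rho by apply: hs; rewrite inE eqxx.
have [h1 h2] := en1_foldr_bf hs' hx.
rewrite enn_bf //; have hi := geo_iden ar h1.
have e0 : 0 <= en w1 (iden a (foldr bf x s)) by exact: (en_ge0 rho0 rho1 wok1 hi).
have x0 : 0 <= en w1 x by exact: (en_ge0 rho0 rho1 wok1 hx).
have a2 : 0 <= 1 - normc a ^+ 2.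
  by rewrite subr_ge0 exprn_ile1 ?nc_ge0 // ltW // (lt_trans ar).
rewrite inE; have [a00|an0] := eqVneq 0 a; last first.
  by apply: (le_trans (IH hs' hx)); rewrite lerDl mulr_ge0.
rewrite -a00 nc0 expr0n subr0 mul1r /= mul1r.
have i0 y : iden 0 y = y.
  apply: (@den_inj _ 0); rewrite den_iden; apply/funext => n.
  by rewrite /den conjc0 mul0r subr0.
rewrite i0 h2 lerD2r; apply: (le_trans _ (IH hs' hx)).
by rewrite lerDl mulr_ge0.
Qed.

Lemma enn_foldr_bf_le s : (forall a, a \in s -> normc a < rho) ->
  exists C, 0 <= C /\ forall x, geo x -> en wn (foldr bf x s) <= en wn x + C * en w1 x.
Proof.
elim: s => [|a s IH] hs.
  by exists 0; split=> // x _ /=; rewrite mul0r addr0.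
have hs' b : b \in s -> normc b < rho by move=> bs; apply: hs; rewrite inE bs orbT.
have ar : normc a < rho by apply: hs; rewrite inE eqxx.
have [C [C0 hC]] := IH hs'.
have a2 : 0 <= 1 - normc a ^+ 2.
  by rewrite subr_ge0 exprn_ile1 ?nc_ge0 // ltW // (lt_trans ar).
have p0 : 0 <= (1 - normc a) ^- 2 by rewrite invr_ge0 sqr_ge0.
exists (C + (1 - normc a ^+ 2) * (1 - normc a) ^- 2); split.
  by rewrite addr_ge0 // mulr_ge0.
move=> x hx /=; have [h1 h2] := en1_foldr_bf hs' hx.
rewrite enn_bf // (mulrDl C) addrA; apply: lerD; first exact: hC.
by rewrite -mulrA ler_wpM2l // -h2; exact: en1_iden_le.
Qed.

Section Multiplication.
Variables (c : R[i]) (s : seq R[i]).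
Hypotheses (c1 : normc c = 1) (hs : forall a, a \in s -> normc a < rho) (s0 : 0 \in s).

Notation M := (MB c s).

Lemma en_scale w x : wok w -> geo x -> en w (M x) = en w (foldr bf x s).
Proof.
move=> hw hx; have [h1 _] := en1_foldr_bf hs hx.
by rewrite /MB (enZ rho0 rho1 c hw h1) c1 expr1n mul1r.
Qed.

Lemma en1_MB x : geo x -> en w1 (M x) = en w1 x.
Proof. by move=> hx; rewrite en_scale ?(en1_foldr_bf hs hx).2 //; exact: wok1. Qed.

Lemma enn_MB_ge x : geo x -> en wn x + en w1 x <= en wn (M x).
Proof.
move=> hx; rewrite en_scale //; last exact: wokn.
by have := enn_foldr_bf hs hx; rewrite s0 mul1r.
Qed.

Lemma enn_MB_le : exists C, 0 <= C /\ forall x, geo x -> en wn (M x) <= en wn x + C * en w1 x.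
Proof.
have [C [C0 h]] := enn_foldr_bf_le hs; exists C; split=> // x hx.
by rewrite en_scale ?h //; exact: wokn.
Qed.

Lemma ip1_MB x y : geo x -> geo y -> ip w1 (M x) (M y) = ip w1 x y.
Proof.
move=> hx hy; have [MD _] := lin_MB c s.
have h := en1_MB (geoD hx hy).
rewrite MD !(enD rho0 rho1) in h; try exact: wok1; try exact: geo_MB; try by [].
rewrite !en1_MB // in h; lra.
Qed.

End Multiplication.

End BlaschkeEnergy.

(** * Coefficient sequences of the model space *)

Section Model.
Variable R : realType.
Variable rho : R.
Hypotheses (rho0 : 0 < rho) (rho1 : rho < 1).
Implicit Types (x y h u : nat -> R[i]) (a b c l : R[i]) (w : nat -> R).
Notation geo := (geo rho).

(** Functions [p / \prod_(a <- s) (1 - a^* z)] with [p] a polynomial of degree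
    smaller than the number of zeros. *)
Definition Kseq s h : Prop := forall n, (size s <= n)%N -> foldr den h s n = 0.

Definition delta0 : nat -> R[i] := fun n => (n == 0%N)%:R.

Lemma lin_fden s : lin (fun x => foldr den x s).
Proof. by apply: lin_foldr => a; exact: lin_den. Qed.

Lemma Kseq_lin s (k : R[i]) x y : Kseq s x -> Kseq s y -> Kseq s (fun n => k * x n + y n).
Proof.
have [dD dZ] := lin_fden s => hx hy n sn.
by rewrite dD dZ hx // hy // mulr0 addr0.
Qed.

Lemma Kseq0 s : Kseq s (fun=> 0).
Proof. by move=> n _; have := lin0 (lin_fden s) => /= ->. Qed.

Lemma KseqB s x y : Kseq s x -> Kseq s y -> Kseq s (fun n => x n - y n).
Proof.
move=> hx hy; have := Kseq_lin (-1) hy hx.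
by congr (Kseq s _); apply/funext => n; rewrite mulN1r addrC.
Qed.

Lemma KseqZ s k x : Kseq s x -> Kseq s (fun n => k * x n).
Proof.
move=> hx; have := Kseq_lin k hx (@Kseq0 s).
by congr (Kseq s _); apply/funext => n; rewrite addr0.
Qed.

Lemma cto_sh (u : nat -> nat -> R[i]) x : (forall n, cto (fun j => u j n) (x n)) ->
  forall n, cto (fun j => sh (u j) n) (sh x n).
Proof. by move=> h [|n]; [exact: cto_cst|exact: h]. Qed.

Lemma cto_fden s (u : nat -> nat -> R[i]) x : (forall n, cto (fun j => u j n) (x n)) ->
  forall n, cto (fun j => foldr den (u j) s n) (foldr den x s n).
Proof.
elim: s => [|a s IH] h n //=; apply: ctoB; first exact: IH.
by apply: ctoZ; apply: cto_sh; exact: IH.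
Qed.

Lemma Kseq_closed s (u : nat -> nat -> R[i]) x : (forall j, Kseq s (u j)) ->
  (forall n, cto (fun j => u j n) (x n)) -> Kseq s x.
Proof.
move=> hu h n sn; apply: cto_uniq (cto_fden s h n) _.
by apply: cto_eq (cto_cst 0) => j; rewrite hu.
Qed.

Lemma fden_bound s x (M : R) : (forall a, a \in s -> normc a < 1) ->
  (forall n, normc (x n) <= M) -> forall n, normc (foldr den x s n) <= 2 ^+ size s * M.
Proof.
elim: s => [|a s IH] hs h n; first by rewrite expr0 mul1r.
have a1 : normc a < 1 by apply: hs; rewrite inE eqxx.
have {}IH := IH _ h; have {}IH k : normc (foldr den x s k) <= 2 ^+ size s * M.
  by apply: IH => b bs; apply: hs; rewrite inE bs orbT.
have S0 : 0 <= 2 ^+ size s * M by apply: le_trans (nc_ge0 _) (IH 0%N).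
rewrite /= exprS -mulrA [2 * _]mulrDl mul1r; apply: (le_trans (ncB _ _)); apply: lerD => //.
rewrite ncM nc_conj; case: n => [|n]; first by rewrite nc0 mulr0.
apply: (@le_trans _ _ (normc (foldr den x s n))) => //.
by rewrite ler_piMl ?nc_ge0 // ltW.
Qed.

Lemma fiden_bound s : (forall a, a \in s -> normc a < rho) -> exists L, 0 <= L /\
  forall x K, (forall n, normc (x n) <= K * rho ^+ n) ->
  forall n, normc (foldr iden x s n) <= L * K * rho ^+ n.
Proof.
elim: s => [|a s IH] hs; first by exists 1; split=> // x K h n; rewrite mul1r.
have [|L [L0 hL]] := IH; first by move=> b bs; apply: hs; rewrite inE bs orbT.
have ar : normc a < rho by apply: hs; rewrite inE eqxx.
exists ((1 - normc a / rho)^-1 * L); split.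
  by rewrite mulr_ge0 // invr_ge0 subr_ge0 ler_pdivrMr // mul1r ltW.
by move=> x K h n /=; rewrite -(mulrA _ L K); apply: iden_bound => // k; exact: hL.
Qed.

Lemma geo_fiden s x : (forall a, a \in s -> normc a < rho) -> geo x -> geo (foldr iden x s).
Proof.
move=> hs [K [K0 h]]; have [L [L0 hL]] := fiden_bound hs.
by exists (L * K); split; [exact: mulr_ge0|exact: hL].
Qed.

Lemma geo_fden s x : geo x -> geo (foldr den x s).
Proof. by elim: s => //= a s IH h; apply: geo_den => //; exact: IH. Qed.

Lemma Kseq_geo s h : (forall a, a \in s -> normc a < rho) -> Kseq s h -> geo h.
Proof.
move=> hs hK; rewrite -(foldr_iden_den h s); apply: geo_fiden => //.
exact: geo_finite hK.
Qed.

(** The space is finite-dimensional, so its norms are comparable. Concretely,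
    the numerator is bounded by the sup norm, and division by the factors
    [1 - a^* z] keeps the rate [rho]. *)
Lemma Kseq_bound s : (forall a, a \in s -> normc a < rho) -> exists C, 0 <= C /\
  forall h M, Kseq s h -> (forall n, normc (h n) <= M) ->
  forall n, normc (h n) <= C * M * rho ^+ n.
Proof.
move=> hs; have [L [L0 hL]] := fiden_bound hs.
exists (L * (2 ^+ size s * rho ^- size s)); split.
  by rewrite mulr_ge0 // mulr_ge0 ?exprn_ge0 // invr_ge0 exprn_ge0 // ltW.
move=> h M hK hM n.
have hs1 a : a \in s -> normc a < 1 by move=> /hs /lt_trans; exact.
have hf := fden_bound hs1 hM.
have r0 : 0 <= rho := ltW rho0.
rewrite -{1}(foldr_iden_den h s) -[L * _ * M]mulrA; apply: hL => k.
have S0 : 0 <= 2 ^+ size s * M by apply: le_trans (nc_ge0 _) (hf 0%N).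
have -> : 2 ^+ size s * rho ^- size s * M * rho ^+ k =
  2 ^+ size s * M * (rho ^- size s * rho ^+ k) by ring.
have [sk|ks] := leqP (size s) k.
  by rewrite hK // nc0; apply: mulr_ge0 => //; apply: mulr_ge0; rewrite ?invr_ge0; apply: exprn_ge0.
apply: (le_trans (hf k)); rewrite ler_peMr //.
by rewrite mulrC ler_pdivlMr ?exprn_gt0 // mul1r ler_wiXn2l ?(ltW rho1) // ltnW.
Qed.

Lemma nc_le_en1 x n : geo x -> normc (x n) <= Num.sqrt (en (@one_weight R) x).
Proof.
move=> hx; rewrite -(ger0_norm (nc_ge0 (x n))) -sqrtr_sqr ler_wsqrtr //.
have := en_partial rho0 rho1 n.+1 (@wok1 R) hx; apply: le_trans.
rewrite big_ord_recr /= /one_weight mul1r lerDr; apply: sumr_ge0 => k _.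
by rewrite mul1r sqr_ge0.
Qed.

Lemma Kseq_en s : (forall a, a \in s -> normc a < rho) -> exists D, 0 <= D /\
  forall h, Kseq s h -> en (@wn2 R) h <= D * en (@one_weight R) h.
Proof.
move=> hs; have [C [C0 hC]] := Kseq_bound hs.
have g := gd_quad rho0 rho1.
have T0 : 0 <= tot (fun k => k.+1%:R ^+ 2 * (rho ^+ k) ^+ 2).
  by apply: tot_ge0 => // k; rewrite mulr_ge0 ?sqr_ge0.
exists (C ^+ 2 * tot (fun k => k.+1%:R ^+ 2 * (rho ^+ k) ^+ 2)); split.
  by rewrite mulr_ge0 ?sqr_ge0.
move=> h hK; have hg := Kseq_geo hs hK.
have e0 := en_ge0 rho0 rho1 (@wok1 R) hg.
pose M := Num.sqrt (en (@one_weight R) h).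
have hM n : normc (h n) <= C * M * rho ^+ n by apply: hC => // k; exact: nc_le_en1.
have -> : en (@one_weight R) h = M ^+ 2 by rewrite sqr_sqrtr.
rewrite mulrAC -exprMn enE -totZ //; apply: tot_le.
- exact: (gd_en rho0 rho1 (@wokn2 R) hg).
- exact: gdZ.
move=> k; rewrite [leRHS]mulrCA; apply: ler_pM; rewrite ?sqr_ge0 //.
  by have /andP[_] := @wokn2 R k.
rewrite -exprMn lerXn2r ?nnegrE ?nc_ge0 //.
by apply: le_trans (nc_ge0 _) (hM k).
Qed.

(** * Orthogonality of the model space and the multiples of the Blaschke product *)

(** The adjoint of multiplication by [z - a]. *)
Definition anum a h : nat -> R[i] := fun n => h n.+1 - conjc a * h n.

Lemma geoS x : geo x -> geo (fun n => x n.+1).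
Proof.
move=> [K [K0 h]]; exists (K * rho); split; first by rewrite mulr_ge0 // ltW.
by move=> n; rewrite -mulrA -exprS.
Qed.

Lemma geo_anum a h : geo h -> geo (anum a h).
Proof. by move=> hh; apply: geoB; [exact: geoS|exact: geoZ]. Qed.

Lemma anum_foldr a h s : anum a (foldr anum h s) = foldr anum (anum a h) s.
Proof.
elim: s => //= b s <-; apply/funext => n; rewrite /anum; ring.
Qed.

(** The adjoints of the factors [z - a] recover the coefficients of the
    numerator [\prod_(a <- s) (1 - a^* z) h] beyond the number of zeros; these
    vanish on the model space. *)
Lemma foldr_anum h s n : foldr anum h s n = foldr den h s (n + size s)%N.
Proof.
elim: s n => [|a s IH] n; first by rewrite addn0.
by rewrite /= /anum !IH addnS /den /= addSn.
Qed.

Lemma geo_bounded h u (M : R) : geo h -> (forall n, normc (u n) <= M) ->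
  cto (fun n => h n * conjc (u n)) 0.
Proof.
move=> [K [K0 hK]] hu; have M0 : 0 <= M := le_trans (nc_ge0 _) (hu 0%N).
apply: (@cto_le _ _ _ (fun n => K * M * rho ^+ n)).
  move=> n; rewrite subr0 ncM nc_conj mulrAC; apply: ler_pM; rewrite ?nc_ge0 //.
rewrite -[X in _ --> X](mulr0 (K * M)); apply: cvgMr; apply: cvg_expr.
by rewrite ger0_norm // ltW.
Qed.

Lemma anum_adjoint a h u l : cto (fun n => h n * conjc (u n)) 0 ->
  cto (fun n => \sum_(k < n) anum a h k * conjc (u k)) l ->
  cto (fun n => \sum_(k < n) h k * conjc (num a u k)) l.
Proof.
move=> hh hl.
have h1 : cto (fun n => \sum_(k < n) anum a h k * conjc (u k) -
    conjc a * (h n * conjc (u n))) l.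
  rewrite -[l]subr0 -[X in _ - X](mulr0 (conjc a)); apply: ctoB => //; exact: ctoZ.
have key n : \sum_(k < n.+1) h k * conjc (num a u k) =
    \sum_(k < n) anum a h k * conjc (u k) - conjc a * (h n * conjc (u n)).
  elim: n => [|n IH].
    rewrite big_ord_recr !big_ord0 /= /num /= !sub0r add0r.
    by rewrite rmorphN rmorphM mulrN mulrCA.
  rewrite big_ord_recr IH big_ord_recr /= /num /= /anum rmorphB rmorphM.
  ring.
apply/ctoP => e e0; have [N hN] := (ctoP _ _).1 h1 e e0.
by exists N.+1 => -[//|n] Nn; rewrite key; exact: hN.
Qed.

Lemma fnum_adjoint (P Q : (nat -> R[i]) -> Prop) s h u l :
  (forall a h, P h -> P (anum a h)) -> (forall a u, Q u -> Q (num a u)) ->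
  (forall h u, P h -> Q u -> cto (fun n => h n * conjc (u n)) 0) -> P h -> Q u ->
  cto (fun n => \sum_(k < n) foldr anum h s k * conjc (u k)) l ->
  cto (fun n => \sum_(k < n) h k * conjc (foldr num u s k)) l.
Proof.
move=> hP hQ hPQ; elim: s h => [|a s IH] h hh hu hl //=.
have hQs : Q (foldr num u s) by elim: (s) => //= b s' hs; exact: hQ.
apply: anum_adjoint; first exact: hPQ.
by apply: IH => //; [exact: hP|move: hl; rewrite /= anum_foldr].
Qed.

Definition bounded u : Prop := exists M, forall n, normc (u n) <= M.

Lemma num_bounded a u : bounded u -> bounded (num a u).
Proof.
move=> [M hM]; have M0 : 0 <= M := le_trans (nc_ge0 _) (hM 0%N).
exists (M + normc a * M) => n; apply: (le_trans (ncB _ _)); apply: lerD.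
  have M00 : normc (0 : R[i]) <= M by rewrite nc0.
  by case: n => [|n]; [exact: M00|exact: hM].
by rewrite ncM ler_wpM2l ?nc_ge0.
Qed.

Lemma iden_bounded s u : (forall a, a \in s -> normc a < 1) -> bounded u ->
  bounded (foldr iden u s).
Proof.
elim: s => [|a s IH] hs hu //=.
have [|M hM] := IH _ hu; first by move=> b bs; apply: hs; rewrite inE bs orbT.
have a1 : normc a < 1 by apply: hs; rewrite inE eqxx.
exists ((1 - normc a / 1)^-1 * M) => n.
have := @iden_bound _ a (foldr iden u s) M 1 a1 _ n; rewrite expr1n mulr1; apply.
by move=> k; rewrite expr1n mulr1.
Qed.

Lemma Kseq_orth c s h u : (forall a, a \in s -> normc a < rho) -> Kseq s h ->
  bounded u -> cto (fun n => \sum_(k < n) h k * conjc (MB c s u k)) 0.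
Proof.
move=> hs hK hu.
have hs1 a : a \in s -> normc a < 1 by move=> /hs /lt_trans; exact.
have h0 : cto (fun n => \sum_(k < n) foldr anum h s k * conjc (foldr iden u s k)) 0.
  apply: cto_eq (cto_cst 0) => n; rewrite big1 // => k _.
  by rewrite foldr_anum hK ?mul0r // leq_addl.
have := fnum_adjoint geo_anum num_bounded _ (Kseq_geo hs hK) (iden_bounded hs1 hu) h0.
rewrite -foldr_bf => h1.
have /(ctoZ (conjc c)) := h1 (fun x y gx '(ex_intro M hM) => geo_bounded gx hM).
rewrite mulr0; apply: cto_eq => n.
by rewrite mulr_sumr; apply: eq_bigr => k _; rewrite /MB rmorphM mulrCA.
Qed.

Lemma MB_bounded c s u : (forall a, a \in s -> normc a < 1) -> bounded u ->
  bounded (MB c s u).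
Proof.
move=> hs hu.
have [M hM] : bounded (foldr num (foldr iden u s) s).
  elim: {2}s => [|b s' IH] //=; last exact: num_bounded.
  exact: iden_bounded.
by exists (normc c * M) => n; rewrite /MB foldr_bf ncM ler_wpM2l ?nc_ge0.
Qed.

Lemma ip1_Kseq c s h x : (forall a, a \in s -> normc a < rho) -> Kseq s h -> geo x ->
  ip (@one_weight R) h (MB c s x) = 0.
Proof.
move=> hs hK [K [K0 hx]]; have hu : bounded x.
  by exists K => n; apply: (le_trans (hx n)); rewrite ler_piMr // exprn_ile1 ?ltW.
apply: tot_eq; have := cto_Re (Kseq_orth c hs hK hu).
rewrite (_ : (fun n => _) = (fun n => \sum_(k < n) dotw (@one_weight R) h (MB c s x) k)) //.
by apply/funext => n; rewrite Re_sum; apply: eq_bigr => k _; rewrite /dotw mul1r.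
Qed.

End Model.

Arguments anum {R} a h n.
Arguments delta0 {R} n.

(** * Energies of finite Blaschke expansions *)

Section Expansion.
Variable R : realType.
Variable rho : R.
Hypotheses (rho0 : 0 < rho) (rho1 : rho < 1).
Variables (c : R[i]) (s : seq R[i]).
Hypotheses (c1 : normc c = 1) (hs : forall a, a \in s -> normc a < rho) (s0 : 0 \in s).
Implicit Types (x y h : nat -> R[i]) (g : nat -> nat -> R[i]) (w : nat -> R).
Notation geo := (geo rho).
Notation K := (Kseq s).
Notation M := (MB c s).
Notation w1 := (@one_weight R).
Notation wn := (@wn R).
Notation wn2 := (@wn2 R).

(** Coefficients of [\sum_(k < m) g_k B^k], by the Horner scheme. *)
Fixpoint FS m g : nat -> R[i] :=
  if m is p.+1 then fun n => g 0%N n + M (FS p (fun k => g k.+1)) n else fun=> 0.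

Let Kgeo h : K h -> geo h := fun hK => Kseq_geo rho0 rho1 hs hK.

Lemma geo_M x : geo x -> geo (M x).
Proof. exact: geo_MB. Qed.

Lemma geo_FS m g : (forall k, K (g k)) -> geo (FS m g).
Proof.
elim: m g => [|m IH] g hg; first exact: geo0.
by apply: geoD; [exact: Kgeo|apply: geo_M; exact: IH].
Qed.

Lemma ip1_FS m g (h : nat -> nat -> R[i]) : (forall k, K (g k)) -> (forall k, K (h k)) ->
  ip w1 (FS m g) (FS m h) = \sum_(k < m) ip w1 (g k) (h k).
Proof.
elim: m g h => [|m IH] g h hg hh.
  rewrite big_ord0; apply: tot_eq; rewrite (_ : (fun n => _) = (fun=> 0)); first exact: cvg_cst.
  by apply/funext => n; rewrite big1 // => k _; rewrite /dotw mul0r mulr0.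
have gG : geo (FS m (fun k => g k.+1)) by exact: geo_FS.
have gH : geo (FS m (fun k => h k.+1)) by exact: geo_FS.
have gMG := geo_M gG; have gMH := geo_M gH.
have g0 := Kgeo (hg 0%N); have h0 := Kgeo (hh 0%N).
have o := @wok1 R.
rewrite big_ord_recl /= (ipDl rho0 rho1 o g0 gMG (geoD h0 gMH)).
rewrite (ipDr rho0 rho1 o g0 h0 gMH) (ipDr rho0 rho1 o gMG h0 gMH).
rewrite (ip1_Kseq rho0 rho1 c hs (hg 0%N) gH) addr0.
rewrite (ipC _ (M _) (h _)) (ip1_Kseq rho0 rho1 c hs (hh 0%N) gG) add0r.
by rewrite (ip1_MB rho0 rho1 c1 hs) // IH.
Qed.

Lemma en1_FS m g : (forall k, K (g k)) -> en w1 (FS m g) = \sum_(k < m) en w1 (g k).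
Proof. by move=> hg; rewrite /en ip1_FS. Qed.

Lemma en1_K_ge0 h : K h -> 0 <= en w1 h.
Proof. by move=> /Kgeo hh; apply: (en_ge0 rho0 rho1 (@wok1 R) hh). Qed.

(** Elements of the model space have energies of all orders comparable to their
    norm; so in the Dirichlet energy of [h + B y] the cross term costs a multiple of
    the squared norm of [h] and an arbitrarily small multiple of that of [y]. *)
Lemma cross_le : exists D, 0 <= D /\ forall t h y, 0 < t -> K h -> geo y ->
  `|2 * ip wn h (M y)| <= t * D * en w1 h + t^-1 * en w1 y /\
  en wn h <= D * en w1 h.
Proof.
have [D [D0 hD]] := Kseq_en rho0 rho1 hs.
exists D; split=> // t h y t0 hK hy; have hh := Kgeo hK.
have gM := geo_M hy; have hDh := hD h hK.
have ww k : wn k ^+ 2 = wn2 k * w1 k by rewrite /wn2 /one_weight mulr1.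
have h1 := ip_amgm rho0 rho1 (@wokn R) (@wokn2 R) (@wok1 R) t0 ww hh gM.
have h2 := ip_amgmN rho0 rho1 (@wokn R) (@wokn2 R) (@wok1 R) t0 ww hh gM.
rewrite (en1_MB rho0 rho1 c1 hs hy) in h1 h2.
have h3 : t * en wn2 h <= t * D * en w1 h by rewrite -mulrA ler_pM2l.
split; first by rewrite ler_norml; apply/andP; split; lra.
apply: le_trans hDh; rewrite !enE; apply: tot_le.
- exact: (gd_en rho0 rho1 (@wokn R) hh).
- exact: (gd_en rho0 rho1 (@wokn2 R) hh).
move=> k; rewrite ler_wpM2r ?sqr_ge0 // /wn /wn2 -natrX ler_nat.
by case: k => // k; rewrite expnS leq_pmulr // expn1.
Qed.

Lemma enn_step h y : K h -> geo y ->
  en wn (fun n => h n + M y n) = en wn h + 2 * ip wn h (M y) + en wn (M y).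
Proof.
by move=> hK hy; rewrite (enD rho0 rho1 (@wokn R)) //; [exact: Kgeo|exact: geo_M].
Qed.

(** Induction on the Horner scheme [h + B y]: by [cross_le] and [enn_MB_le]
    each step costs a multiple of the squared norms of [h] and [y], and that of
    [y] is the sum of the squared norms of the later terms. *)
Lemma enn_FS_le : exists A, 0 <= A /\ forall m g, (forall k, K (g k)) ->
  en wn (FS m g) <= A * \sum_(k < m) k.+1%:R * en w1 (g k).
Proof.
have [D [D0 hD]] := cross_le; have [C [C0 hC]] := enn_MB_le rho0 rho1 c1 hs.
exists (2 * D + C + 1); split; first lra.
elim=> [|m IH] g hg.
  rewrite big_ord0 mulr0 enE (@tot_eq _ _ 0) //.
  rewrite (_ : (fun n => _) = (fun=> 0)); first exact: cvg_cst.
  by apply/funext => n; rewrite big1 // => k _; rewrite nc0 expr0n mulr0.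
set A := 2 * D + C + 1; pose g' := fun k => g k.+1.
have hg' k : K (g' k) by exact: hg.
have gy : geo (FS m g') by exact: geo_FS.
have [cr n0] := hD 1 _ _ ltr01 (hg 0%N) gy.
have hB := hC _ gy; have hI := IH _ hg'; have e1 := en1_FS m hg'.
rewrite /= enn_step // big_ord_recl mul1r mulrDr.
have -> : \sum_(i < m) (lift ord0 i).+1%:R * en w1 (g (lift ord0 i)) =
    \sum_(k < m) k.+1%:R * en w1 (g' k) + \sum_(k < m) en w1 (g' k).
  by rewrite -big_split /=; apply: eq_bigr => k _; rewrite /bump /= add1n -natr1 mulrDl mul1r.
rewrite -e1 mulrDr; have E0 := en1_K_ge0 (hg 0%N).
have Y0 := en_ge0 rho0 rho1 (@wok1 R) gy.
move: cr; rewrite ler_norml invr1 !mul1r => /andP[_ cr].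
have k1 : A * en w1 (g 0%N) >= 2 * D * en w1 (g 0%N) by rewrite ler_wpM2r // /A; lra.
have k2 : A * en w1 (FS m g') >= (C + 1) * en w1 (FS m g') by rewrite ler_wpM2r // /A; lra.
rewrite (_ : g ord0 = g 0%N) // /g'; rewrite -/A /g' in hB hI k2 cr; lra.
Qed.

(** In the step [h + B y] the gain of [enn_MB_ge], the square of the norm of
    [y], pays for the cross term and leaves half of itself. *)
Lemma enn_FS_ge : exists A, 0 <= A /\ forall m g, (forall k, K (g k)) ->
  2^-1 * \sum_(k < m) k%:R * en w1 (g k) <= en wn (FS m g) + A * \sum_(k < m) en w1 (g k).
Proof.
have [D [D0 hD]] := cross_le.
exists (2 * D); split; first lra.
elim=> [|m IH] g hg.
  rewrite !big_ord0 !mulr0 addr0; apply: (en_ge0 rho0 rho1 (@wokn R)); exact: geo0.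
pose g' := fun k => g k.+1.
have hg' k : K (g' k) by exact: hg.
have gy : geo (FS m g') by exact: geo_FS.
have [cr n0] := hD 2 _ _ (ltr0Sn _ _) (hg 0%N) gy.
have hB := enn_MB_ge rho0 rho1 c1 hs s0 gy; have hI := IH _ hg'; have e1 := en1_FS m hg'.
rewrite /= enn_step // big_ord_recl mul0r add0r big_ord_recl.
have -> : \sum_(i < m) (lift ord0 i)%:R * en w1 (g (lift ord0 i)) =
    \sum_(k < m) k%:R * en w1 (g' k) + \sum_(k < m) en w1 (g' k).
  by rewrite -big_split /=; apply: eq_bigr => k _; rewrite /bump /= add1n -natr1 mulrDl mul1r.
have -> : \sum_(i < m) en w1 (g (lift ord0 i)) = \sum_(k < m) en w1 (g' k) by [].
rewrite -e1 in hI *; rewrite (_ : g ord0 = g 0%N) //; have E0 := en1_K_ge0 (hg 0%N).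
have G0 := en_ge0 rho0 rho1 (@wokn R) (Kgeo (hg 0%N)).
have Y0 := en_ge0 rho0 rho1 (@wok1 R) gy.
move: cr; rewrite ler_norml => /andP[cr _].
rewrite /g' in hB hI Y0 cr *; lra.
Qed.

(** The estimate to be proved for each of the three weights; its constant does not
    depend on the number of terms. *)
Definition expansion_like w : Prop := exists A, 0 < A /\ forall m g, (forall k, K (g k)) ->
  en w (FS m g) <= A * \sum_(k < m) w k * en w1 (g k) /\
  \sum_(k < m) w k * en w1 (g k) <= A * en w (FS m g).

Lemma expansion_like1 : expansion_like w1.
Proof.
exists 1; split=> // m g hg; rewrite en1_FS // !mul1r.
suff -> : \sum_(k < m) w1 k * en w1 (g k) = \sum_(k < m) en w1 (g k) by [].
by apply: eq_bigr => k _; rewrite mul1r.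
Qed.

Notation wd := (@dir_weight R).
Notation wb := (@berg_weight R).

Lemma wokd : wok wd.
Proof. by move=> k; rewrite ler0n /= expr2 ler_peMr // ler1n. Qed.

Lemma wokb : wok wb.
Proof.
move=> k; rewrite invr_ge0 ler0n /=; apply: (@le_trans _ _ 1).
  by rewrite invf_le1 // ler1n.
by rewrite -[leLHS](expr1n _ 2) lerXn2r ?nnegrE // ler1n.
Qed.

Lemma enwdE x : geo x -> en wd x = en wn x + en w1 x.
Proof.
move=> hx; rewrite !enE -totD; [|exact: (gd_en rho0 rho1 (@wokn R))|exact: (gd_en rho0 rho1 (@wok1 R))].
by congr tot; apply/funext => k; rewrite -mulrDl /dir_weight /wn /one_weight natr1.
Qed.

Lemma expansion_liked : expansion_like wd.
Proof.
have [A [A0 hA]] := enn_FS_le; have [C [C0 hC]] := enn_FS_ge.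
exists (A + 2 * C + 3); split=> [|m g hg]; first lra.
have hx := geo_FS m hg; rewrite enwdE //.
have h1 := hA m g hg; have h2 := hC m g hg; have h3 := en1_FS m hg.
have hs1 : \sum_(k < m) wd k * en w1 (g k) =
    \sum_(k < m) k%:R * en w1 (g k) + \sum_(k < m) en w1 (g k).
  by rewrite -big_split; apply: eq_bigr => k _; rewrite /dir_weight -natr1 mulrDl mul1r.
have N0 := en_ge0 rho0 rho1 (@wokn R) hx; have O0 := en_ge0 rho0 rho1 (@wok1 R) hx.
have hk : 0 <= \sum_(k < m) k%:R * en w1 (g k).
  by apply: sumr_ge0 => k _; rewrite mulr_ge0 // en1_K_ge0.
have hd : \sum_(k < m) k.+1%:R * en w1 (g k) = \sum_(k < m) wd k * en w1 (g k) by [].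
rewrite hd hs1 in h1; rewrite -h3 in h1 h2 hs1; rewrite hs1.
move: h1 h2 N0 O0 hk; set P := en wn _; set Q := en w1 _; set T := \sum_(k < m) _.
move=> h1 h2 P0 Q0 T0.
have C1 : 0 <= C * (T + Q) by rewrite mulr_ge0 // addr_ge0.
have A1 : 0 <= A * (P + Q) by rewrite mulr_ge0 // addr_ge0.
have C2 : 0 <= C * P by rewrite mulr_ge0.
by split; lra.
Qed.

End Expansion.

(** * Blaschke expansions of polynomials *)

Section PolynomialExpansion.
Variable R : realType.
Implicit Types (x y : nat -> R[i]) (a b c : R[i]) (s : seq R[i]).

(** Division of [(1 - a^* z) x] by [z - a] with remainder [k]. *)
Lemma peel a m x : (forall k, (m <= k)%N -> x k = 0) ->
  exists k y, x = (fun n => k * iden a delta0 n + bf a y n) /\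
    forall n, (m <= n + (a == 0)%R)%N -> y n = 0.
Proof.
move=> hx; pose P := den a x.
have hP k : (m < k)%N -> P k = 0.
  by case: k => // k mk; rewrite /P /den /= !hx ?mulr0 ?subr0 // ltnW.
pose y n := \sum_(j < m.+1) a ^+ j * P (n + j).+1.
have [dD dZ] := lin_den a.
exists (P 0%N + a * y 0%N), y; split.
  apply: (@den_inj _ a); rewrite dD dZ /bf den_num !den_iden -/P.
  apply/funext => -[|n]; rewrite /num /delta0 /=; first by rewrite mulr1 sub0r addrK.
  rewrite mulr0 add0r {1}/y big_ord_recl /= expr0 mul1r addn0 /y big_ord_recr /=.
  rewrite [P (n.+1 + m).+1]hP ?ltnS ?leq_addl // mulr0 addr0 mulr_sumr -addrA.
  rewrite (_ : \sum_(i < m) _ - _ = 0) ?addr0 //; apply/eqP; rewrite subr_eq0; apply/eqP.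
  by apply: eq_bigr => i _; rewrite /bump /= add1n exprS mulrA addnS addSn.
move=> n mn; rewrite /y big1 // => -[j /= _] _; have [a0|an0] := eqVneq a 0; last first.
  rewrite (negPf an0) addn0 in mn; rewrite hP ?mulr0 // ltnS.
  exact: leq_trans mn (leq_addr _ _).
rewrite a0 eqxx addn1 in mn; rewrite /P /den a0 conjc0 mul0r subr0 hx ?mulr0 //.
by apply: (leq_trans mn); rewrite ltnS leq_addr.
Qed.

Lemma den_foldr_den a x s : den a (foldr den x s) = foldr den (den a x) s.
Proof. by elim: s => //= b s <-; rewrite den_den. Qed.

Lemma foldr_den_iden x s : foldr den (foldr iden x s) s = x.
Proof. by elim: s => //= a s IH; rewrite den_foldr_den den_iden. Qed.

Lemma foldr_den_num a x s : foldr den (num a x) s = num a (foldr den x s).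
Proof. by elim: s => //= b s ->; rewrite den_num. Qed.

Lemma foldr_den_supp s m x : (forall k, (m <= k)%N -> x k = 0) ->
  forall k, (m + size s <= k)%N -> foldr den x s k = 0.
Proof.
move=> hx; elim: s => [|a s IH] k /=; first by rewrite addn0; exact: hx.
rewrite addnS; case: k => // k; rewrite ltnS => mk.
by rewrite /den /= !IH ?mulr0 ?subr0 // ltnW.
Qed.

(** Division by [B], one factor after the other. The factor [z] lowers the
    degree and the others do not increase it. *)
Lemma peel_all s m x : (forall k, (m <= k)%N -> x k = 0) ->
  exists g y, [/\ Kseq s g, x = (fun n => g n + foldr bf y s n) &
    forall n, (m <= n + (0 \in s)%R)%N -> y n = 0].
Proof.
elim: s m x => [|a s IH] m x hx.
  exists (fun=> 0), x; split; first exact: Kseq0.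
    by apply/funext => n; rewrite add0r.
  by move=> n; rewrite addn0; exact: hx.
have [k [x' [ex hx']]] := peel a hx.
have hx2 n : (m - (a == 0)%R <= n)%N -> x' n = 0 by rewrite leq_subLR addnC; exact: hx'.
have [g [y [hg ex' hy]]] := IH _ _ hx2.
have [nD nZ] := lin_num a; have [iD iZ] := lin_iden a.
exists (fun n => k * iden a delta0 n + bf a g n), y; split.
- apply: Kseq_lin => n /=; case: n => // n; rewrite ltnS => sn; rewrite den_foldr_den.
    rewrite den_iden (@foldr_den_supp _ 1) ?add1n // => -[] //.
  by rewrite /bf den_num den_iden foldr_den_num /num /= !hg ?mulr0 ?subr0 // ltnW.
- rewrite {1}ex {1}ex'; apply/funext => n.
  by rewrite /= /bf iD nD addrA.
move=> n; rewrite inE => mn; apply: hy; rewrite leq_subLR; apply: (leq_trans mn).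
rewrite [0 == a]eq_sym; case: (a == 0); case: (0 \in s); rewrite /= ?addn0 ?addn1 ?add1n //.
Qed.

(** Since [B] vanishes at the origin, each division by [B] lowers the degree,
    so that polynomials have finite expansions. *)
Lemma poly_FS c s m x : c != 0 -> 0 \in s -> (forall k, (m <= k)%N -> x k = 0) ->
  exists g, [/\ forall k, Kseq s (g k), forall k, (m <= k)%N -> g k = (fun=> 0) &
    x = FS c s m g].
Proof.
move=> c0 s0; elim: m x => [|m IH] x hx.
  exists (fun _ _ => 0); split=> // [k|]; first exact: Kseq0.
  by apply/funext => n; rewrite hx.
have [g0 [y [hg ex hy]]] := peel_all s hx.
rewrite s0 in hy.
have hy' k : (m <= k)%N -> c^-1 * y k = 0 by move=> mk; rewrite hy ?mulr0 // addn1.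
have [g [hK hg0 eg]] := IH _ hy'.
exists (fun k => if k is p.+1 then g p else g0); split=> [[|k]|[|k]|] //.
  exact: hg0.
rewrite /= -eg ex; apply/funext => n; congr (_ + _).
rewrite /MB; have [_ fZ] : lin (fun x => foldr bf x s).
  by apply: lin_foldr => a; apply: lin_comp; [exact: lin_num|exact: lin_iden].
by rewrite fZ mulrA mulfV // mul1r.
Qed.

Lemma FS0 c s m g : (forall k, g k = (fun=> 0)) -> FS c s m g = (fun=> 0).
Proof.
elim: m g => [|m IH] g hg //=; rewrite IH => [|k]; last by rewrite hg.
by rewrite (lin0 (lin_MB c s)) hg; apply/funext => n; rewrite addr0.
Qed.

Lemma FS_pad c s m J g : (m <= J)%N -> (forall k, (m <= k)%N -> g k = (fun=> 0)) ->
  FS c s J g = FS c s m g.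
Proof.
elim: m J g => [|m IH] J g mJ hg; first by rewrite FS0 // => k; exact: hg.
by case: J mJ => // J mJ /=; rewrite IH // => k mk; apply: hg.
Qed.

Lemma eq_FS c s m g h : (forall k, (k < m)%N -> g k = h k) -> FS c s m g = FS c s m h.
Proof.
elim: m g h => [|m IH] g h e //=; rewrite e // (IH _ (fun k => h k.+1)) // => k km.
exact: e.
Qed.

Lemma FSB c s m g h :
  (fun n => FS c s m g n - FS c s m h n) = FS c s m (fun k n => g k n - h k n).
Proof.
have [MD MZ] := lin_MB c s.
elim: m g h => [|m IH] g h /=; first by apply/funext => n; rewrite subr0.
rewrite -IH (_ : (fun n => FS c s m _ n - _) = (fun n => FS c s m (fun k => g k.+1) n +
   (-1) * FS c s m (fun k => h k.+1) n)); last by apply/funext => n; rewrite mulN1r.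
by rewrite MD MZ; apply/funext => n; ring.
Qed.

End PolynomialExpansion.

(** * Duality between the weights [k + 1] and [1 / (k + 1)] *)

Section Duality.
Variable R : realType.
Variable rho : R.
Hypotheses (rho0 : 0 < rho) (rho1 : rho < 1).
Variables (c : R[i]) (s : seq R[i]).
Hypotheses (c1 : normc c = 1) (hs : forall a, a \in s -> normc a < rho) (s0 : 0 \in s).
Notation K := (Kseq s).
Notation w1 := (@one_weight R).
Notation wd := (@dir_weight R).
Notation wb := (@berg_weight R).

Lemma ww_db k : w1 k ^+ 2 = wb k * wd k.
Proof. by rewrite /berg_weight /dir_weight mulVf ?expr1n. Qed.

Lemma c_neq0 : c != 0.
Proof. by rewrite -nc_eq0 c1 oner_eq0. Qed.

(** The two inequalities follow from those for the weight [k + 1] by testing the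
    expansion against [\sum_k (k + 1)^-1 g_k B^k], respectively against
    the truncations of [\sum_n (n + 1)^-1 p_n z^n]. *)
Lemma expansion_likeb : expansion_like c s wb.
Proof.
have [A [A0 hA]] := expansion_liked rho0 rho1 c1 hs s0.
exists A; split=> // m g hg.
have gx := geo_FS rho0 rho1 c hs m hg.
have gg k := Kseq_geo rho0 rho1 hs (hg k).
pose S := \sum_(k < m) wb k * en w1 (g k).
have [[v1 vd] vb] := (@wok1 R, @wokd R, @wokb R).
split; last first.
  pose h k n := (wb k)%:C * g k n.
  have hh k : K (h k) by exact: KseqZ.
  have gy := geo_FS rho0 rho1 c hs m hh.
  have e1 : ip w1 (FS c s m g) (FS c s m h) = S.
    rewrite (ip1_FS rho0 rho1 c1 hs) //; apply: eq_bigr => k _.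
    by rewrite (ipZr rho0 rho1 _ v1 (gg k) (gg k)).
  have e2 : \sum_(k < m) wd k * en w1 (h k) = S.
    apply: eq_bigr => k _; rewrite (enZ rho0 rho1 _ v1 (gg k)) nc_real.
    rewrite real_normK ?num_real // mulrA /dir_weight /berg_weight.
    by rewrite expr2 mulrA mulfV // mul1r.
  have [h1 _] := hA m h hh; rewrite e2 in h1.
  have := ip_amgm rho0 rho1 v1 vb vd A0 ww_db gx gy; rewrite e1.
  have h2 : A^-1 * en wd (FS c s m h) <= S by rewrite mulrC ler_pdivrMr // mulrC.
  rewrite /S in h2 *; lra.
apply: (en_bound rho0 rho1 vb gx) => J.
set p := FS c s m g; pose q n := if (n < J)%N then (wb n)%:C * p n else 0.
have q0 k : (J <= k)%N -> q k = 0 by rewrite /q ltnNge => ->.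
have q0' k : (maxn m J <= k)%N -> q k = 0 by rewrite geq_max => /andP[_]; exact: q0.
have [h [hh h0 qh]] := poly_FS c_neq0 s0 q0'.
pose g' k := if (k < m)%N then g k else fun=> 0.
have g'K k : K (g' k) by rewrite /g'; case: ifP => // _; exact: Kseq0.
have g'E : FS c s (maxn m J) g' = p.
  rewrite (@FS_pad _ c s m) ?leq_maxl //; last by move=> k; rewrite /g' ltnNge => ->.
  by apply: eq_FS => k km; rewrite /g' km.
have gq : geo rho q := geo_finite rho0 rho1 q0.
pose T := \sum_(k < J) wb k * normc (p k) ^+ 2.
have e1 : ip w1 p q = T.
  rewrite /ip (@tot_finite _ _ J); last by move=> k Jk; rewrite /dotw q0 // conjc0 !mulr0.
  apply: eq_bigr => k _; rewrite /dotw /q ltn_ord /one_weight mul1r nc_sqrE.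
  by rewrite !ReM !ReJ !ImJ !ReM !ImM /=; ring.
have e2 : en wd q = T.
  rewrite enE (@tot_finite _ _ J); last by move=> k Jk; rewrite q0 // nc0 expr0n mulr0.
  apply: eq_bigr => k _; rewrite /q ltn_ord ncM nc_real exprMn real_normK ?num_real //.
  rewrite mulrA; congr (_ * _); rewrite /dir_weight /berg_weight expr2 mulrA mulfV ?mul1r //.
have [_] := hA (maxn m J) h hh; rewrite -qh e2 => h1.
have gh k := Kseq_geo rho0 rho1 hs (hh k).
have gg' k := Kseq_geo rho0 rho1 hs (g'K k).
have h2 : 2 * T <= A * \sum_(k < maxn m J) wb k * en w1 (g' k) +
    A^-1 * \sum_(k < maxn m J) wd k * en w1 (h k).
  rewrite -e1 -{1}g'E {1}qh (ip1_FS rho0 rho1 c1 hs) // !mulr_sumr -big_split /=.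
  apply: ler_sum => k _; have wd0 : 0 < wd k by rewrite ltr0n.
  have t0 : 0 < A * wb k by rewrite mulr_gt0 // invr_gt0.
  have := ip_amgm rho0 rho1 v1 v1 v1 t0 _ (gg' k) (gh k).
  rewrite invfM invrK !mulrA; apply=> j; by rewrite /one_weight expr2.
have -> : \sum_(k < m) wb k * en w1 (g k) = \sum_(k < maxn m J) wb k * en w1 (g' k).
  rewrite -(subnKC (leq_maxl m J)) big_split_ord /= [X in _ + X]big1 ?addr0.
    by apply: eq_bigr => k _; rewrite /g' ltn_ord.
  move=> k _; rewrite /g' ltnNge leq_addr /= enE (@tot_finite _ _ 0) ?big_ord0 ?mulr0 //.
  by move=> j _; rewrite nc0 expr0n mulr0.
have h3 : A^-1 * \sum_(k < maxn m J) wd k * en w1 (h k) <= T.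
  by rewrite mulrC ler_pdivrMr // mulrC.
rewrite -/T; lra.
Qed.

End Duality.

(** * Blaschke expansions of sequences of finite energy *)

Section Existence.
Variable R : realType.
Variable rho : R.
Hypotheses (rho0 : 0 < rho) (rho1 : rho < 1).
Variables (c : R[i]) (s : seq R[i]).
Hypotheses (c1 : normc c = 1) (hs : forall a, a \in s -> normc a < rho) (s0 : 0 \in s).
Notation K := (Kseq s).
Notation w1 := (@one_weight R).
Implicit Types (x y : nat -> R[i]) (w : nat -> R).

Lemma cto_normc (u : nat -> R[i]) l : cto u l -> normc (u n) @[n --> \oo] --> normc l.
Proof.
move=> /ctoP h; apply/cvgnP => e e0; have [N hN] := h e e0; exists N => n Nn.
apply: (le_trans _ (hN n Nn)); rewrite ler_norml lerNl opprB nc_sub_le andbT.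
by rewrite ncC nc_sub_le.
Qed.

Lemma cvg_sum_ord (F : nat -> nat -> R) (L : nat -> R) m :
  (forall k, (k < m)%N -> F n k @[n --> \oo] --> L k) ->
  \sum_(k < m) F n k @[n --> \oo] --> \sum_(k < m) L k.
Proof.
elim: m => [|m IH] h.
  rewrite big_ord0 (_ : (fun n => _) = (fun=> 0)); first exact: cvg_cst.
  by apply/funext => n; rewrite big_ord0.
rewrite big_ord_recr /= (_ : (fun n => _) = (fun n => \sum_(k < m) F n k + F n m)).
  by apply: cvgD; [apply: IH => k km; apply: h; exact: ltnW|exact: h].
by apply/funext => n; rewrite big_ord_recr.
Qed.

Lemma sum_ord_le (F : nat -> R) m i : (forall k, 0 <= F k) -> (m <= i)%N ->
  \sum_(k < m) F k <= \sum_(k < i) F k.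
Proof.
by move=> F0 mi; rewrite -(subnKC mi) big_split_ord /= lerDl; apply: sumr_ge0.
Qed.

Lemma nc_sqrD (x y : R[i]) : normc (x + y) ^+ 2 <= 2 * normc x ^+ 2 + 2 * normc y ^+ 2.
Proof.
have h := ncD x y; have x0 := nc_ge0 x; have y0 := nc_ge0 y; have z0 := nc_ge0 (x + y).
apply: (@le_trans _ _ ((normc x + normc y) ^+ 2)).
  by rewrite lerXn2r ?nnegrE ?addr_ge0.
rewrite -subr_ge0 (_ : _ - _ = (normc x - normc y) ^+ 2) ?sqr_ge0 //; ring.
Qed.

(** Fatou's lemma: the bound holds for finitely many coefficients of finitely
    many terms, and each finite sum passes to the limit. *)
Lemma energies_closed w m (M : R) (G : nat -> nat -> nat -> R[i]) (g : nat -> nat -> R[i]) :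
  (forall k, 0 <= w k) -> (forall i k, geo rho (G i k)) -> (forall k, geo rho (g k)) ->
  (forall k n, cto (fun i => G i k n) (g k n)) ->
  (exists N, forall i, (N <= i)%N -> \sum_(k < m) w k * en w1 (G i k) <= M) ->
  \sum_(k < m) w k * en w1 (g k) <= M.
Proof.
move=> w0 hG hg hl [N hN].
have part p : \sum_(k < m) w k * \sum_(n < p) w1 n * normc (g k n) ^+ 2 <= M.
  pose F i k := w k * \sum_(n < p) w1 n * normc (G (i + N)%N k n) ^+ 2.
  pose L k := w k * \sum_(n < p) w1 n * normc (g k n) ^+ 2.
  apply: (@cvg_le_cst _ (fun i => \sum_(k < m) F i k) (\sum_(k < m) L k) M).
    apply: cvg_sum_ord => k _; apply: cvgMr.
    apply: (@cvg_sum_ord (fun i n => w1 n * normc (G (i + N)%N k n) ^+ 2)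
      (fun n => w1 n * normc (g k n) ^+ 2)) => n _.
    apply: cvgMr; rewrite expr2.
    by apply: cvgM; apply: cto_normc; apply: cto_shift (hl k n).
  move=> i; apply: le_trans (hN (i + N)%N (leq_addl _ _)).
  by apply: ler_sum => k _; rewrite ler_wpM2l // (en_partial rho0 rho1 p (@wok1 R)).
apply: (@cvg_le_cst _ (fun p => \sum_(k < m) w k * \sum_(n < p) w1 n * normc (g k n) ^+ 2)
  (\sum_(k < m) w k * en w1 (g k)) M) => //.
apply: (@cvg_sum_ord (fun p k => w k * \sum_(n < p) w1 n * normc (g k n) ^+ 2)
  (fun k => w k * en w1 (g k))).
move=> k _; apply: cvgMr; rewrite enE; apply: gd_cvg.
exact: (gd_en rho0 rho1 (@wok1 R)).
Qed.

(** The lower energy bound makes the expansions of the truncations of [a]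
    Cauchy, term by term; the upper one shows that the expansion formed by the
    limits converges to [a]. *)
Lemma expansion_exists w a X : wok w -> (forall k, 0 < w k) -> expansion_like c s w ->
  wle w a X -> exists g : nat -> nat -> R[i], [/\ forall k, K (g k),
    exists Y : R, forall m, \sum_(k < m) w k * en w1 (g k) <= Y &
    forall e : R, 0 < e -> exists N, forall m, (N <= m)%N ->
      wle w (fun n => a n - FS c s m g n) e].
Proof.
move=> vw w0 [A [A0 hA]] aX.
pose S j := \sum_(n < j) w n * normc (a n) ^+ 2.
have Sm : {homo S : i j / (i <= j)%N >-> i <= j}.
  move=> i j ij; rewrite /S -(subnKC ij) big_split_ord /= lerDl.
  by apply: sumr_ge0 => k _; rewrite mulr_ge0 ?sqr_ge0 // ltW.
have Scv : cvgn S.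
  apply: nondecreasing_is_cvgn => //; exists X => _ [j _ <-]; exact: aX.
pose eps j := limn S - S j.
have eps0 j : S j <= limn S := cvg_ge_partial Scv Sm j.
have epsl d : 0 < d -> exists N, forall j, (N <= j)%N -> eps j <= d.
  move=> d0; have [N hN] := (cvgnP _ _).1 Scv d d0; exists N => j Nj.
  by apply: le_trans (hN j Nj); rewrite distrC; exact: ler_norm.
pose tr j n := if (n < j)%N then a n else 0.
have tra j n : \sum_(k < n) w k * normc (a k - tr j k) ^+ 2 <= eps j.
  apply: (@le_trans _ _ (\sum_(k < j + n) w k * normc (a k - tr j k) ^+ 2)).
    rewrite addnC big_split_ord /= lerDl; apply: sumr_ge0 => k _.
    by rewrite mulr_ge0 ?sqr_ge0 // ltW.
  have -> : \sum_(k < j + n) w k * normc (a k - tr j k) ^+ 2 = S (j + n)%N - S j.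
    rewrite /S !big_split_ord /= [X in X + _]big1 => [|k _].
      rewrite add0r [RHS]addrC addKr; apply: eq_bigr => k _.
      by rewrite /tr ltnNge leq_addr subr0.
    by rewrite /tr ltn_ord subrr nc0 expr0n mulr0.
  by rewrite lerD2r.
have trS i j n : (j <= i)%N -> \sum_(k < n) w k * normc (tr i k - tr j k) ^+ 2 <= eps j.
  move=> ji; apply: le_trans (tra j n); apply: ler_sum => k _.
  rewrite ler_wpM2l ?(ltW (w0 _)) // lerXn2r ?nnegrE ?nc_ge0 // {1}/tr.
  by case: ltnP => // ik; rewrite /tr ltnNge (leq_trans ji ik) subrr nc0 nc_ge0.
have tr0 j n : (j <= n)%N -> tr j n = 0 by rewrite /tr ltnNge => ->.
have /choice[G hG] : forall j, exists g, [/\ forall k, K (g k),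
    forall k, (j <= k)%N -> g k = (fun=> 0) & tr j = FS c s j g].
  by move=> j; apply: poly_FS => //; [exact: c_neq0 c1|exact: tr0].
have GK j k : K (G j k) by have [] := hG j.
have Ggeo j k := Kseq_geo rho0 rho1 hs (GK j k).
have key i j m : (j <= i)%N -> (m <= i)%N ->
    \sum_(k < m) w k * en w1 (fun n => G i k n - G j k n) <= A * eps j.
  move=> ji mi; have DK k : K (fun n => G i k n - G j k n) by exact: KseqB.
  have [_ h] := hA i _ DK.
  have e1 : FS c s i (fun k n => G i k n - G j k n) = (fun n => tr i n - tr j n).
    rewrite -FSB; have [_ _ <-] := hG i; have [_ Gj0 ->] := hG j.
    by rewrite (FS_pad c s ji Gj0).
  rewrite e1 in h; apply: (@le_trans _ _ (A * en w (fun n => tr i n - tr j n))).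
    apply: le_trans h.
    apply: (@sum_ord_le (fun k => w k * en w1 (fun n => G i k n - G j k n))) mi => k; rewrite mulr_ge0 ?(ltW (w0 _)) //.
    exact: (en1_K_ge0 rho0 rho1 hs).
  rewrite ler_pM2l //; apply: (en_bound rho0 rho1 vw).
    by rewrite -e1; exact: (geo_FS rho0 rho1 c hs i DK).
  by move=> n; exact: trS.
have hl k n : exists l, cto (fun i => G i k n) l.
  apply: cto_cauchy => e e0.
  have d0 : 0 < w k * e ^+ 2 / A by rewrite divr_gt0 ?mulr_gt0 ?exprn_gt0.
  have [N hN] := epsl _ d0; exists (maxn N k.+1).
  have half i j : (j <= i)%N -> (maxn N k.+1 <= j)%N -> normc (G i k n - G j k n) <= e.
    rewrite geq_max => ji /andP[Nj kj]; have ki := leq_trans kj ji.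
    have h1 := key i j k.+1 ji ki.
    have gD : geo rho (fun n => G i k n - G j k n) by exact: geoB.
    apply: (le_trans (nc_le_en1 rho0 rho1 n gD)).
    rewrite -[leRHS](ger0_norm (ltW e0)) -sqrtr_sqr ler_wsqrtr //.
    rewrite -(ler_pM2l (w0 k)); apply: (@le_trans _ _ (A * eps j)).
      apply: le_trans h1; rewrite big_ord_recr /= lerDr; apply: sumr_ge0 => p _.
      by rewrite mulr_ge0 ?(ltW (w0 _)) // (en1_K_ge0 rho0 rho1 hs) //; exact: KseqB.
    have := hN j Nj; rewrite ler_pdivlMr // mulrC; exact.
  move=> i j Ni Nj; have [ij|/ltnW ji] := leqP i j; last exact: half.
  by rewrite ncC; exact: half.
have /choice[g hg] : forall k, exists x, forall n, cto (fun i => G i k n) (x n).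
  by move=> k; have [x hx] := choice (hl k); exists x.
have gK k : K (g k) := Kseq_closed (fun j => GK j k) (hg k).
have ggeo k := Kseq_geo rho0 rho1 hs (gK k).
have lim j m : \sum_(k < m) w k * en w1 (fun n => g k n - G j k n) <= A * eps j.
  apply: (@energies_closed w m _ (fun i k n => G i k n - G j k n)
    (fun k n => g k n - G j k n)).
  - by move=> k; exact: ltW.
  - by move=> i k; exact: geoB.
  - by move=> k; exact: geoB.
  - by move=> k n; apply: ctoB => //; exact: cto_cst.
  by exists (maxn j m) => i; rewrite geq_max => /andP[ji mi]; exact: key.
exists g; split=> //.
  exists (A * eps 0%N) => m; apply: le_trans (lim 0%N m).
  rewrite le_eqVlt; apply/orP; left; apply/eqP; apply: eq_bigr => k _.
  congr (_ * en _ _); apply/funext => n; have [_ G0 _] := hG 0%N.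
  by rewrite G0 // subr0.
move=> e e0; have q0 : 0 < 2 + 2 * A ^+ 2 by have := sqr_ge0 A; lra.
have d0 : 0 < e / (2 + 2 * A ^+ 2) by rewrite divr_gt0.
have [j /(_ j (leqnn j)) hj] := epsl _ d0; exists j => m jm n.
have DK k : K (fun n => g k n - G j k n) by exact: KseqB.
have e1 : FS c s m (fun k n => g k n - G j k n) = (fun n => FS c s m g n - tr j n).
  by rewrite -FSB; have [_ Gj0 ->] := hG j; rewrite (FS_pad c s jm Gj0).
have [h1 _] := hA m _ DK; rewrite e1 in h1.
have gD : geo rho (fun n => FS c s m g n - tr j n).
  by rewrite -e1; exact: (geo_FS rho0 rho1 c hs m DK).
have h2 := en_partial rho0 rho1 n vw gD.
have h3 : A * (\sum_(k < m) w k * en w1 (fun n => g k n - G j k n)) <= A * (A * eps j).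
  by rewrite ler_pM2l.
have h4 := tra j n.
apply: (@le_trans _ _ (2 * \sum_(k < n) w k * normc (a k - tr j k) ^+ 2 +
    2 * \sum_(k < n) w k * normc (FS c s m g k - tr j k) ^+ 2)).
  rewrite !mulr_sumr -big_split /=; apply: ler_sum => k _.
  rewrite !(mulrCA 2 (w k)) -mulrDr ler_wpM2l ?(ltW (w0 _)) //.
  rewrite (ncC (FS _ _ _ _ _)) (_ : a k - FS c s m g k = (a k - tr j k) + (tr j k - FS c s m g k)).
    exact: nc_sqrD.
  by rewrite addrA subrK.
move: hj; rewrite ler_pdivlMr //; lra.
Qed.

End Existence.

(** * The model space *)

Section ModelSpace.
Variable R : realType.
Variable rho : R.
Hypotheses (rho0 : 0 < rho) (rho1 : rho < 1).
Variables (B : R[i] -> R[i]) (c : R[i]) (s : seq R[i]).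
Hypotheses (c1 : normc c = 1) (hs : forall a, a \in s -> normc a < rho).
Hypothesis hB : forall z, disc z ->
  B z = c * \prod_(a <- s) ((z - a) / (1 - conjc a * z)).
Notation w1 := (@one_weight R).
Implicit Types (x y h : nat -> R[i]) (w : nat -> R).

Let hs1 a : a \in s -> normc a < 1.
Proof. by move=> /hs /lt_trans; exact. Qed.

Lemma wle_geo w x : wok w -> geo rho x -> wle w x (en w x).
Proof. by move=> vw hx n; exact: (en_partial rho0 rho1 n vw hx). Qed.

Lemma wle1_bounded x X : wle w1 x X -> bounded x.
Proof.
move=> hx; exists (Num.sqrt X) => n.
rewrite -(ger0_norm (nc_ge0 (x n))) -sqrtr_sqr ler_wsqrtr //.
apply: le_trans (hx n.+1); rewrite big_ord_recr /= /one_weight mul1r lerDr.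
by apply: sumr_ge0 => k _; rewrite mul1r sqr_ge0.
Qed.

Lemma hardy_wle f x : rep f x -> hardy f -> exists X, wle w1 x X.
Proof. by move=> fx [_ ff]; exact: hardy_norm_fin fx ff. Qed.

Lemma wle_hardy f x X : rep f x -> wle w1 x X -> hardy f.
Proof.
move=> fx hX; split; first exact: rep_holo fx.
by apply: le_lt_trans (hardy_norm_le fx hX) _; rewrite ltry.
Qed.

(** The coefficients of [B g] are bounded for [g] in the Hardy space and those
    of [h] decay geometrically, so the boundary pairing is the coefficient
    pairing. *)
Lemma Kseq_model (h : R[i] -> R[i]) x : rep h x -> Kseq s x -> model_space B h.
Proof.
move=> hx xK; have gx := Kseq_geo rho0 rho1 hs xK.
split; first exact: wle_hardy hx (wle_geo (@wok1 R) gx).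
move=> g hg; have [y gy] := holo_rep hg.1; have [Y hY] := hardy_wle gy hg.
have yb := wle1_bounded hY; have [M hM] := MB_bounded c hs1 yb.
have M0 : 0 <= M := le_trans (nc_ge0 _) (hM 0%N).
have [C [C0 hC]] := gx.
apply: (hardy_innerE hx (rep_MB hs1 hB gy) (ltW rho0) rho1 (C := C * M)).
  by move=> k; rewrite ncM nc_conj mulrAC; apply: ler_pM; rewrite ?nc_ge0.
exact: (Kseq_orth rho0 rho1).
Qed.

Lemma rep_foldr_den f x t : rep f x ->
  rep (fun z => \prod_(a <- t) (1 - conjc a * z) * f z) (foldr den x t).
Proof.
move=> fx; elim: t => [|a t IH] /=.
  by apply: (rep_ext _ _ fx) => // z _; rewrite big_nil mul1r.
by apply: (rep_ext _ _ (rep_den a IH)) => // z _; rewrite big_cons mulrA.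
Qed.

Definition finite_supp x : Prop := exists n, forall k, (n <= k)%N -> x k = 0.

Lemma finite_supp_num a x : finite_supp x -> finite_supp (num a x).
Proof.
move=> [n hn]; exists n.+1 => -[//|k] nk.
by rewrite /num /sh !hn ?mulr0 ?subr0 // ltnW.
Qed.

Lemma finite_supp_lim h x : True -> finite_supp x -> cto (fun n => h n * conjc (x n)) 0.
Proof.
move=> _ [n hn]; apply/ctoP => e e0; exists n => k nk.
by rewrite hn // conjc0 mulr0 subr0 nc0 ltW.
Qed.

(** Testing orthogonality against the multiples of [B] by
    [z^j \prod_(a <- s) (1 - a^* z)], which are polynomials, gives
    the linear equations that cut out the model space. *)
Lemma model_Kseq (h : R[i] -> R[i]) x : rep h x -> model_space B h -> Kseq s x.
Proof.
move=> hx [hh horth].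
suff E j : foldr den x s (j + size s)%N = 0.
  by move=> n sn; rewrite -(subnK sn).
pose d k : R[i] := (k == j)%:R.
have dj : finite_supp d.
  by exists j.+1 => k jk; rewrite /d gtn_eqF.
have gq := rep_foldr_den s (@rep_pow R j).
have dq : geo rho (foldr den d s).
  apply: geo_fden => //; have [n hn] := dj; exact: geo_finite hn.
have hq := horth _ (wle_hardy gq (wle_geo (@wok1 R) dq)).
have MBE : MB c s (foldr den d s) = (fun n => c * foldr num d s n).
  by rewrite /MB foldr_bf foldr_iden_den.
have gMB := rep_MB hs1 hB gq; rewrite MBE in gMB.
have [n hn] : finite_supp (foldr num d s).
  by elim: (s) => //= a t IH; exact: finite_supp_num.
have hsum : cto (fun n => \sum_(k < n) foldr anum x s k * conjc (d k)) (foldr anum x s j).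
  apply/ctoP => e e0; exists j.+1 => k jk.
  rewrite (bigD1 (Ordinal jk)) //= big1 => [|i ij].
    by rewrite /d eqxx conjc1 mulr1 addr0 subrr nc0 ltW.
  by rewrite /d -val_eqE /= in ij *; rewrite (negPf ij) conjc0 mulr0.
have h1 := fnum_adjoint (P := fun=> True) (fun _ _ _ => I) finite_supp_num finite_supp_lim
   I dj hsum.
have h2 : cto (fun n => \sum_(k < n) x k * conjc (c * foldr num d s k))
    (conjc c * foldr anum x s j).
  apply: cto_eq (ctoZ (conjc c) h1) => p.
  by rewrite mulr_sumr; apply: eq_bigr => k _; rewrite rmorphM mulrCA.
have [|C [q [C0 q0 q1 hC]]] := @gd_finite R (fun k => normc (x k * conjc (c * foldr num d s k))) n.
  by move=> k nk; rewrite hn // mulr0 conjc0 mulr0 nc0.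
have e : conjc c * foldr anum x s j = 0.
  rewrite -(hardy_innerE hx gMB q0 q1 (C := C) _ h2) //.
  by move=> k; apply: le_trans (hC k); exact: ler_norm.
move/eqP: e; rewrite mulf_eq0 -nc_eq0 nc_conj c1 oner_eq0 /= => /eqP <-.
by rewrite foldr_anum.
Qed.

(** For [m = size s] this is the function with coefficients [h], when
    [Kseq s h]; smaller [m] truncate the numerator and serve for induction. *)
Definition Kfun_sum m h : R[i] -> R[i] := fun z =>
  \sum_(i < m) foldr den h s i * (z ^+ i / \prod_(a <- s) (1 - conjc a * z)).
Notation Kfun := (Kfun_sum (size s)).

Lemma rep_foldr_iden f x : rep f x ->
  rep (fun z => f z / \prod_(a <- s) (1 - conjc a * z)) (foldr iden x s).
Proof.
move=> fx; elim: (s) hs1 => [|a t IH] ht /=.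
  by apply: (rep_ext _ _ fx) => // z _; rewrite big_nil divr1.
have a1 : normc a < 1 by apply: ht; rewrite inE eqxx.
have ht' b : b \in t -> normc b < 1 by move=> bt; apply: ht; rewrite inE bt orbT.
apply: (rep_ext _ _ (rep_iden a1 (IH ht'))) => // z _.
by rewrite big_cons invfM mulrCA mulrC.
Qed.

Lemma rep_poly m x : rep (fun z => \sum_(i < m) x i * z ^+ i) (fun k => if (k < m)%N then x k else 0).
Proof.
move=> z _; apply/ctoP => e e0; exists m => n mn.
rewrite /psum -(subnKC mn) big_split_ord /= [X in _ + X - _]big1 => [|k _].
  rewrite addr0 (eq_bigr (fun i : 'I_m => x i * z ^+ i)) ?subrr ?nc0 ?ltW // => i _.
  by rewrite ltn_ord.
by rewrite ltnNge leq_addr mul0r.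
Qed.

Lemma Kfun_sum_rep m h : rep (Kfun_sum m h)
  (foldr iden (fun k => if (k < m)%N then foldr den h s k else 0) s).
Proof.
apply: (rep_ext _ _ (rep_foldr_iden (rep_poly m (foldr den h s)))) => // z _.
by rewrite mulr_suml; apply: eq_bigr => i _; rewrite mulrA.
Qed.

Lemma Kfun_sum_model m h : (m <= size s)%N -> model_space B (Kfun_sum m h).
Proof.
move=> ms; apply: Kseq_model (Kfun_sum_rep m h) _ => n sn.
rewrite foldr_den_iden.
by rewrite ltnNge (leq_trans ms sn).
Qed.

End ModelSpace.

(** * From coefficient sequences back to functions *)

Section Main.
Variable R : realType.
Variable rho : R.
Hypotheses (rho0 : 0 < rho) (rho1 : rho < 1).
Variables (B : R[i] -> R[i]) (c : R[i]) (s : seq R[i]).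
Hypotheses (c1 : normc c = 1) (hs : forall a, a \in s -> normc a < rho) (s0 : 0 \in s).
Hypothesis hB : forall z, disc z ->
  B z = c * \prod_(a <- s) ((z - a) / (1 - conjc a * z)).
Variable N : (R[i] -> R[i]) -> R.
Hypothesis hN : is_norm_on (model_space B) N.
Notation w1 := (@one_weight R).
Notation Kfun := (Kfun_sum s (size s)).
Implicit Types (x y h : nat -> R[i]) (w : nat -> R).

Let hs1 a : a \in s -> normc a < 1.
Proof. by move=> /hs /lt_trans; exact. Qed.

Definition Kbasis i : R[i] -> R[i] := fun z => z ^+ i / \prod_(a <- s) (1 - conjc a * z).

Lemma Kbasis_model (k : R[i]) i : (i < size s)%N -> model_space B (fun z => k * Kbasis i z).
Proof.
move=> hi; have h := rep_foldr_iden rho1 hs (@rep_pow R i).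
apply: (Kseq_model rho0 rho1 hs hB (repZ k h)); apply: KseqZ => n sn.
by rewrite foldr_den_iden gtn_eqF // (leq_trans hi sn).
Qed.

Lemma norm_Kfun_sum m h : (m <= size s)%N ->
  N (Kfun_sum s m h) <= \sum_(i < m) normc (foldr den h s i) * N (Kbasis i).
Proof.
elim: m => [|m IH] ms.
  have V0 := Kfun_sum_model rho0 rho1 hs hB h ms.
  rewrite big_ord0 (norm_on_eq0 hN V0).2 // => z _.
  by rewrite /Kfun_sum big_ord0.
have -> : Kfun_sum s m.+1 h = (fun z => Kfun_sum s m h z + foldr den h s m * Kbasis m z).
  by apply/funext => z; rewrite /Kfun_sum big_ord_recr.
have Vm := Kfun_sum_model rho0 rho1 hs hB h (ltnW ms).
apply: (le_trans (norm_onD hN Vm (Kbasis_model _ ms))).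
rewrite big_ord_recr /=; apply: lerD; first by apply: IH; exact: ltnW.
rewrite (norm_onZ hN) //; have := Kbasis_model 1 ms.
by congr (model_space B _); apply/funext => z; rewrite mul1r.
Qed.

(** The coefficients of the numerator are controlled by the energy of [h]; the
    triangle inequality in the given norm does the rest. *)
Lemma norm_Kfun : exists C : R, 0 <= C /\ forall h, Kseq s h -> N (Kfun h) ^+ 2 <= C * en w1 h.
Proof.
have Nb i : (i < size s)%N -> 0 <= N (Kbasis i).
  move=> hi; have := Kbasis_model 1 hi; rewrite (_ : (fun z => _) = Kbasis i).
    exact: (norm_on_ge0 hN).
  by apply/funext => z; rewrite mul1r.
pose D := \sum_(i < size s) 2 ^+ size s * N (Kbasis i).
have D0 : 0 <= D by apply: sumr_ge0 => i _; rewrite mulr_ge0 ?exprn_ge0 ?Nb.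
exists (D ^+ 2); split=> [|h hK]; first exact: sqr_ge0.
have gh := Kseq_geo rho0 rho1 hs hK.
have e0 := en_ge0 rho0 rho1 (@wok1 R) gh.
rewrite -(sqr_sqrtr e0) -exprMn lerXn2r ?nnegrE //.
- exact: (norm_on_ge0 hN (Kfun_sum_model rho0 rho1 hs hB h (leqnn _))).
- by rewrite mulr_ge0 ?sqrtr_ge0.
apply: (le_trans (norm_Kfun_sum h (leqnn _))); rewrite mulr_suml; apply: ler_sum => i _.
rewrite mulrAC ler_wpM2r ?Nb //.
by apply: (fden_bound hs1) => n; exact: (nc_le_en1 rho0 rho1 n gh).
Qed.

Lemma rep_series m (g : nat -> R[i] -> R[i]) (x : nat -> nat -> R[i]) :
  (forall k, rep (g k) (x k)) ->
  rep (fun z => \sum_(k < m) g k z * B z ^+ k) (FS c s m x).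
Proof.
elim: m g x => [|m IH] g x gx.
  by move=> z _; apply: cto_eq (cto_cst _) => n; rewrite big_ord0 /psum big1 // => k _; rewrite mul0r.
have h := repD (gx 0%N) (rep_MB hs1 hB (IH (fun k => g k.+1) (fun k => x k.+1) (fun k => gx k.+1))).
apply: (rep_ext _ _ h) => // z _.
rewrite big_ord_recl expr0 mulr1 mulr_sumr; congr (_ + _); apply: eq_bigr => k _.
by rewrite exprS mulrCA.
Qed.

Lemma wleD w x y X Y : (forall k, 0 <= w k) -> wle w x X -> wle w y Y ->
  wle w (fun n => x n + y n) (2 * X + 2 * Y).
Proof.
move=> w0 hx hy n; apply: (@le_trans _ _ (2 * (\sum_(k < n) w k * normc (x k) ^+ 2) +
  2 * \sum_(k < n) w k * normc (y k) ^+ 2)); last by rewrite lerD // ler_wpM2l.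
rewrite !mulr_sumr -big_split /=; apply: ler_sum => k _.
by rewrite !(mulrCA 2 (w k)) -mulrDr ler_wpM2l // nc_sqrD.
Qed.

(** Finite energy yields the expansion by [expansion_exists]. Conversely the
    partial sums of a Blaschke series have geometrically decaying coefficients,
    so [f] has finite energy as soon as one remainder has. *)
Lemma blaschke_characterization (nrm : (R[i] -> R[i]) -> \bar R) w (v : nat -> R -> R)
    (f : R[i] -> R[i]) :
  holomorphic_on_disc f ->
  norm_like nrm w -> (forall u, (0 <= nrm u)%E) ->
  wok w -> (forall k, 0 < w k) -> expansion_like c s w ->
  (forall k t, v k t = w k * t ^+ 2) ->
  (nrm f < +oo)%E <-> exists g : nat -> R[i] -> R[i],
    [/\ forall k, model_space B (g k), blaschke_series_cvg nrm B g f &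
      (\sum_(0 <= k <oo) (v k (N (g k)))%:E < +oo)%E].
Proof.
move=> hf [C [C0 hnrm]] nrm0 vw w0 hexp hv; have [a fa] := holo_rep hf.
have w0' k : 0 <= w k by exact: ltW.
split.
  move=> /(hnrm _ _ fa).2[X aX].
  have [x [xK [Y hY] hcvg]] := expansion_exists rho0 rho1 c1 hs s0 vw w0 hexp aX.
  have [D [D0 hD]] := norm_Kfun.
  have rx k : rep (Kfun (x k)) (x k).
    apply: (rep_ext _ _ (Kfun_sum_rep rho1 hs (size s) (x k))) => // n.
    rewrite -{2}(foldr_iden_den (x k) s); congr (foldr iden _ s n); apply/funext => j.
    by case: ltnP => // sj; rewrite xK.
  exists (fun k => Kfun (x k)); split.
  - by move=> k; apply: (Kfun_sum_model rho0 rho1 hs hB).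
  - have small (e : R) : 0 < e -> exists M, forall m, (M <= m)%N ->
        (nrm (fun z => f z - \sum_(k < m) Kfun (x k) z * B z ^+ k)%R <= e%:E)%E.
      move=> e0; have d0 : 0 < e ^+ 2 / (C + 1) by rewrite divr_gt0 ?exprn_gt0 // ltr_wpDl.
      have [M hM] := hcvg _ d0; exists M => m Mm.
      have h := (hnrm _ _ (repB fa (rep_series m rx))).1 _ (hM m Mm).
      apply: (le_trans h); rewrite lee_fin -[leRHS](ger0_norm (ltW e0)) -sqrtr_sqr.
      rewrite ler_wsqrtr // mulrCA ler_piMr ?sqr_ge0 // ler_pdivrMr ?ltr_wpDl //.
      by rewrite mul1r lerDl.
    apply/fine_cvgP; split.
      have [M hM] := small 1 ltr01; exists M => // m /= Mm.
      rewrite ge0_fin_numE //; apply: le_lt_trans (hM m Mm) _; exact: ltry.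
    apply/cvgnP => e e0; have [M hM] := small e e0; exists M => m Mm.
    rewrite subr0 /= ger0_norm ?fine_ge0 // -lee_fin fineK ?hM //.
    rewrite ge0_fin_numE //; apply: le_lt_trans (hM m Mm) _; exact: ltry.
  apply: le_lt_trans (eseries_le (X := D * Y) _ _) _; last exact: ltry.
    by move=> k; rewrite hv mulr_ge0 ?sqr_ge0.
  move=> n; apply: (@le_trans _ _ (D * \sum_(k < n) w k * en w1 (x k))).
    rewrite mulr_sumr; apply: ler_sum => k _; rewrite hv [leRHS]mulrCA ler_wpM2l //; exact: hD.
  by rewrite ler_wpM2l.
move=> [g [gV /fine_cvgP[[M _ hM] _] _]].
have /choice[x gx] : forall k, exists x, rep (g k) x.
  by move=> k; apply: holo_rep; have [[]] := gV k.
have xK k : Kseq s (x k) by exact: (model_Kseq rho0 rho1 c1 hs hB (gx k) (gV k)).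
have hr := repB fa (rep_series M gx).
have := hM M (leqnn M); rewrite /= ge0_fin_numE // => /((hnrm _ _ hr).2)[X hX].
have gy := geo_FS rho0 rho1 c hs M xK.
have h := wleD w0' hX (wle_geo rho0 rho1 vw gy).
have h' : wle w a (2 * X + 2 * en w (FS c s M x)).
  by move=> n; have := h n; under eq_bigr do rewrite subrK.
by apply: le_lt_trans ((hnrm _ _ fa).1 _ h') _; rewrite ltry.
Qed.

End Main.

Lemma radius_exists (R : realType) (s : seq R[i]) : (forall a, a \in s -> disc a) ->
  exists rho : R, [/\ 0 < rho, rho < 1 & forall a, a \in s -> normc a < rho].
Proof.
elim: s => [|a s IH] hs; first by exists 2^-1; split=> //; rewrite invf_lt1 // ltr1n.
have [|rho [r0 r1 hr]] := IH; first by move=> b bs; apply: hs; rewrite inE bs orbT.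
have a1 : normc a < 1 by apply: hs; rewrite inE eqxx.
have a0 := nc_ge0 a.
exists (Num.max rho ((1 + normc a) / 2)); split.
- by rewrite lt_max r0.
- by rewrite gt_max r1 /=; lra.
move=> b; rewrite inE => /orP[/eqP ->|bs]; rewrite lt_max; first by apply/orP; right; lra.
by rewrite hr.
Qed.

Theorem theorem2p1 (R : realType) (B : R[i] -> R[i])
    (N : (R[i] -> R[i]) -> R) (f : R[i] -> R[i])
    (hB : finite_blaschke_product B) (hB0 : B 0 = 0)
    (hN : is_norm_on (model_space B) N)
    (hf : holomorphic_on_disc f) :
  [/\ hardy f <->
        (exists g : nat -> R[i] -> R[i],
          [/\ forall k, model_space B (g k),
              blaschke_series_cvg (@hardy_norm R) B g f &
              (\sum_(0 <= k <oo) (N (g k) ^+ 2)%:E < +oo)%E]),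
      dirichlet f <->
        (exists g : nat -> R[i] -> R[i],
          [/\ forall k, model_space B (g k),
              blaschke_series_cvg (@dirichlet_norm R) B g f &
              (\sum_(0 <= k <oo) (k.+1%:R * N (g k) ^+ 2)%:E < +oo)%E]) &
      bergman f <->
        (exists g : nat -> R[i] -> R[i],
          [/\ forall k, model_space B (g k),
              blaschke_series_cvg (@bergman_norm R) B g f &
              (\sum_(0 <= k <oo) (N (g k) ^+ 2 / k.+1%:R)%:E < +oo)%E])].
Proof.
have [c [s [c1 hs hBs]]] := hB; have [rho [r0 r1 hr]] := radius_exists hs.
have s0 : 0 \in s.
  have d0 : disc (0 : R[i]) by rewrite /disc /mkset nc0.
  have /eqP := hBs 0 d0; rewrite hB0 eq_sym mulf_eq0 -nc_eq0 c1 oner_eq0 /=.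
  rewrite prodf_seq_eq0 => /hasP[a as_ /= /eqP h0].
  by move: h0 as_; rewrite sub0r mulr0 subr0 divr1 => /eqP; rewrite oppr_eq0 => /eqP ->.
have main := blaschke_characterization r0 r1 c1 hr s0 hBs hN.
have split_hol (nrm : (R[i] -> R[i]) -> \bar R) (P : Prop) :
    ((nrm f < +oo)%E <-> P) -> (holomorphic_on_disc f /\ (nrm f < +oo)%E <-> P).
  by move=> [h1 h2]; split=> [[_]|/h2].
split; apply: split_hol.
- apply: (main _ _ (fun k t => t ^+ 2) _ hf (@hardy_norm_like R)
    (fun u => sqrte_ge0 _) (@wok1 R) _ (expansion_like1 r0 r1 c1 hr)) => // k t.
  by rewrite mul1r.
- apply: (main _ _ (fun k t => k.+1%:R * t ^+ 2) _ hf (@dirichlet_norm_like R)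
    (fun u => sqrte_ge0 _) (@wokd R) _ (expansion_liked r0 r1 c1 hr s0)) => k //.
- apply: (main _ _ (fun k t => t ^+ 2 / k.+1%:R) _ hf (@bergman_norm_like R)
    (fun u => sqrte_ge0 _) (@wokb R) _ (expansion_likeb r0 r1 c1 hr s0)) => k.
    by rewrite /berg_weight invr_gt0 ltr0n.
  by move=> t; rewrite mulrC.
Qed.
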